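(* Let $\alpha>1$, $\omega>0$, $p\ge0$. The linearised integral equation \[ l(x)=-2p+\int_\omega^{+\infty}K_\alpha\!\left(\tfrac{x}{y}\right)l(y)\frac{dy}{y},\qquad x\in[\omega,+\infty), \] admits a unique solution $l=l(\cdot;\omega,p):[\omega,+\infty)\to\mathbb{R}$ normalised so that $\lim_{x\to+\infty}x^{-\frac{1+\alpha}{2\alpha}}l(x)=1$. It is given by $l(x;\omega,p)=\bar l(\frac{x}{\omega};\omega,p)$ with \[ \bar l(\xi;\omega,p)=p\,\tau(\xi)-\frac{2\alpha}{1+\alpha}\left[p-\left(\frac{\omega}{A}\right)^{\frac{1+\alpha}{2\alpha}}\right]D_\xi\tau(\xi),\qquad \xi\ge1, \] and moreover $\bar l(1;\omega,p)=\sqrt{2(1+\alpha)}\left[\left(\frac{\omega}{A}\right)^{\frac{1+\alpha}{2\alpha}}-p\right]$ (understood as the limit $\xi\to1^+$ where derivatives are involved).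
   Context: $K_\alpha(x)=\frac{\sin(\frac{2\pi}{1+\alpha})}{\pi}\frac{x}{1+x^2-2x\cos(\frac{2\pi}{1+\alpha})}$; $D_\xi=\xi\frac{d}{d\xi}$. Let $\rho=\frac{\alpha+1}{\alpha}\alpha^{\frac{1}{\alpha+1}}$, $V(u;x)=xu^2-u^{2\alpha+2}-1$; for $x>\rho$ let $0<u_1(x)<u_2(x)$ be the two positive zeros of $V(\cdot;x)$, $S(x)=\frac1\pi\int_{u_1(x)}^{u_2(x)}\sqrt{V(u;x)}\frac{du}{u}$, and $S(x)=0$ for $0\le x\le\rho$. Let $\tau(\xi)=2(1+\alpha)S(\rho\xi)$ and $A=(1+\alpha)\left(\frac{1}{\sqrt{\pi\alpha}}\frac{\Gamma(\frac{1}{2\alpha})}{\Gamma(\frac{1+\alpha}{2\alpha})}\right)^{\frac{2\alpha}{\alpha+1}}$. *)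

(* Defs.v *)
From Stdlib Require Import Reals Lra ClassicalEpsilon.
From Coquelicot Require Import Coquelicot.
Open Scope R_scope.

Definition Gamma (s : R) : R :=
  RInt_gen (fun t => Rpower t (s - 1) * exp (- t)) (at_right 0) (Rbar_locally p_infty).

Definition theta (alpha : R) : R := 2 * PI / (1 + alpha).

Definition K (alpha x : R) : R :=
  sin (theta alpha) / PI * (x / (1 + x ^ 2 - 2 * x * cos (theta alpha))).

Definition rho (alpha : R) : R :=
  (alpha + 1) / alpha * Rpower alpha (1 / (alpha + 1)).

Definition V (alpha u x : R) : R :=
  x * u ^ 2 - Rpower u (2 * alpha + 2) - 1.

(* For x > rho: the pair (u1(x), u2(x)) of the two positive zeros of V(.;x),
   0 < u1 < u2 (chosen by Hilbert's epsilon; determined uniquely for x > rho). *)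
Definition zeros (alpha x : R) : R * R :=
  epsilon (inhabits (0, 0))
    (fun q : R * R => 0 < fst q < snd q /\ V alpha (fst q) x = 0 /\ V alpha (snd q) x = 0).
Definition u1 (alpha x : R) : R := fst (zeros alpha x).
Definition u2 (alpha x : R) : R := snd (zeros alpha x).

Definition S (alpha x : R) : R :=
  if Rle_dec x (rho alpha) then 0
  else / PI * RInt (fun u => sqrt (V alpha u x) / u) (u1 alpha x) (u2 alpha x).

Definition tau (alpha xi : R) : R := 2 * (1 + alpha) * S alpha (rho alpha * xi).

Definition Dtau (alpha xi : R) : R := xi * Derive (tau alpha) xi.

Definition Aconst (alpha : R) : R :=
  (1 + alpha) *
  Rpower (/ sqrt (PI * alpha) * (Gamma (1 / (2 * alpha)) / Gamma ((1 + alpha) / (2 * alpha))))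
         (2 * alpha / (alpha + 1)).

Definition gam (alpha : R) : R := (1 + alpha) / (2 * alpha).

Definition solves_eq (alpha omega p : R) (l : R -> R) : Prop :=
  forall x, omega <= x ->
    is_RInt_gen (fun y => K alpha (x / y) * l y / y)
      (at_point omega) (Rbar_locally p_infty) (l x + 2 * p).

Definition normalised (alpha : R) (l : R -> R) : Prop :=
  is_lim (fun x => Rpower x (- gam alpha) * l x) p_infty 1.

Definition lbar (alpha omega p xi : R) : R :=
  p * tau alpha xi
  - 2 * alpha / (1 + alpha) * (p - Rpower (omega / Aconst alpha) (gam alpha)) * Dtau alpha xi.

(* Main.v *)
Require Import Defs.
From Stdlib Require Import Reals Lra ClassicalEpsilon.
From Coquelicot Require Import Coquelicot.
Open Scope R_scope.

(** Put [t = ln u] and [W(t) = x e^(2t) - e^((2 alpha + 2) t) - 1], so that [pi S(x)] is the integral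
    over the real line of [sqrt W], the square root of a negative number being [0].

    Rotating [t] to [t + i phi] up to [phi = theta / 2 = pi / (alpha + 1)] turns [W] into
    [x e^(i theta) u^2 - u^(2 alpha + 2) - 1].  For [x > rho] the values of [W] on the open strip avoid the
    negative half-line, so Cauchy's theorem on rectangles, applied to the principal root, gives
    [pi S(x) + theta / 2] as the integral of [Re sqrt W] on the rotated line; the constant is the
    contribution of [t -> -oo], where [sqrt W -> i].  On the other hand the kernel [K (x / y) / y] is
    the Poisson kernel that maps [sqrt (y - a)] to [Re sqrt (x e^(i theta) - a)], and Tonelli's theorem turns the
    rotated integral into [pi] times the integral of [K (x / y) S(y) / y].  Hence
    [S(x) + 1 / (1 + alpha)] is the transform of [S] on [rho, +oo).

    This transform is smooth in [x], which makes [S] differentiable and, by an integration by parts,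
    [x S'(x)] a nonnegative solution of the homogeneous equation.  Its value at [rho] comes from the
    quadratic minimum of the potential, its growth from [S ~ C x^gam] by Landau interpolation, and
    [C] from a Beta integral.  Comparison with this solution yields uniqueness. *)

(** * Continuous functions on the plane and integrals over the line *)

(** No complex integral is formed: the real part p and the imaginary part q of the root are explicit
    real functions, and Cauchy's theorem says that the phi-derivative of the integral of p over
    [t0, t1] is q(t0) - q(t1). At the angle pi / (alpha + 1) the power u^(2 alpha + 2) has turned
    once around, so the rotated W is e^(2t) (x e^(i theta) - level(t)): the same potential, with x
    made complex. As t -> +oo, q is not small but close to -e^((alpha+1) t) cos((alpha+1) phi),
    whose integral over [0, pi / (alpha + 1)] is 0; the error decays because alpha > 1.

    The infinite slope of the root at the zeros of W obstructs differentiating S under its own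
    integral; in the integral equation the smooth kernel carries the derivative instead. S has a
    corner at rho (slope 0 on the left, positive on the right), so statements at rho pass through a
    function T differentiable on all of (0, +oo). Because roots of negative numbers and S below rho
    are both 0, the integrands are continuous on the whole line or plane, and Tonelli's theorem is
    proved for continuous nonnegative functions only. The factor 2 (1 + alpha) in [tau] turns the
    constant 1 / (1 + alpha) into 2. *)

Ltac req := match goal with |- @eq _ ?u ?v => change (@eq R u v) end.

Lemma locally_R (x : R) (P : R -> Prop) (d : R) :
  0 < d -> (forall y : R, Rabs (y - x) < d -> P y) -> locally x P.
Proof. intros Hd H. exists (mkposreal d Hd). intros y Hy. apply H, Hy. Qed.

Lemma ex_derive_continuity_pt (f : R -> R) (x : R) : ex_derive f x -> continuity_pt f x.
Proof.
  intros H. apply continuity_pt_filterlim.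
  now apply (ex_derive_continuous (K := R_AbsRing) (V := R_NormedModule)).
Qed.

Lemma cont_scal (c : R) (f : R -> R) (x : R) : continuous f x -> continuous (fun t => c * f t) x.
Proof. apply (continuous_scal_r (V := R_NormedModule) c f). Qed.

Lemma cont_plus (f g : R -> R) (x : R) :
  continuous f x -> continuous g x -> continuous (fun t => f t + g t) x.
Proof. apply (continuous_plus (V := R_NormedModule) f g). Qed.

Lemma cont_minus (f g : R -> R) (x : R) :
  continuous f x -> continuous g x -> continuous (fun t => f t - g t) x.
Proof. apply (continuous_minus (V := R_NormedModule) f g). Qed.

Lemma cont_mult (f g : R -> R) (x : R) :
  continuous f x -> continuous g x -> continuous (fun t => f t * g t) x.
Proof. apply (continuous_mult (K := R_AbsRing) f g). Qed.

Lemma ex_RInt_cont_on (f : R -> R) (a b : R) :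
  a <= b -> (forall x : R, a <= x <= b -> continuous f x) -> ex_RInt f a b.
Proof.
  intros Hab H. apply (ex_RInt_continuous (V := R_CompleteNormedModule)).
  now rewrite Rmin_left, Rmax_right by trivial.
Qed.

Lemma RInt_R_correct (f : R -> R) (a b : R) : ex_RInt f a b -> is_RInt f a b (RInt f a b).
Proof. apply (RInt_correct (V := R_CompleteNormedModule)). Qed.

Lemma continuous_RInt_param (f : R -> R -> R) (a b y0 : R) :
  (forall x y, continuity_2d_pt f x y) ->
  continuous (fun y => RInt (fun t => f t y) a b) y0.
Proof.
  intros Hf.
  assert (Hex : forall y c d, ex_RInt (fun t => f t y) c d).
  { intros y c d. apply (@ex_RInt_continuous R_CompleteNormedModule).
    intros z _. apply continuity_pt_filterlim.
    intros eps Heps. destruct (Hf z y (mkposreal eps Heps)) as [d0 Hd0].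
    exists d0. split; [apply cond_pos|].
    intros u [_ Hu]. apply Hd0; [exact Hu | rewrite Rminus_diag, Rabs_R0; apply cond_pos]. }
  assert (Hle : forall a b, a <= b -> continuous (fun y => RInt (fun t => f t y) a b) y0).
  { clear a b. intros a b Hab. apply continuity_pt_filterlim. intros eps Heps.
    assert (He : 0 < eps / (b - a + 1)) by (apply Rdiv_lt_0_compat; lra).
    destruct (uniform_continuity_2d_1d f a b y0 (fun x _ => Hf x y0) (mkposreal _ He)) as [d Hd].
    exists d. split; [apply cond_pos|].
    intros y [_ Hy]. simpl in Hy |- *. unfold R_dist in *.
    rewrite <- (RInt_minus (V := R_CompleteNormedModule)); [|apply Hex|apply Hex].
    apply Rle_lt_trans with ((b - a) * (eps / (b - a + 1))).
    - apply abs_RInt_le_const; [exact Hab| |].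
      + apply (ex_RInt_minus (V := R_NormedModule)); apply Hex.
      + intros t Ht. left. apply Rabs_lt_between' in Hy.
        pose proof (cond_pos d).
        apply (Hd t y0 t y); try lra.
        rewrite Rminus_diag, Rabs_R0. lra.
    - apply Rlt_le_trans with ((b - a + 1) * (eps / (b - a + 1))).
      + apply Rmult_lt_compat_r; lra.
      + right. field. lra. }
  destruct (Rle_lt_dec a b) as [Hab | Hab]; [now apply Hle|].
  apply (continuous_ext (fun y => opp (RInt (fun t => f t y) b a))).
  - intros y. apply (opp_RInt_swap (V := R_CompleteNormedModule)), Hex.
  - apply (continuous_opp (V := R_NormedModule)), Hle. lra.
Qed.

Lemma continuity_2d_swap (f : R -> R -> R) (x y : R) :
  continuity_2d_pt f y x -> continuity_2d_pt (fun u v => f v u) x y.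
Proof.
  intros H eps. destruct (H eps) as [d Hd]. exists d. intros u v Hu Hv. now apply Hd.
Qed.

Lemma continuity_2d_fst (f : R -> R -> R) (x y : R) :
  continuity_2d_pt f x y -> continuous (fun u => f u y) x.
Proof.
  intros H. apply continuity_pt_filterlim. intros eps Heps.
  destruct (H (mkposreal eps Heps)) as [d Hd].
  exists d. split; [apply cond_pos|].
  intros u [_ Hu]. apply Hd; [exact Hu | rewrite Rminus_diag, Rabs_R0; apply cond_pos].
Qed.

Lemma continuity_2d_snd (f : R -> R -> R) (x y : R) :
  continuity_2d_pt f x y -> continuous (fun v => f x v) y.
Proof.
  intros H. apply (continuity_2d_fst (fun u v => f v u)), continuity_2d_swap, H.
Qed.

Lemma ex_RInt_cont (f : R -> R) (a b : R) :
  (forall x : R, continuous f x) -> ex_RInt f a b.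
Proof. intros H. apply (@ex_RInt_continuous R_CompleteNormedModule). intros; apply H. Qed.

(** As functions of the upper limit [b], both sides have the derivative [RInt (fun y => f b y) c d]
    and vanish at [b = a]. *)
Lemma Fubini_rectangle (f : R -> R -> R) (a b c d : R) :
  (forall x y, continuity_2d_pt f x y) -> a <= b ->
  RInt (fun t => RInt (fun y => f t y) c d) a b
  = RInt (fun y => RInt (fun t => f t y) a b) c d.
Proof.
  intros Hf Hab.
  assert (C1 : forall y t, continuous (fun t => f t y) t)
    by (intros; apply (continuity_2d_fst f), Hf).
  assert (C2 : forall t : R, continuous (fun t => RInt (fun y => f t y) c d) t).
  { intros t. apply (continuous_RInt_param (fun y t => f t y)).
    intros; apply continuity_2d_swap, Hf. }
  assert (D1 : forall z, is_derive (fun z => RInt (fun t => RInt (fun y => f t y) c d) a z) z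
                           (RInt (fun y => f z y) c d)).
  { intros z. apply (is_derive_RInt (V := R_NormedModule)
      (fun t => RInt (fun y => f t y) c d) _ a); [|apply C2].
    apply filter_forall. intros z'. apply RInt_R_correct.
    apply ex_RInt_cont, C2. }
  assert (D0 : forall y z, is_derive (fun z => RInt (fun t => f t y) a z) z (f z y)).
  { intros y z. apply (is_derive_RInt (V := R_NormedModule) (fun t => f t y) _ a); [|apply C1].
    apply filter_forall. intros z'. apply RInt_R_correct.
    apply ex_RInt_cont, C1. }
  assert (D2 : forall z, is_derive (fun z => RInt (fun y => RInt (fun t => f t y) a z) c d) z
                           (RInt (fun y => f z y) c d)).
  { intros z.
    assert (E : RInt (fun y => f z y) c d
      = RInt (fun y => Derive (fun z => RInt (fun t => f t y) a z) z) c d).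
    { apply RInt_ext. intros y _. symmetry. apply is_derive_unique, D0. }
    rewrite E.
    apply (is_derive_RInt_param (fun z y => RInt (fun t => f t y) a z)).
    - apply filter_forall. intros z' y _. eexists. apply D0.
    - intros y _. apply (continuity_2d_pt_ext f); [|apply Hf].
      intros u v. symmetry. apply is_derive_unique, D0.
    - apply filter_forall. intros z'. apply ex_RInt_cont.
      intros y. now apply continuous_RInt_param. }
  destruct (Req_dec a b) as [<- | Hne].
  { rewrite !(RInt_point (V := R_CompleteNormedModule)).
    transitivity (RInt (fun _ : R => 0) c d).
    - rewrite (RInt_const (V := R_CompleteNormedModule)). unfold scal; simpl.
      unfold mult; simpl. unfold zero; simpl. ring.
    - apply RInt_ext. intros y _. symmetry. apply (RInt_point (V := R_CompleteNormedModule)). }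
  set (g := fun z => RInt (fun t => RInt (fun y => f t y) c d) a z
                     - RInt (fun y => RInt (fun t => f t y) a z) c d).
  assert (Hg : g a = g b).
  { apply (eq_is_derive (V := R_NormedModule)); [|lra].
    intros z _. unfold g.
    replace (@zero R_NormedModule) with (minus (RInt (fun y => f z y) c d) (RInt (fun y => f z y) c d))
      by apply (minus_eq_zero (G := R_AbelianGroup)).
    apply (is_derive_minus (V := R_NormedModule)); [apply D1 | apply D2]. }
  assert (Hga : g a = 0).
  { unfold g. rewrite (RInt_point (V := R_CompleteNormedModule)).
    replace (RInt (fun y => RInt (fun t => f t y) a a) c d) with 0.
    - unfold zero; simpl. ring.
    - transitivity (RInt (fun _ : R => 0) c d).
      + rewrite (RInt_const (V := R_CompleteNormedModule)). unfold scal; simpl.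
        unfold mult; simpl. ring.
      + apply RInt_ext. intros y _. symmetry. apply (RInt_point (V := R_CompleteNormedModule)). }
  unfold g in Hg, Hga. lra.
Qed.

(** * Integrals of continuous functions over the whole line *)

Lemma RInt_Rmult (f : R -> R) (a b c : R) :
  ex_RInt f a b -> RInt (fun t => c * f t) a b = c * RInt f a b.
Proof. apply (RInt_scal (V := R_CompleteNormedModule)). Qed.

Lemma RInt_Rplus (f g : R -> R) (a b : R) :
  ex_RInt f a b -> ex_RInt g a b -> RInt (fun t => f t + g t) a b = RInt f a b + RInt g a b.
Proof. apply (RInt_plus (V := R_CompleteNormedModule)). Qed.

Lemma RInt_Rminus (f g : R -> R) (a b : R) :
  ex_RInt f a b -> ex_RInt g a b -> RInt (fun t => f t - g t) a b = RInt f a b - RInt g a b.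
Proof. apply (RInt_minus (V := R_CompleteNormedModule)). Qed.

Lemma RInt_Rconst (a b c : R) : RInt (fun _ => c) a b = (b - a) * c.
Proof. apply (RInt_const (V := R_CompleteNormedModule)). Qed.

(** The two ends move independently, so this is genuine improper convergence and not a principal
    value. [RInt] being total, integrability on windows is no part of the notion; the lemmas that
    rely on it assume continuity. *)
Definition line_integral (f : R -> R) (I : R) : Prop :=
  forall eps, 0 < eps -> exists M, forall a b, a <= - M -> M <= b -> Rabs (RInt f a b - I) < eps.

Lemma RInt_cont_Chasles (f : R -> R) (a b c : R) :
  (forall x : R, continuous f x) -> RInt f a b + RInt f b c = RInt f a c.
Proof.
  intros H. apply (RInt_Chasles (V := R_CompleteNormedModule)); now apply ex_RInt_cont.
Qed.

Lemma RInt_cont_le (f g : R -> R) (a b : R) :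
  a <= b -> (forall x : R, continuous f x) -> (forall x : R, continuous g x) ->
  (forall x, a < x < b -> f x <= g x) -> RInt f a b <= RInt g a b.
Proof. intros. apply RInt_le; trivial; now apply ex_RInt_cont. Qed.

Lemma RInt_cont_ge_0 (f : R -> R) (a b : R) :
  a <= b -> (forall x : R, continuous f x) -> (forall x, 0 <= f x) -> 0 <= RInt f a b.
Proof. intros. apply RInt_ge_0; trivial. now apply ex_RInt_cont. Qed.

Lemma RInt_window_le (f : R -> R) (a b c d : R) :
  (forall x : R, continuous f x) -> (forall x, 0 <= f x) ->
  c <= a -> a <= b -> b <= d -> RInt f a b <= RInt f c d.
Proof.
  intros Hc H0 Hca Hab Hbd.
  rewrite <- (RInt_cont_Chasles f c a d), <- (RInt_cont_Chasles f a b d) by trivial.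
  pose proof (RInt_cont_ge_0 f c a Hca Hc H0). pose proof (RInt_cont_ge_0 f b d Hbd Hc H0). lra.
Qed.

Lemma line_integral_unique (f : R -> R) (I J : R) :
  line_integral f I -> line_integral f J -> I = J.
Proof.
  intros HI HJ. apply Rminus_diag_uniq. apply cond_eq. intros eps He.
  destruct (HI (eps / 2)) as [M HM]; [lra|]. destruct (HJ (eps / 2)) as [N HN]; [lra|].
  specialize (HM (- Rmax M N) (Rmax M N)). specialize (HN (- Rmax M N) (Rmax M N)).
  pose proof (Rmax_l M N). pose proof (Rmax_r M N).
  specialize (HM ltac:(lra) ltac:(lra)). specialize (HN ltac:(lra) ltac:(lra)).
  apply Rabs_def2 in HM. apply Rabs_def2 in HN. apply Rabs_def1; lra.
Qed.

Lemma line_integral_ext (f g : R -> R) (I : R) :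
  (forall x, f x = g x) -> line_integral f I -> line_integral g I.
Proof.
  intros H HI eps He. destruct (HI eps He) as [M HM]. exists M. intros a b Ha Hb.
  rewrite <- (RInt_ext f g) by (intros; apply H). auto.
Qed.

Lemma line_integral_RInt_le (f : R -> R) (I a b : R) :
  (forall x : R, continuous f x) -> (forall x, 0 <= f x) -> line_integral f I ->
  a <= b -> RInt f a b <= I.
Proof.
  intros Hc H0 HI Hab. apply le_epsilon. intros eps He.
  destruct (HI eps He) as [M HM].
  specialize (HM (Rmin a (- M)) (Rmax b M) (Rmin_r _ _) (Rmax_r _ _)).
  assert (RInt f a b <= RInt f (Rmin a (- M)) (Rmax b M)).
  { apply RInt_window_le; trivial. apply Rmin_l. apply Rmax_l. }
  apply Rabs_def2 in HM. lra.
Qed.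

(** The value is the supremum of the integrals over all windows. *)
Lemma line_integral_bounded (f : R -> R) (B : R) :
  (forall x : R, continuous f x) -> (forall x, 0 <= f x) ->
  (forall a b, a <= b -> RInt f a b <= B) -> exists I, line_integral f I.
Proof.
  intros Hc H0 HB.
  destruct (completeness (fun v => exists a b, a <= b /\ v = RInt f a b)) as [I [HI1 HI2]].
  - exists B. intros v (a & b & Hab & ->). auto.
  - exists (RInt f 0 0), 0, 0. split; [lra | reflexivity].
  - exists I. intros eps He.
    destruct (Classical_Prop.classic (exists a b, a <= b /\ I - eps < RInt f a b)) as [(a & b & Hab & H) | H].
    + exists (Rmax (- a) b). intros a' b' Ha' Hb'.
      pose proof (Rmax_l (- a) b). pose proof (Rmax_r (- a) b).
      assert (RInt f a b <= RInt f a' b') by (apply RInt_window_le; trivial; lra).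
      assert (RInt f a' b' <= I) by (apply HI1; exists a', b'; split; [lra | reflexivity]).
      apply Rabs_def1; lra.
    + exfalso. assert (I <= I - eps); [|lra].
      apply HI2. intros v (a & b & Hab & ->).
      destruct (Rle_lt_dec (RInt f a b) (I - eps)); trivial.
      exfalso. apply H. exists a, b. auto.
Qed.

Lemma RInt_shift (f : R -> R) (a b c : R) :
  (forall x : R, continuous f x) -> RInt (fun t => f (t + c)) a b = RInt f (a + c) (b + c).
Proof.
  intros Hc.
  pose proof (RInt_comp_lin (V := R_CompleteNormedModule) f 1 c a b) as H.
  rewrite !Rmult_1_l in H. rewrite <- H by now apply ex_RInt_cont.
  apply RInt_ext. intros x _. unfold scal; simpl. unfold mult; simpl. rewrite !Rmult_1_l. reflexivity.
Qed.

Lemma line_integral_shift (f : R -> R) (I c : R) :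
  (forall x : R, continuous f x) -> line_integral f I -> line_integral (fun t => f (t + c)) I.
Proof.
  intros Hc HI eps He. destruct (HI eps He) as [M HM]. exists (M + Rabs c).
  intros a b Ha Hb. rewrite RInt_shift by trivial.
  pose proof (Rle_abs c). pose proof (Rle_abs (- c)). rewrite Rabs_Ropp in *.
  apply HM; lra.
Qed.

Lemma line_integral_scal (f : R -> R) (I c : R) :
  (forall x : R, continuous f x) -> line_integral f I -> line_integral (fun t => c * f t) (c * I).
Proof.
  intros Hc HI eps He.
  assert (Hp : 0 < eps / (Rabs c + 1)).
  { apply Rdiv_lt_0_compat; trivial. pose proof (Rabs_pos c); lra. }
  destruct (HI _ Hp) as [M HM]. exists M.
  intros a b Ha Hb.
  rewrite RInt_Rmult by now apply ex_RInt_cont.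
  rewrite <- Rmult_minus_distr_l, Rabs_mult.
  specialize (HM a b Ha Hb). pose proof (Rabs_pos c).
  apply Rle_lt_trans with (Rabs c * (eps / (Rabs c + 1))).
  - apply Rmult_le_compat_l; lra.
  - apply Rlt_le_trans with ((Rabs c + 1) * (eps / (Rabs c + 1))).
    + apply Rmult_lt_compat_r; lra.
    + right. field. lra.
Qed.

(* Dini's theorem; the index bound is encoded in the gauge as [delta t <= / N t], so that
   the compactness lemma delivers a common index. *)
Lemma line_integral_uniform (f : R -> R -> R) (G : R -> R) (A B eps : R) :
  (forall x y, continuity_2d_pt f x y) -> (forall x y, 0 <= f x y) ->
  (forall t : R, continuous G t) -> (forall t, line_integral (f t) (G t)) -> 0 < eps ->
  exists n, 0 < n /\ forall t, A <= t <= B -> G t - RInt (f t) (- n) n <= eps.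
Proof.
  intros Hf H0 HG HI He.
  assert (Cf : forall t y, continuous (f t) y).
  { intros t y. apply (continuity_2d_snd f), Hf. }
  assert (Hloc : forall t, exists d : posreal, forall u, Rabs (u - t) < d ->
            G u - RInt (f u) (- / d) (/ d) <= eps).
  { intros t.
    destruct (HI t (eps / 2)) as [M HM]; [lra|].
    set (N := Rmax M 1).
    assert (HN : 1 <= N) by apply Rmax_r.
    specialize (HM (- N) N). assert (M <= N) by apply Rmax_l.
    specialize (HM ltac:(lra) ltac:(lra)).
    assert (C : continuous (fun u => G u - RInt (f u) (- N) N) t).
    { apply (cont_minus); [apply HG|].
      apply (continuous_RInt_param (fun y u => f u y)). intros; apply continuity_2d_swap, Hf. }
    apply continuity_pt_filterlim in C.
    destruct (C (eps / 2)) as [d [Hd C']]; [lra|].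
    assert (Hd' : 0 < Rmin d (/ N)).
    { apply Rmin_glb_lt; trivial. apply Rinv_0_lt_compat. lra. }
    exists (mkposreal _ Hd'). simpl. intros u Hu.
    assert (Hinv : N <= / Rmin d (/ N)).
    { apply Rle_trans with (/ / N); [rewrite Rinv_inv; lra|]. apply Rinv_le_contravar; [trivial | apply Rmin_r]. }
    assert (RInt (f u) (- N) N <= RInt (f u) (- / Rmin d (/ N)) (/ Rmin d (/ N))).
    { apply RInt_window_le; auto; lra. }
    assert (Hcl : G u - RInt (f u) (- N) N < eps).
    { destruct (Req_dec u t) as [-> | Hne].
      - apply Rabs_def2 in HM. lra.
      - simpl in C'. unfold R_dist in C'.
        specialize (C' u). apply Rabs_def2 in HM.
        assert (Hq : Rabs (G u - RInt (f u) (- N) N - (G t - RInt (f t) (- N) N)) < eps / 2).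
        { apply C'. split. split; auto. unfold no_cond; auto.
          eapply Rlt_le_trans; [exact Hu | apply Rmin_l]. }
        apply Rabs_def2 in Hq. lra. }
    lra. }
  set (delta := fun t => proj1_sig (constructive_indefinite_description _ (Hloc t))).
  assert (Hdelta : forall t u, Rabs (u - t) < delta t ->
            G u - RInt (f u) (- / delta t) (/ delta t) <= eps).
  { intros t. exact (proj2_sig (constructive_indefinite_description _ (Hloc t))). }
  destruct (compactness_value_1d A B delta) as [d Hd].
  pose proof (cond_pos d) as Hdp.
  exists (/ d). split; [now apply Rinv_0_lt_compat|].
  intros t Ht. apply Classical_Prop.NNPP. intros Hn. apply (Hd t Ht).
  intros (s & Hs & Hst & Hds). apply Hn.
  specialize (Hdelta s t Hst).
  assert (/ delta s <= / d) by (apply Rinv_le_contravar; lra).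
  assert (0 < / delta s) by (apply Rinv_0_lt_compat, cond_pos).
  assert (RInt (f t) (- / delta s) (/ delta s) <= RInt (f t) (- / d) (/ d)).
  { apply RInt_window_le; auto; lra. }
  lra.
Qed.

(** Both inequalities are read off rectangles. On a compact window [line_integral_uniform] replaces
    the inner improper integral by one over [[-n, n]] up to a uniform error, [Fubini_rectangle]
    exchanges the order, and nonnegativity enlarges the windows. Uniformity is where the continuity
    of the marginals [G] and [H] enters. *)
Lemma Tonelli_line (f : R -> R -> R) (G H : R -> R) (I : R) :
  (forall x y, continuity_2d_pt f x y) -> (forall x y, 0 <= f x y) ->
  (forall t : R, continuous G t) -> (forall y : R, continuous H y) ->
  (forall t, line_integral (fun y => f t y) (G t)) ->
  (forall y, line_integral (fun t => f t y) (H y)) ->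
  line_integral G I -> line_integral H I.
Proof.
  intros Hf H0 CG CH HG HH HI.
  assert (Hfs : forall x y, continuity_2d_pt (fun u v => f v u) x y).
  { intros; apply continuity_2d_swap, Hf. }
  assert (C1 : forall t y, continuous (fun y => f t y) y).
  { intros. apply (continuity_2d_snd f), Hf. }
  assert (C2 : forall y t, continuous (fun t => f t y) t).
  { intros. apply (continuity_2d_fst f), Hf. }
  assert (C3 : forall a b y, continuous (fun y => RInt (fun t => f t y) a b) y).
  { intros. now apply continuous_RInt_param. }
  assert (C4 : forall a b t, continuous (fun t => RInt (fun y => f t y) a b) t).
  { intros. now apply (continuous_RInt_param (fun y t => f t y)). }
  assert (G0 : forall t, 0 <= G t).
  { intros t. eapply Rle_trans; [|apply (line_integral_RInt_le (f t) (G t) 0 1); auto; lra].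
    apply RInt_cont_ge_0; auto; lra. }
  assert (HH0 : forall y, 0 <= H y).
  { intros y. eapply Rle_trans; [|apply (line_integral_RInt_le (fun t => f t y) (H y) 0 1); auto; lra].
    apply RInt_cont_ge_0; auto; lra. }
  assert (Up : forall a b, a <= b -> RInt H a b <= I).
  { intros a b Hab. apply le_epsilon. intros eps He.
    assert (Hp : 0 < eps / (b - a + 1)) by (apply Rdiv_lt_0_compat; lra).
    destruct (line_integral_uniform (fun y t => f t y) H a b _ Hfs (fun x y => H0 y x) CH HH Hp)
      as (n & Hn & Hu).
    apply Rle_trans with (RInt (fun y => RInt (fun t => f t y) (- n) n + eps / (b - a + 1)) a b).
    { apply RInt_cont_le; trivial.
      - intros y. apply (cont_plus); [apply C3 | apply continuous_const].
      - intros y Hy. specialize (Hu y ltac:(lra)). simpl in Hu. lra. }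
    rewrite (RInt_Rplus (fun y => RInt (fun t => f t y) (- n) n) (fun _ => eps / (b - a + 1))), RInt_Rconst
      by (apply ex_RInt_cont; intros; apply continuous_const || apply C3).
    rewrite <- Fubini_rectangle by (trivial; lra).
    assert (RInt (fun t => RInt (fun y => f t y) a b) (- n) n <= RInt G (- n) n).
    { apply RInt_cont_le; auto; try lra.
      intros t _. apply line_integral_RInt_le; auto. }
    assert (RInt G (- n) n <= I) by (apply line_integral_RInt_le; auto; lra).
    assert ((b - a) * (eps / (b - a + 1)) <= eps).
    { apply Rle_trans with ((b - a + 1) * (eps / (b - a + 1))).
      - apply Rmult_le_compat_r; lra.
      - right. field. lra. }
    lra. }
  intros eps He.
  destruct (HI (eps / 2)) as [M HM]; [lra|].
  set (N := Rmax M 1). assert (HN : 1 <= N) by apply Rmax_r.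
  assert (HMN : M <= N) by apply Rmax_l.
  specialize (HM (- N) N ltac:(lra) ltac:(lra)). apply Rabs_def2 in HM.
  (* Over the window of length [2 * N] this tolerance costs [eps / 2]; the other half is the tail of
     [G]. *)
  assert (Hp : 0 < eps / (4 * N)) by (apply Rdiv_lt_0_compat; lra).
  destruct (line_integral_uniform f G (- N) N _ Hf H0 CG HG Hp) as (n & Hn & Hu).
  exists n. intros a b Ha Hb.
  specialize (Up a b ltac:(lra)).
  assert (RInt H (- n) n <= RInt H a b) by (apply RInt_window_le; auto; lra).
  assert (RInt G (- N) N <= RInt (fun t => RInt (fun y => f t y) (- n) n + eps / (4 * N)) (- N) N).
  { apply RInt_cont_le; auto; try lra.
    - intros y. apply (cont_plus); [apply C4 | apply continuous_const].
    - intros y Hy. specialize (Hu y ltac:(lra)). change (fun y0 => f y y0) with (f y). lra. }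
  rewrite (RInt_Rplus (fun t => RInt (fun y => f t y) (- n) n) (fun _ => eps / (4 * N))), RInt_Rconst in H2
    by (apply ex_RInt_cont; intros; apply continuous_const || apply C4).
  rewrite Fubini_rectangle in H2 by (trivial; lra).
  assert (RInt (fun y => RInt (fun t => f t y) (- N) N) (- n) n <= RInt H (- n) n).
  { apply RInt_cont_le; auto; try lra.
    intros y _. apply (line_integral_RInt_le (fun t => f t y)); auto; lra. }
  assert ((N - - N) * (eps / (4 * N)) = eps / 2) by (field; lra).
  apply Rabs_def1; lra.
Qed.

(** * The Gamma function *)

Ltac smooth := apply (ex_derive_continuous (K := R_AbsRing) (V := R_NormedModule)); auto_derive; auto.

(** Limits at +oo with explicit thresholds, which combine by [Rmax] and [lra]; [tends_is_lim]
    identifies them with the limits of the theorem. *)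
Definition tends (F : R -> R) (l : R) : Prop :=
  forall eps, 0 < eps -> exists M, forall x, M <= x -> Rabs (F x - l) < eps.

Lemma tends_exp_neg (c : R) : 0 < c -> tends (fun x => exp (- c * x)) 0.
Proof.
  intros Hc eps He. exists (- ln eps / c + 1). intros x Hx.
  rewrite Rminus_0_r, Rabs_pos_eq by (left; apply exp_pos).
  rewrite <- (exp_ln eps) at 1 by trivial. apply exp_increasing.
  assert (c * (- ln eps / c + 1) <= c * x) by (apply Rmult_le_compat_l; lra).
  replace (c * (- ln eps / c + 1)) with (- ln eps + c) in H by (field; lra). lra.
Qed.

Lemma tends_squeeze (F G : R -> R) (l : R) :
  (exists N, forall x, N <= x -> Rabs (F x - l) <= G x) -> tends G 0 -> tends F l.
Proof.
  intros [N HN] HG eps He. destruct (HG eps He) as [M HM]. exists (Rmax N M). intros x Hx.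
  pose proof (Rmax_l N M). pose proof (Rmax_r N M).
  specialize (HN x ltac:(lra)). specialize (HM x ltac:(lra)).
  apply Rabs_def2 in HM. lra.
Qed.

Lemma tends_scal (F : R -> R) (l c : R) : tends F l -> tends (fun x => c * F x) (c * l).
Proof.
  intros HF eps He.
  assert (Hc : 0 < Rabs c + 1) by (pose proof (Rabs_pos c); lra).
  destruct (HF (eps / (Rabs c + 1))) as [M HM]; [now apply Rdiv_lt_0_compat|].
  exists M. intros x Hx. specialize (HM x Hx).
  rewrite <- Rmult_minus_distr_l, Rabs_mult.
  apply Rle_lt_trans with (Rabs c * (eps / (Rabs c + 1))).
  - apply Rmult_le_compat_l; [apply Rabs_pos | lra].
  - apply Rlt_le_trans with ((Rabs c + 1) * (eps / (Rabs c + 1))).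
    + apply Rmult_lt_compat_r; [|lra]. apply Rdiv_lt_0_compat; lra.
    + right. field. lra.
Qed.

Lemma tends_plus (F G : R -> R) (l m : R) :
  tends F l -> tends G m -> tends (fun x => F x + G x) (l + m).
Proof.
  intros HF HG eps He.
  destruct (HF (eps / 2)) as [M HM]; [lra|]. destruct (HG (eps / 2)) as [N HN]; [lra|].
  exists (Rmax M N). intros x Hx.
  pose proof (Rmax_l M N). pose proof (Rmax_r M N).
  specialize (HM x ltac:(lra)). specialize (HN x ltac:(lra)).
  apply Rabs_def2 in HM. apply Rabs_def2 in HN. apply Rabs_def1; lra.
Qed.

Lemma atan_tends (F : R -> R) :
  (forall B, exists M, forall x, M <= x -> B <= F x) -> tends (fun x => atan (F x)) (PI / 2).
Proof.
  intros HF eps He.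
  (* The cap at 1/2 keeps [PI / 2 - e] inside the principal branch, as [atan_tan] requires. *)
  set (e := Rmin eps 1 / 2).
  assert (He1 : 0 < e <= 1 / 2).
  { unfold e. pose proof (Rmin_r eps 1). assert (0 < Rmin eps 1) by (apply Rmin_glb_lt; lra). lra. }
  assert (He2 : e < eps).
  { unfold e in *. pose proof (Rmin_l eps 1). lra. }
  pose proof PI2_1.
  destruct (HF (tan (PI / 2 - e) + 1)) as [M HM]. exists M. intros x Hx. specialize (HM x Hx).
  assert (atan (tan (PI / 2 - e)) < atan (F x)) by (apply atan_increasing; lra).
  rewrite atan_tan in H0 by lra.
  pose proof (atan_bound (F x)). apply Rabs_def1; lra.
Qed.

(** The limit [m] at -oo is stated as the limit of [F (- x)] at +oo, so that [tends] serves both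
    ends. *)
Lemma line_integral_primitive (F f : R -> R) (l m : R) :
  (forall x : R, is_derive F x (f x)) -> (forall x : R, continuous f x) ->
  tends F l -> tends (fun x => F (- x)) m -> line_integral f (l - m).
Proof.
  intros HD HC Hl Hm eps He.
  destruct (Hl (eps / 2)) as [M HM]; [lra|]. destruct (Hm (eps / 2)) as [N HN]; [lra|].
  exists (Rmax M N). intros a b Ha Hb.
  pose proof (Rmax_l M N). pose proof (Rmax_r M N).
  specialize (HM b ltac:(lra)). specialize (HN (- a) ltac:(lra)). rewrite Ropp_involutive in HN.
  rewrite (is_RInt_unique f a b (minus (F b) (F a))).
  - unfold minus, plus, opp; simpl. apply Rabs_def2 in HM. apply Rabs_def2 in HN. apply Rabs_def1; lra.
  - apply (is_RInt_derive (V := R_CompleteNormedModule)); intros; auto.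
Qed.

(** The integrand t^(z-1) e^(-t) dt after t = e^s, Jacobian included. On the whole line, scaling of
    t becomes translation of s. *)
Definition gamma_density (z s : R) : R := exp (z * s - exp s).

Lemma continuous_gamma_density (z s : R) : continuous (gamma_density z) s.
Proof. unfold gamma_density. smooth. Qed.

Lemma gamma_density_pos (z s : R) : 0 < gamma_density z s.
Proof. apply exp_pos. Qed.

(** The maximum over s of exp((z+1) s - e^s), attained at s = ln(z+1). *)
Definition gamma_tail (z : R) : R := exp (- (z + 1) * (1 - ln (z + 1))).

(* [exp s >= c (1 + s - ln c)] is the tangent line of [exp] at [ln c], here with [c = z + 1]. *)
Lemma gamma_density_le_right (z s : R) :
  0 < z -> gamma_density z s <= gamma_tail z * exp (- s).
Proof.
  intros Hz. unfold gamma_density, gamma_tail. rewrite <- exp_plus.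
  assert (H : (z + 1) * (1 + (s - ln (z + 1))) <= exp s).
  { replace (exp s) with ((z + 1) * exp (s - ln (z + 1))).
    - apply Rmult_le_compat_l; [lra|]. apply exp_ineq1_le.
    - unfold Rminus. rewrite exp_plus, exp_Ropp, exp_ln by lra. field. lra. }
  destruct (Rle_lt_or_eq_dec _ _ (Rplus_le_compat_l (z * s) _ _ (Ropp_le_contravar _ _ H))) as [H1 | H1].
  - left. apply exp_increasing. lra.
  - right. f_equal. lra.
Qed.

Lemma gamma_density_le_left (z s : R) : gamma_density z s <= exp (z * s).
Proof.
  unfold gamma_density. left. apply exp_increasing. pose proof (exp_pos s). lra.
Qed.

Lemma RInt_exp_lin (c a b : R) : c <> 0 ->
  RInt (fun s => exp (c * s)) a b = (exp (c * b) - exp (c * a)) / c.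
Proof.
  intros Hc. apply is_RInt_unique.
  replace ((exp (c * b) - exp (c * a)) / c) with (minus (exp (c * b) / c) (exp (c * a) / c))
    by (unfold minus, plus, opp; simpl; field; trivial).
  apply (is_RInt_derive (V := R_CompleteNormedModule) (fun s => exp (c * s) / c)).
  - intros x _. auto_derive; trivial. field. trivial.
  - intros x _. smooth.
Qed.

Lemma gamma_density_integrable (z : R) : 0 < z -> exists I, line_integral (gamma_density z) I.
Proof.
  intros Hz. apply (line_integral_bounded _ (/ z + gamma_tail z)).
  - apply continuous_gamma_density.
  - intros; left; apply gamma_density_pos.
  - intros a b Hab.
    apply Rle_trans with (RInt (gamma_density z) (Rmin a 0) (Rmax b 0)).
    { apply RInt_window_le; trivial using continuous_gamma_density, Rmin_l, Rmax_l.
      intros; left; apply gamma_density_pos. }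
    rewrite <- (RInt_cont_Chasles _ _ 0) by apply continuous_gamma_density.
    pose proof (Rmin_r a 0). pose proof (Rmax_r b 0).
    assert (RInt (gamma_density z) (Rmin a 0) 0 <= RInt (fun s => exp (z * s)) (Rmin a 0) 0).
    { apply RInt_cont_le; trivial using continuous_gamma_density.
      - intros. smooth.
      - intros; apply gamma_density_le_left. }
    rewrite RInt_exp_lin in H1 by lra.
    assert (RInt (gamma_density z) 0 (Rmax b 0) <= RInt (fun s => gamma_tail z * exp (- 1 * s)) 0 (Rmax b 0)).
    { apply RInt_cont_le; trivial using continuous_gamma_density.
      - intros. smooth.
      - intros. replace (-1 * x) with (- x) by ring. now apply gamma_density_le_right. }
    rewrite RInt_Rmult in H2 by (apply ex_RInt_cont; intros; smooth).
    rewrite RInt_exp_lin in H2 by lra.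
    pose proof (exp_pos (z * Rmin a 0)). pose proof (exp_pos (-1 * Rmax b 0)).
    assert (0 < gamma_tail z) by apply exp_pos.
    rewrite Rmult_0_r, exp_0 in H1, H2.
    assert ((1 - exp (z * Rmin a 0)) / z <= / z).
    { unfold Rdiv. rewrite <- (Rmult_1_l (/ z)) at 2. apply Rmult_le_compat_r; [|lra].
      left. now apply Rinv_0_lt_compat. }
    replace ((exp (-1 * Rmax b 0) - 1) / -1) with (1 - exp (-1 * Rmax b 0)) in H2 by field.
    nra.
Qed.

Lemma RInt_gamma_integrand (z a b : R) : 0 < a -> 0 < b ->
  is_RInt (fun t => Rpower t (z - 1) * exp (- t)) a b (RInt (gamma_density z) (ln a) (ln b)).
Proof.
  intros Ha Hb.
  assert (Hc : forall t, 0 < t -> continuous (fun t => Rpower t (z - 1) * exp (- t)) t).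
  { intros t Ht. unfold Rpower. smooth. }
  assert (E : RInt (gamma_density z) (ln a) (ln b) = RInt (fun t => Rpower t (z - 1) * exp (- t)) a b).
  { rewrite <- (exp_ln a) at 2 by trivial. rewrite <- (exp_ln b) at 2 by trivial.
    rewrite <- (RInt_comp (V := R_CompleteNormedModule) _ exp exp).
    - apply RInt_ext. intros s _. unfold scal; simpl. unfold mult; simpl.
      unfold gamma_density, Rpower. rewrite ln_exp, <- !exp_plus. f_equal. ring.
    - intros s _. apply Hc, exp_pos.
    - intros s _. split; [|smooth]. auto_derive; trivial. ring. }
  rewrite E. apply RInt_R_correct.
  apply (ex_RInt_continuous (V := R_CompleteNormedModule)).
  intros t Ht. apply Hc. apply Rlt_le_trans with (2 := proj1 Ht). now apply Rmin_glb_lt.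
Qed.

(** Through the logarithm the filters at 0+ and +oo in [Gamma] become the two ends of the line: the
    window [-M, M] corresponds to a < e^(-M) and b > e^M. *)
Lemma line_integral_Gamma (z : R) : 0 < z -> line_integral (gamma_density z) (Gamma z).
Proof.
  intros Hz. destruct (gamma_density_integrable z Hz) as [I HI].
  replace (Gamma z) with I; trivial. symmetry. unfold Gamma.
  apply (is_RInt_gen_unique (V := R_CompleteNormedModule)).
  apply filterlimi_locally. intros eps.
  destruct (HI eps (cond_pos eps)) as [M HM].
  apply (Filter_prod _ _ _ (fun a => 0 < a < exp (- M)) (fun b => exp M < b)).
  - exists (mkposreal _ (exp_pos (- M))). intros a Ha Ha0. simpl in Ha.
    unfold ball in Ha; simpl in Ha; unfold AbsRing_ball, abs, minus, plus, opp in Ha; simpl in Ha.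
    rewrite Rabs_pos_eq in Ha by lra. lra.
  - exists (exp M). auto.
  - intros a b Ha Hb. pose proof (exp_pos M).
    exists (RInt (gamma_density z) (ln a) (ln b)). split.
    + apply RInt_gamma_integrand; lra.
    + apply HM.
      * rewrite <- (ln_exp (- M)). left. apply ln_increasing; lra.
      * rewrite <- (ln_exp M). left. apply ln_increasing; lra.
Qed.

Lemma Gamma_pos (z : R) : 0 < z -> 0 < Gamma z.
Proof.
  intros Hz. apply Rlt_le_trans with (RInt (gamma_density z) 0 1).
  - apply RInt_gt_0; [lra| |]; intros; [apply gamma_density_pos | apply continuous_gamma_density].
  - apply line_integral_RInt_le; [apply continuous_gamma_density| |now apply line_integral_Gamma|lra].
    intros; left; apply gamma_density_pos.
Qed.

(** Integration by parts in disguise: [gamma_density z] vanishes at both ends and has derivative [z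
    * gamma_density z - gamma_density (z + 1)]. *)
Lemma Gamma_succ (z : R) : 0 < z -> Gamma (z + 1) = z * Gamma z.
Proof.
  intros Hz. apply (line_integral_unique (gamma_density (z + 1))); [apply line_integral_Gamma; lra|].
  assert (H0 : line_integral (fun s => z * gamma_density z s - gamma_density (z + 1) s) (0 - 0)).
  { apply (line_integral_primitive (gamma_density z)).
    - intros s. unfold gamma_density. auto_derive; trivial.
      replace ((z + 1) * s - exp s) with ((z * s - exp s) + s) by ring.
      rewrite (exp_plus _ s). unfold Rminus. ring.
    - intros s. unfold gamma_density. smooth.
    - apply (tends_squeeze _ (fun s => gamma_tail z * exp (- 1 * s))).
      + exists 0. intros s _. rewrite Rminus_0_r, Rabs_pos_eq by (left; apply gamma_density_pos).
        replace (- 1 * s) with (- s) by ring. now apply gamma_density_le_right.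
      + rewrite <- (Rmult_0_r (gamma_tail z)). apply (tends_scal (fun s => exp (- 1 * s))), (tends_exp_neg 1). lra.
    - apply (tends_squeeze _ (fun s => exp (- z * s))); [|now apply tends_exp_neg].
      exists 0. intros s _. rewrite Rminus_0_r, Rabs_pos_eq by (left; apply gamma_density_pos).
      replace (- z * s) with (z * - s) by ring. apply gamma_density_le_left. }
  intros eps He.
  destruct (H0 (eps / 2)) as [M HM]; [lra|].
  destruct (line_integral_scal _ _ z (continuous_gamma_density z) (line_integral_Gamma z Hz) (eps / 2))
    as [N HN]; [lra|].
  exists (Rmax M N). intros a b Ha Hb. pose proof (Rmax_l M N). pose proof (Rmax_r M N).
  specialize (HM a b ltac:(lra) ltac:(lra)). specialize (HN a b ltac:(lra) ltac:(lra)).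
  rewrite (RInt_Rminus (fun s => z * gamma_density z s)) in HM.
  - apply Rabs_def2 in HM. apply Rabs_def2 in HN. apply Rabs_def1; lra.
  - apply ex_RInt_cont. intros. unfold gamma_density. smooth.
  - apply ex_RInt_cont. apply continuous_gamma_density.
Qed.

Ltac cont2d :=
  repeat first
   [ apply continuity_2d_pt_const | apply continuity_2d_pt_id1 | apply continuity_2d_pt_id2
   | apply continuity_2d_pt_plus | apply continuity_2d_pt_minus | apply continuity_2d_pt_mult
   | apply continuity_2d_pt_opp
   | apply (continuity_1d_2d_pt_comp exp); [apply derivable_continuous_pt, derivable_pt_exp|]
   | apply (continuity_1d_2d_pt_comp cos); [apply derivable_continuous_pt, derivable_pt_cos|]
   | apply (continuity_1d_2d_pt_comp sin); [apply derivable_continuous_pt, derivable_pt_sin|] ].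

(** Euler's Beta integrand y^(b-1) / (1+y)^(a+b) dy after y = e^q. *)
Definition beta_density (a b q : R) : R := exp (b * q - (a + b) * ln (1 + exp q)).

Lemma continuous_beta_density (a b q : R) : continuous (beta_density a b) q.
Proof. unfold beta_density. pose proof (exp_pos q). smooth. lra. Qed.

(** The double integral of [gamma_density a s * gamma_density b (q + s)] is evaluated in both
    orders. Integrating in q first gives the product of Gammas; integrating in s first, after a
    shift by ln(1 + e^q), gives the Beta density times [Gamma (a + b)]. *)
Lemma beta_Gamma (a b : R) : 0 < a -> 0 < b ->
  line_integral (beta_density a b) (Gamma a * Gamma b / Gamma (a + b)).
Proof.
  intros Ha Hb.
  pose proof (Gamma_pos (a + b) ltac:(lra)) as Hg.
  assert (H : line_integral (fun q => beta_density a b q * Gamma (a + b)) (Gamma a * Gamma b)).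
  { apply (Tonelli_line (fun s q => exp ((a + b) * s + b * q - exp s * (1 + exp q)))
             (fun s => gamma_density a s * Gamma b)).
    - intros s q. cont2d.
    - intros; left; apply exp_pos.
    - intros s. unfold gamma_density. smooth.
    - intros q. unfold beta_density. pose proof (exp_pos q). smooth. lra.
    - intros s. apply (line_integral_ext (fun q => gamma_density a s * gamma_density b (q + s))).
      + intros q. unfold gamma_density. rewrite <- exp_plus. f_equal. rewrite (exp_plus q s). ring.
      + apply (line_integral_scal (fun q => gamma_density b (q + s))).
        * intros. unfold gamma_density. smooth.
        * apply line_integral_shift; [apply continuous_gamma_density | now apply line_integral_Gamma].
    - intros q. pose proof (exp_pos q).
      apply (line_integral_ext (fun s => beta_density a b q * gamma_density (a + b) (s + ln (1 + exp q)))).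
      + intros s. unfold gamma_density, beta_density. rewrite <- exp_plus. f_equal.
        rewrite (exp_plus s), exp_ln by lra. ring.
      + apply (line_integral_scal (fun s => gamma_density (a + b) (s + ln (1 + exp q)))).
        * intros. unfold gamma_density. smooth.
        * apply line_integral_shift; [apply continuous_gamma_density | apply line_integral_Gamma; lra].
    - apply (line_integral_ext (fun s => Gamma b * gamma_density a s)); [intros; ring|].
      rewrite (Rmult_comm (Gamma a)).
      apply line_integral_scal; [apply continuous_gamma_density | now apply line_integral_Gamma]. }
  apply (line_integral_ext (fun q => / Gamma (a + b) * (beta_density a b q * Gamma (a + b)))).
  - intros q. field. lra.
  - replace (Gamma a * Gamma b / Gamma (a + b)) with (/ Gamma (a + b) * (Gamma a * Gamma b))
      by (field; lra).
    apply (line_integral_scal (fun q => beta_density a b q * Gamma (a + b))); trivial.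
    intros q. unfold beta_density. pose proof (exp_pos q). smooth. lra.
Qed.

Lemma Gamma_1 : Gamma 1 = 1.
Proof.
  apply (line_integral_unique (gamma_density 1)); [apply line_integral_Gamma; lra|].
  replace 1 with (0 - - 1) at 2 by ring.
  assert (Hex : forall x, Rabs (exp (- x) - 0) = exp (- x)).
  { intros. rewrite Rminus_0_r, Rabs_pos_eq; trivial. left; apply exp_pos. }
  apply (line_integral_primitive (fun s => - exp (- exp s))).
  - intros s. unfold gamma_density. auto_derive; trivial. replace (1 * s - exp s) with (s + - exp s) by ring. rewrite exp_plus. ring.
  - apply continuous_gamma_density.
  - apply (tends_squeeze _ (fun s => exp (- 1 * s))); [|apply (tends_exp_neg 1); lra].
    exists 0. intros s Hs. rewrite Rminus_0_r, Rabs_Ropp, Rabs_pos_eq by (left; apply exp_pos).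
    left. apply exp_increasing. pose proof (exp_ineq1_le s). lra.
  - apply (tends_squeeze _ (fun s => exp (- 1 * s))); [|apply (tends_exp_neg 1); lra].
    exists 0. intros s Hs. pose proof (exp_ineq1_le (- exp (- s))).
    pose proof (exp_pos (- s)).
    assert (exp (- exp (- s)) < 1) by (rewrite <- exp_0; apply exp_increasing; lra).
    replace (- 1 * s) with (- s) by ring. rewrite Rabs_pos_eq; lra.
Qed.

(** For a = b = 1/2 the Beta density is e^(q/2) / (1 + e^q), with primitive 2 arctan(e^(q/2)). This
    is the source of the square root of pi in [Aconst]. *)
Lemma Gamma_half_sqr : Gamma (1 / 2) * Gamma (1 / 2) = PI.
Proof.
  assert (H := beta_Gamma (1 / 2) (1 / 2) ltac:(lra) ltac:(lra)).
  replace (1 / 2 + 1 / 2) with 1 in H by field. rewrite Gamma_1 in H.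
  replace (Gamma (1 / 2) * Gamma (1 / 2) / 1) with (Gamma (1 / 2) * Gamma (1 / 2)) in H by field.
  apply (line_integral_unique _ _ _ H).
  replace PI with (2 * (PI / 2) - 2 * 0) by field.
  assert (Hbig : forall B, exists M, forall x, M <= x -> B <= exp (x / 2)).
  { intros B. exists (2 * B). intros x Hx. pose proof (exp_ineq1_le (x / 2)). lra. }
  apply (line_integral_primitive (fun q => 2 * atan (exp (q / 2)))).
  - intros q. unfold beta_density. auto_derive; trivial.
    pose proof (exp_pos (q / 2)).
    assert (E : exp q = exp (q / 2) * exp (q / 2)) by (rewrite <- exp_plus; f_equal; field).
    unfold Rminus. rewrite exp_plus, exp_Ropp.
    replace ((1 / 2 + 1 / 2) * ln (1 + exp q)) with (ln (1 + exp q)) by field.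
    rewrite exp_ln by (pose proof (exp_pos q); lra).
    replace (1 / 2 * q) with (q / 2) by field. rewrite E.
    req.
    replace (q * / 2) with (q / 2) by reflexivity. field. nra.
  - intros q. apply continuous_beta_density.
  - apply tends_scal, atan_tends, Hbig.
  - apply (tends_scal (fun q => atan (exp (- q / 2)))).
    intros eps He. destruct (atan_tends _ Hbig eps He) as [M HM]. exists M. intros x Hx.
    specialize (HM x Hx).
    replace (- x / 2) with (- (x / 2)) by field. rewrite exp_Ropp, atan_inv by apply exp_pos.
    rewrite Rminus_0_r, <- Rabs_Ropp.
    replace (- (PI / 2 - atan (exp (x / 2)))) with (atan (exp (x / 2)) - PI / 2) by ring. trivial.
Qed.

(** * The action integral *)

Lemma exp_le_exp (x y : R) : x <= y -> exp x <= exp y.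
Proof. intros [H | ->]; [left; now apply exp_increasing | right; reflexivity]. Qed.

Lemma exp_tangent (a b : R) : exp b * (1 + (a - b)) <= exp a.
Proof.
  replace (exp a) with (exp b * exp (a - b)) by (rewrite <- exp_plus; f_equal; ring).
  apply Rmult_le_compat_l; [left; apply exp_pos | apply exp_ineq1_le].
Qed.

(** Square e^(s/2) >= 1 + s/2. *)
Lemma exp_quadratic (s : R) : 0 <= s -> s ^ 2 / 4 <= exp s - 1 - s.
Proof.
  intros Hs.
  replace (exp s) with (exp (s / 2) * exp (s / 2)) by (rewrite <- exp_plus; f_equal; field).
  pose proof (exp_ineq1_le (s / 2)). nra.
Qed.

Definition W (alpha t x : R) : R := x * exp (2 * t) - exp ((2 * alpha + 2) * t) - 1.

(** The potential: by [W_level], [W alpha t x] is positive exactly where [level alpha t < x]. It is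
    convex with minimum [rho alpha]. *)
Definition level (alpha t : R) : R := exp (2 * alpha * t) + exp (- 2 * t).

Lemma W_level (alpha t x : R) : W alpha t x = exp (2 * t) * (x - level alpha t).
Proof.
  unfold W, level.
  replace ((2 * alpha + 2) * t) with (2 * t + 2 * alpha * t) by ring.
  rewrite exp_plus. assert (exp (2 * t) * exp (-2 * t) = 1).
  { rewrite <- exp_plus. replace (2 * t + -2 * t) with 0 by ring. apply exp_0. }
  lra.
Qed.

Lemma V_exp (alpha t x : R) : V alpha (exp t) x = W alpha t x.
Proof.
  unfold V, W, Rpower. rewrite ln_exp. f_equal. f_equal. f_equal.
  simpl. rewrite Rmult_1_r, <- exp_plus. f_equal. ring.
Qed.

Lemma sqrt_W_0 (alpha t x : R) : x <= level alpha t -> sqrt (W alpha t x) = 0.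
Proof.
  intros H. apply sqrt_neg_0. rewrite W_level. pose proof (exp_pos (2 * t)). nra.
Qed.

Lemma continuous_sqrt_2d (f : R -> R -> R) (x y : R) :
  continuity_2d_pt f x y -> continuity_2d_pt (fun u v => sqrt (f u v)) x y.
Proof.
  intros H. apply (continuity_1d_2d_pt_comp sqrt); trivial.
  apply continuity_pt_filterlim, continuous_sqrt.
Qed.

Lemma sqrt_W_cont_2d (alpha t x : R) : continuity_2d_pt (fun t x => sqrt (W alpha t x)) t x.
Proof. apply continuous_sqrt_2d. unfold W. cont2d. Qed.

Lemma sqrt_W_cont (alpha t x : R) : continuous (fun t => sqrt (W alpha t x)) t.
Proof. apply (continuity_2d_fst (fun t x => sqrt (W alpha t x))), sqrt_W_cont_2d. Qed.

(** The minimiser of [level]: the root of alpha e^((2 alpha + 2) t) = 1. *)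
Definition tmin (alpha : R) : R := - ln alpha / (2 * alpha + 2).

(** The height of the potential above its minimum, recentred at [tmin] and divided by exp(-2 tmin);
    see [level_excess]. *)
Definition excess (alpha r : R) : R := (exp (2 * alpha * r) - 1) / alpha + exp (- 2 * r) - 1.

Section Alpha.
Variable alpha : R.
Hypothesis Halpha : 1 < alpha.

Lemma rho_scale : rho alpha = (alpha + 1) / alpha * exp (- 2 * tmin alpha).
Proof.
  unfold rho, tmin, Rpower. f_equal. f_equal. field. lra.
Qed.

Lemma exp_tmin : exp (2 * alpha * tmin alpha) = exp (- 2 * tmin alpha) / alpha.
Proof.
  replace (2 * alpha * tmin alpha) with (- 2 * tmin alpha + - ln alpha)
    by (unfold tmin; field; lra).
  rewrite exp_plus, exp_Ropp, exp_ln by lra. reflexivity.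
Qed.

Lemma level_excess (r : R) :
  level alpha (r + tmin alpha) = rho alpha + exp (- 2 * tmin alpha) * excess alpha r.
Proof.
  unfold level, excess. rewrite !Rmult_plus_distr_l, !exp_plus, exp_tmin, rho_scale. field. lra.
Qed.

(** After adding and subtracting the linear terms, [excess] is a sum of two remainders e^s - 1 - s,
    both nonnegative. On each side of 0 the one with positive exponent already supplies the
    quadratic bound of [exp_quadratic]. *)
Lemma excess_ge (r : R) : r ^ 2 <= excess alpha r.
Proof.
  unfold excess.
  replace ((exp (2 * alpha * r) - 1) / alpha + exp (-2 * r) - 1)
    with ((exp (2 * alpha * r) - 1 - 2 * alpha * r) / alpha + (exp (-2 * r) - 1 - (-2 * r)))
    by (field; lra).
  assert (H1 : 0 <= exp (2 * alpha * r) - 1 - 2 * alpha * r)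
    by (pose proof (exp_ineq1_le (2 * alpha * r)); lra).
  assert (H2 : 0 <= exp (-2 * r) - 1 - (-2 * r))
    by (pose proof (exp_ineq1_le (-2 * r)); lra).
  destruct (Rle_lt_dec 0 r) as [Hr | Hr].
  - pose proof (exp_quadratic (2 * alpha * r)) as Hq.
    assert (r ^ 2 <= (exp (2 * alpha * r) - 1 - 2 * alpha * r) / alpha); [|lra].
    apply Rmult_le_reg_r with alpha; [lra|].
    unfold Rdiv. rewrite Rmult_assoc, Rinv_l, Rmult_1_r by lra.
    apply Rle_trans with ((2 * alpha * r) ^ 2 / 4); [|apply Hq; nra].
    assert (0 <= r ^ 2) by nra. nra.
  - pose proof (exp_quadratic (-2 * r) ltac:(lra)) as Hq.
    assert (0 <= (exp (2 * alpha * r) - 1 - 2 * alpha * r) / alpha)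
      by (apply Rdiv_le_0_compat; lra).
    replace ((-2 * r) ^ 2 / 4) with (r ^ 2) in Hq by field. lra.
Qed.

Lemma level_ge_rho (t : R) : rho alpha <= level alpha t.
Proof.
  replace t with (t - tmin alpha + tmin alpha) by ring. rewrite level_excess.
  pose proof (excess_ge (t - tmin alpha)). pose proof (exp_pos (- 2 * tmin alpha)).
  pose proof (pow2_ge_0 (t - tmin alpha)). nra.
Qed.

Lemma level_tmin : level alpha (tmin alpha) = rho alpha.
Proof.
  unfold level. rewrite exp_tmin, rho_scale. field. lra.
Qed.

Lemma rho_pos : 0 < rho alpha.
Proof.
  rewrite rho_scale. apply Rmult_lt_0_compat; [apply Rdiv_lt_0_compat; lra | apply exp_pos].
Qed.

(** It provides an explicit window: [sqrt (W alpha t x)] vanishes as soon as |t| >= |x|. *)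
Lemma level_ge_abs (t : R) : 2 * Rabs t <= level alpha t.
Proof.
  unfold level. pose proof (exp_ineq1_le (2 * alpha * t)). pose proof (exp_ineq1_le (- 2 * t)).
  pose proof (exp_pos (2 * alpha * t)). pose proof (exp_pos (- 2 * t)).
  unfold Rabs. destruct (Rcase_abs t); [lra|].
  assert (0 <= (alpha - 1) * t) by (apply Rmult_le_pos; lra). lra.
Qed.

Lemma level_convex (s t : R) :
  level alpha s + (2 * alpha * exp (2 * alpha * s) - 2 * exp (- 2 * s)) * (t - s) <= level alpha t.
Proof.
  unfold level. pose proof (exp_tangent (2 * alpha * t) (2 * alpha * s)).
  pose proof (exp_tangent (- 2 * t) (- 2 * s)). lra.
Qed.

(** By convexity the tangent at [t1] lies below the graph, and evaluating it at [t2] shows that its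
    slope is at most 0; to the left of [t1] it therefore stays above x. The tangent at [t2] does the
    same on the right. *)
Lemma level_outside (t1 t2 t x : R) :
  t1 < t2 -> level alpha t1 = x -> level alpha t2 = x -> t <= t1 \/ t2 <= t -> x <= level alpha t.
Proof.
  intros H12 H1 H2 [Ht | Ht].
  - pose proof (level_convex t1 t). pose proof (level_convex t1 t2). rewrite H1 in *. rewrite H2 in *.
    set (d := 2 * alpha * exp (2 * alpha * t1) - 2 * exp (- 2 * t1)) in *. nra.
  - pose proof (level_convex t2 t). pose proof (level_convex t2 t1). rewrite H1 in *. rewrite H2 in *.
    set (d := 2 * alpha * exp (2 * alpha * t2) - 2 * exp (- 2 * t2)) in *. nra.
Qed.

Lemma level_continuity : continuity (level alpha).
Proof.
  intros t. apply continuity_pt_filterlim.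
  change (continuous (level alpha) t). unfold level. smooth.
Qed.

Lemma zeros_exist (x : R) : rho alpha < x ->
  exists t1 t2, t1 < t2 /\ level alpha t1 = x /\ level alpha t2 = x.
Proof.
  intros Hx. pose proof rho_pos.
  (* [L > x > 0] makes [level] at L and -L at least 2 L > x, and [L > |tmin|] puts the minimiser
     between them. *)
  set (L := Rmax x (Rabs (tmin alpha)) + 1).
  assert (HL1 : x < L) by (unfold L; pose proof (Rmax_l x (Rabs (tmin alpha))); lra).
  assert (HL2 : Rabs (tmin alpha) < L) by (unfold L; pose proof (Rmax_r x (Rabs (tmin alpha))); lra).
  apply Rabs_def2 in HL2.
  assert (HLp : x < level alpha L).
  { pose proof (level_ge_abs L). rewrite Rabs_pos_eq in * by lra. lra. }
  assert (HLm : x < level alpha (- L)).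
  { pose proof (level_ge_abs (- L)). rewrite Rabs_Ropp, Rabs_pos_eq in * by lra. lra. }
  destruct (IVT (fun t => level alpha t - x) (tmin alpha) L) as [t2 [Ht2 E2]].
  - apply continuity_minus; [apply level_continuity | apply continuity_const; intros ? ?; reflexivity].
  - lra.
  - rewrite level_tmin. lra.
  - lra.
  - destruct (IVT (fun t => x - level alpha t) (- L) (tmin alpha)) as [t1 [Ht1 E1]].
    + apply continuity_minus; [apply continuity_const; intros ? ?; reflexivity | apply level_continuity].
    + lra.
    + lra.
    + rewrite level_tmin. lra.
    + exists t1, t2. repeat split; try lra.
      destruct (Rle_lt_or_eq_dec t1 t2); [lra|trivial|].
      exfalso. assert (t2 = tmin alpha) by lra. rewrite H0, level_tmin in E2. lra.
Qed.

Lemma zeros_spec (x : R) : rho alpha < x ->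
  0 < u1 alpha x < u2 alpha x /\ V alpha (u1 alpha x) x = 0 /\ V alpha (u2 alpha x) x = 0.
Proof.
  intros Hx. unfold u1, u2, zeros. apply epsilon_spec.
  destruct (zeros_exist x Hx) as (t1 & t2 & H12 & E1 & E2).
  exists (exp t1, exp t2). simpl. rewrite !V_exp, !W_level, E1, E2.
  pose proof (exp_pos t1). pose proof (exp_increasing _ _ H12).
  split; [lra | split; ring].
Qed.

Lemma RInt_eq_0 (f : R -> R) (a b : R) :
  (forall x, Rmin a b < x < Rmax a b -> f x = 0) -> RInt f a b = 0.
Proof.
  intros H. transitivity (RInt (fun _ => 0) a b); [now apply RInt_ext|].
  rewrite RInt_Rconst. apply Rmult_0_r.
Qed.

(** The window no longer refers to the zeros, so monotonicity and continuity of S in x follow by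
    integrating pointwise facts. The zeros chosen in [zeros] are used only through their
    specification: [level_outside] shows that any ordered pair of zeros bounds the set where the
    integrand is positive. *)
Lemma S_window (x a b : R) : a <= - Rabs x -> Rabs x <= b ->
  RInt (fun t => sqrt (W alpha t x)) a b = PI * S alpha x.
Proof.
  intros Ha Hb. unfold S.
  destruct (Rle_dec x (rho alpha)) as [Hx | Hx].
  { rewrite Rmult_0_r. apply RInt_eq_0. intros t _. apply sqrt_W_0.
    pose proof (level_ge_rho t). lra. }
  pose proof PI_RGT_0 as HPI.
  rewrite <- Rmult_assoc, Rinv_r, Rmult_1_l by lra.
  destruct (zeros_spec x ltac:(lra)) as ([H1 H12] & E1 & E2).
  set (v1 := u1 alpha x) in *. set (v2 := u2 alpha x) in *.
  assert (L12 : ln v1 < ln v2) by now apply ln_increasing.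
  assert (E1' : level alpha (ln v1) = x).
  { rewrite <- (exp_ln v1), V_exp, W_level in E1 by trivial.
    pose proof (exp_pos (2 * ln v1)). apply Rmult_integral in E1. lra. }
  assert (E2' : level alpha (ln v2) = x).
  { rewrite <- (exp_ln v2), V_exp, W_level in E2 by lra.
    pose proof (exp_pos (2 * ln v2)). apply Rmult_integral in E2. lra. }
  assert (Hout : forall t, t <= ln v1 \/ ln v2 <= t -> sqrt (W alpha t x) = 0).
  { intros t Ht. apply sqrt_W_0. now apply (level_outside (ln v1) (ln v2)). }
  assert (Hin1 : - Rabs x <= ln v1).
  { pose proof (level_ge_abs (ln v1)). rewrite E1' in *. pose proof (Rle_abs x).
    pose proof (Rle_abs (- ln v1)). rewrite Rabs_Ropp in *. pose proof (Rabs_pos x). lra. }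
  assert (Hin2 : ln v2 <= Rabs x).
  { pose proof (level_ge_abs (ln v2)). rewrite E2' in *. pose proof (Rle_abs x).
    pose proof (Rle_abs (ln v2)). pose proof (Rabs_pos x). lra. }
  assert (C : forall t : R, continuous (fun t => sqrt (W alpha t x)) t) by (intros; apply sqrt_W_cont).
  rewrite <- (RInt_cont_Chasles _ a (ln v1) b), <- (RInt_cont_Chasles _ (ln v1) (ln v2) b) by trivial.
  rewrite (RInt_eq_0 _ a (ln v1)).
  2: { intros t Ht. apply Hout. left. rewrite Rmin_left, Rmax_right in Ht by lra. lra. }
  rewrite (RInt_eq_0 _ (ln v2) b).
  2: { intros t Ht. apply Hout. right. rewrite Rmin_left, Rmax_right in Ht by lra. lra. }
  rewrite Rplus_0_l, Rplus_0_r.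
  rewrite <- (exp_ln v1) at 2 by trivial. rewrite <- (exp_ln v2) at 2 by lra.
  rewrite <- (RInt_comp (V := R_CompleteNormedModule) (fun u => sqrt (V alpha u x) / u) exp exp).
  - apply RInt_ext. intros t _. rewrite V_exp. unfold scal; simpl. unfold mult; simpl.
    pose proof (exp_pos t). field. lra.
  - intros t _.
    apply (cont_mult (fun u => sqrt (V alpha u x)) (fun u => / u)).
    + apply continuous_comp; [|apply continuous_sqrt].
      pose proof (exp_pos t). unfold V, Rpower. smooth.
    + pose proof (exp_pos t). smooth. lra.
  - intros t _. split; [|smooth]. auto_derive; trivial. ring.
Qed.

Lemma S_line_integral (x : R) : line_integral (fun t => sqrt (W alpha t x)) (PI * S alpha x).
Proof.
  intros eps He. exists (Rabs x). intros a b Ha Hb. rewrite S_window by trivial.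
  rewrite Rminus_diag, Rabs_R0. trivial.
Qed.

Lemma S_eq_0 (x : R) : x <= rho alpha -> S alpha x = 0.
Proof. intros H. unfold S. destruct (Rle_dec x (rho alpha)); lra. Qed.

Lemma S_le (x y : R) : x <= y -> S alpha x <= S alpha y.
Proof.
  intros Hxy. pose proof PI_RGT_0 as HPI. apply Rmult_le_reg_l with PI; trivial.
  set (M := Rmax (Rabs x) (Rabs y)).
  assert (Rabs x <= M) by apply Rmax_l. assert (Rabs y <= M) by apply Rmax_r.
  pose proof (Rabs_pos x).
  rewrite <- (S_window x (- M) M), <- (S_window y (- M) M) by lra.
  apply RInt_cont_le; try lra; try (intros; apply sqrt_W_cont).
  intros t _. apply sqrt_le_1_alt. unfold W. pose proof (exp_pos (2 * t)). nra.
Qed.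

Lemma S_ge_0 (x : R) : 0 <= S alpha x.
Proof.
  destruct (Rle_lt_dec x (rho alpha)).
  - rewrite S_eq_0; lra.
  - rewrite <- (S_eq_0 (rho alpha)) by lra. apply S_le. lra.
Qed.

Lemma S_continuous (x : R) : continuous (S alpha) x.
Proof.
  pose proof PI_RGT_0 as HPI.
  apply (continuous_ext_loc _ (fun x' => / PI * RInt (fun t => sqrt (W alpha t x')) (- (Rabs x + 1)) (Rabs x + 1))).
  - apply (locally_R _ _ 1); [lra|]. intros x' Hx'.
    pose proof (Rabs_triang (x' - x) x). replace (x' - x + x) with x' in * by ring.
    rewrite S_window by lra. req. field. lra.
  - apply (cont_scal (/ PI)
             (fun x' => RInt (fun t => sqrt (W alpha t x')) (- (Rabs x + 1)) (Rabs x + 1))).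
    apply (continuous_RInt_param (fun t x' => sqrt (W alpha t x'))). intros; apply sqrt_W_cont_2d.
Qed.

End Alpha.

(** * Growth of the action at infinity *)

(** The limit shape of [sqrt W] as x -> +oo: by [W_scaled], after a translation and division by x^(2
    gam), only the term -1 separates W from its radicand. *)
Definition profile (alpha t : R) : R := sqrt (exp (2 * t) - exp ((2 * alpha + 2) * t)).

(** The integral of [profile] over the line, as the Beta value B(1/(2 alpha), 3/2) / (2 alpha). *)
Definition profile_mass (alpha : R) : R :=
  1 / (2 * alpha) * (Gamma (1 / (2 * alpha)) * Gamma (3 / 2) / Gamma (1 / (2 * alpha) + 3 / 2)).

Section Alpha.
Variable alpha : R.
Hypothesis Halpha : 1 < alpha.

Lemma profile_cont (t : R) : continuous (profile alpha) t.
Proof. unfold profile. apply continuous_comp; [smooth | apply continuous_sqrt]. Qed.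

Lemma profile_ge_0 (t : R) : 0 <= profile alpha t.
Proof. apply sqrt_pos. Qed.

Lemma profile_0 (t : R) : 0 <= t -> profile alpha t = 0.
Proof.
  intros Ht. apply sqrt_neg_0.
  assert (exp (2 * t) <= exp ((2 * alpha + 2) * t)); [|lra]. apply exp_le_exp. nra.
Qed.

Lemma profile_le_1 (t : R) : t <= 0 -> profile alpha t <= 1.
Proof.
  intros Ht. rewrite <- sqrt_1. apply sqrt_le_1_alt.
  pose proof (exp_pos ((2 * alpha + 2) * t)).
  assert (exp (2 * t) <= exp 0) by (apply exp_le_exp; lra). rewrite exp_0 in *. lra.
Qed.

Let a := 1 / (2 * alpha).
(** The substitution e^(2 alpha t) = 1 / (1 + e^q), a decreasing map of the line onto the negative
    half-line. *)
Let h (q : R) := - a * ln (1 + exp q).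

Lemma RInt_profile_beta (q1 q2 : R) :
  RInt (profile alpha) (h q2) (h q1) = a * RInt (beta_density a (3 / 2)) q1 q2.
Proof.
  assert (Ha : 0 < a) by (apply Rdiv_lt_0_compat; lra).
  rewrite <- (opp_RInt_swap (V := R_CompleteNormedModule)) by (apply ex_RInt_cont, profile_cont).
  rewrite <- (RInt_comp (V := R_CompleteNormedModule) (profile alpha) h (fun q => - a * (exp q / (1 + exp q)))).
  - rewrite <- RInt_Rmult by (apply ex_RInt_cont, continuous_beta_density).
    rewrite <- (RInt_opp (V := R_CompleteNormedModule)).
    + apply RInt_ext. intros q _. unfold opp, scal; simpl. unfold mult; simpl. req.
      unfold profile, beta_density, h.
      set (L := ln (1 + exp q)).
      assert (HL : exp L = 1 + exp q) by (unfold L; rewrite exp_ln; trivial; pose proof (exp_pos q); lra).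
      replace (exp (2 * (- a * L)) - exp ((2 * alpha + 2) * (- a * L)))
        with (Rsqr (exp ((q - (2 * a + 1) * L) / 2))).
      * rewrite sqrt_Rsqr by (left; apply exp_pos).
        replace (3 / 2 * q - (a + 3 / 2) * L) with (q + - L + (q - (2 * a + 1) * L) / 2) by field.
        rewrite !exp_plus, exp_Ropp, HL. field. pose proof (exp_pos q); lra.
      * unfold Rsqr. rewrite <- exp_plus.
        replace ((2 * alpha + 2) * (- a * L)) with (- (2 * a * L) + - L) by (unfold a; field; lra).
        replace ((q - (2 * a + 1) * L) / 2 + (q - (2 * a + 1) * L) / 2) with (- (2 * a * L) + (q + - L)) by field.
        replace (2 * (- a * L)) with (- (2 * a * L)) by ring.
        rewrite !exp_plus, (exp_Ropp L), HL. field. pose proof (exp_pos q); lra.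
    + apply ex_RInt_cont. intros q.
      apply (cont_mult (fun q => - a * (exp q / (1 + exp q))) (fun q => profile alpha (h q))).
      * pose proof (exp_pos q). smooth. lra.
      * apply continuous_comp; [|apply profile_cont]. unfold h. pose proof (exp_pos q). smooth. lra.
  - intros q _. apply profile_cont.
  - intros q _. pose proof (exp_pos q). split; [|smooth; lra].
    unfold h. auto_derive; [lra|]. req. field. lra.
Qed.

(** The substitution [h] reaches only t < 0. For t >= 0 the profile vanishes, and the gap between
    [h (- n)] and 0 contributes at most its length, which is at most [a * exp (- n)]. *)
Lemma profile_line_integral : line_integral (profile alpha) (profile_mass alpha).
Proof.
  assert (Ha : 0 < a) by (apply Rdiv_lt_0_compat; lra).
  assert (HB := beta_Gamma a (3 / 2) Ha ltac:(lra)).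
  apply (line_integral_scal _ _ a) in HB; [|apply continuous_beta_density].
  fold (profile_mass alpha) in HB.
  assert (Hbeta : line_integral (fun q => a * beta_density a (3 / 2) q) (profile_mass alpha)) by exact HB.
  clear HB.
  assert (C : forall q : R, continuous (fun q => a * beta_density a (3 / 2) q) q).
  { intros q. unfold beta_density. pose proof (exp_pos q). smooth. lra. }
  assert (P : forall q, 0 <= a * beta_density a (3 / 2) q).
  { intros q. apply Rmult_le_pos; [lra | left; apply exp_pos]. }
  assert (hneg : forall q, h q < 0).
  { intros q. unfold h. pose proof (exp_pos q).
    assert (0 < ln (1 + exp q)) by (rewrite <- ln_1; apply ln_increasing; lra). nra. }
  assert (hsmall : forall n, - a * exp (- n) <= h (- n)).
  { intros n. unfold h. assert (ln (1 + exp (- n)) <= exp (- n)); [|nra].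
    rewrite <- (ln_exp (exp (- n))) at 2. pose proof (exp_pos (- n)).
    destruct (Rle_lt_or_eq_dec _ _ (exp_ineq1_le (exp (- n)))) as [E | E].
    - left. apply ln_increasing; lra.
    - rewrite E. lra. }
  assert (Up : forall A, A < 0 -> RInt (profile alpha) A 0 <= profile_mass alpha).
  { intros A HA. apply le_epsilon. intros eps He.
    (* The preimage of [A] under [h]. *)
    set (q := ln (exp (- A / a) - 1)).
    assert (Hq : h q = A).
    { unfold h, q. rewrite exp_ln.
      - replace (1 + (exp (- A / a) - 1)) with (exp (- A / a)) by ring. rewrite ln_exp. field. lra.
      - assert (exp 0 < exp (- A / a)); [|rewrite exp_0 in *; lra].
        apply exp_increasing. apply Rdiv_lt_0_compat; lra. }
    destruct (tends_exp_neg 1 ltac:(lra) (eps / a)) as [N HN]; [now apply Rdiv_lt_0_compat|].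
    set (n := Rmax N (- q)).
    assert (Hn1 : N <= n) by apply Rmax_l. assert (Hn2 : - q <= n) by apply Rmax_r.
    specialize (HN n Hn1). rewrite Rminus_0_r, Rabs_pos_eq in HN by (left; apply exp_pos).
    replace (- (1) * n) with (- n) in HN by ring.
    rewrite <- (RInt_cont_Chasles _ A (h (- n)) 0) by apply profile_cont.
    assert (RInt (profile alpha) A (h (- n)) <= profile_mass alpha).
    { rewrite <- Hq, RInt_profile_beta.
      rewrite <- RInt_Rmult by (apply ex_RInt_cont, continuous_beta_density).
      apply line_integral_RInt_le; trivial. lra. }
    assert (RInt (profile alpha) (h (- n)) 0 <= (0 - h (- n)) * 1).
    { rewrite <- RInt_Rconst. specialize (hneg (- n)). apply RInt_cont_le; try lra.
      - apply profile_cont.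
      - intros; apply continuous_const.
      - intros; apply profile_le_1. lra. }
    specialize (hsmall n). specialize (hneg (- n)).
    assert (a * exp (- n) < eps).
    { apply Rmult_lt_compat_l with (r := a) in HN; trivial.
      replace (a * (eps / a)) with eps in HN by (field; lra).
      trivial. }
    lra. }
  intros eps He. destruct (Hbeta eps He) as [M HM].
  set (M' := Rmax M 0). assert (M <= M') by apply Rmax_l. assert (0 <= M') by apply Rmax_r.
  specialize (HM (- M') M' ltac:(lra) ltac:(lra)).
  exists (Rmax (- h M') 0). intros A B HA HB.
  pose proof (Rmax_l (- h M') 0). pose proof (Rmax_r (- h M') 0).
  pose proof (hneg M'). pose proof (hneg (- M')).
  rewrite <- (RInt_cont_Chasles _ A 0 B) by apply profile_cont.
  rewrite (RInt_eq_0 (profile alpha) 0 B).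
  2: { intros t Ht. rewrite Rmin_left in Ht by lra. apply profile_0. lra. }
  specialize (Up A ltac:(lra)).
  assert (RInt (profile alpha) (h M') (h (- M')) <= RInt (profile alpha) A 0).
  { apply RInt_window_le; try lra; [apply profile_cont | apply profile_ge_0 |].
    unfold h. apply Rmult_le_compat_neg_l; [lra|].
    pose proof (exp_pos (- M')).
    assert (exp (- M') <= exp M') by (apply exp_le_exp; lra).
    destruct (Rle_lt_or_eq_dec _ _ H6) as [E | E]; [left; apply ln_increasing; lra | rewrite E; lra]. }
  rewrite RInt_profile_beta, <- RInt_Rmult in H5 by (apply ex_RInt_cont, continuous_beta_density).
  apply Rabs_def2 in HM. apply Rabs_def1; lra.
Qed.

(** The shift ln x / (2 alpha) balances the terms x e^(2t) and e^((2 alpha + 2) t): both acquire the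
    factor x^((1+alpha)/alpha), the square of x^gam. *)
Lemma W_scaled (x t : R) : 0 < x ->
  W alpha (t + ln x / (2 * alpha)) x
  = Rsqr (Rpower x (gam alpha)) * (exp (2 * t) - exp ((2 * alpha + 2) * t)) - 1.
Proof.
  intros Hx. unfold W, Rpower, Rsqr, gam.
  rewrite <- (exp_ln x) at 1 by trivial. rewrite <- !exp_plus.
  rewrite Rmult_minus_distr_l, <- !exp_plus. f_equal. f_equal; f_equal; field; lra.
Qed.

Lemma S_upper (x : R) : 0 < x -> PI * S alpha x <= Rpower x (gam alpha) * profile_mass alpha.
Proof.
  intros Hx. set (s := ln x / (2 * alpha)).
  set (M := Rabs x + Rabs s).
  pose proof (Rabs_pos x). pose proof (Rabs_pos s). pose proof (Rle_abs s). pose proof (Rle_abs (- s)).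
  rewrite Rabs_Ropp in *.
  rewrite <- (S_window alpha Halpha x (- M + s) (M + s)) by (unfold M; lra).
  rewrite <- (RInt_shift (fun t => sqrt (W alpha t x))) by (intros; apply sqrt_W_cont).
  assert (HX : 0 < Rpower x (gam alpha)) by apply exp_pos.
  apply Rle_trans with (Rpower x (gam alpha) * RInt (profile alpha) (- M) M).
  - rewrite <- RInt_Rmult by (apply ex_RInt_cont, profile_cont).
    apply RInt_cont_le; [unfold M; lra | | |].
    + intros t. apply (continuous_comp (fun t => t + s) (fun t => sqrt (W alpha t x))); [smooth | apply sqrt_W_cont].
    + intros t. apply (cont_scal _ (profile alpha)), profile_cont.
    + intros t _. unfold s. rewrite W_scaled by trivial. unfold profile.
      rewrite <- (sqrt_Rsqr (Rpower x (gam alpha))) at 2 by lra.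
      rewrite <- sqrt_mult_alt by apply Rle_0_sqr. apply sqrt_le_1_alt. lra.
  - apply Rmult_le_compat_l; [lra|].
    apply line_integral_RInt_le; [apply profile_cont | apply profile_ge_0 | apply profile_line_integral |].
    unfold M; lra.
Qed.

Lemma sqrt_minus_1 (v : R) : sqrt v - 1 <= sqrt (v - 1).
Proof.
  destruct (Rle_lt_dec v 1) as [H | H].
  - pose proof (sqrt_pos (v - 1)). apply sqrt_le_1_alt in H. rewrite sqrt_1 in H. lra.
  - pose proof (sqrt_pos (v - 1)). pose proof (sqrt_sqrt (v - 1) ltac:(lra)).
    assert (sqrt v <= sqrt (v - 1) + 1); [|lra].
    rewrite <- (sqrt_Rsqr (sqrt (v - 1) + 1)) by lra. apply sqrt_le_1_alt. unfold Rsqr. lra.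
Qed.

(** Dropping the -1 under the root changes it by at most 1, so a window of length 2 L loses at most
    2 L, a constant against the growing x^gam. *)
Lemma S_lower (x L : R) : 0 < x -> 0 <= L ->
  Rpower x (gam alpha) * RInt (profile alpha) (- L) L - 2 * L <= PI * S alpha x.
Proof.
  intros Hx HL. set (s := ln x / (2 * alpha)).
  assert (HX : 0 < Rpower x (gam alpha)) by apply exp_pos.
  apply Rle_trans with (RInt (fun t => sqrt (W alpha t x)) (- L + s) (L + s)).
  2: { apply line_integral_RInt_le; [intros t; apply (sqrt_W_cont alpha t x) | intros; apply sqrt_pos | now apply S_line_integral | lra]. }
  rewrite <- (RInt_shift (fun t => sqrt (W alpha t x))) by (intros; apply sqrt_W_cont).
  rewrite <- RInt_Rmult by (apply ex_RInt_cont, profile_cont).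
  replace (2 * L) with ((L - - L) * 1) by ring. rewrite <- RInt_Rconst.
  assert (C : forall t : R, continuous (fun t => Rpower x (gam alpha) * profile alpha t) t).
  { intros t. apply (cont_scal _ (profile alpha)), profile_cont. }
  rewrite <- (RInt_Rminus (fun t => Rpower x (gam alpha) * profile alpha t) (fun _ => 1)).
  - apply RInt_cont_le; [lra | | |].
    + intros t. apply (cont_minus); [apply C | apply continuous_const].
    + intros t. apply (continuous_comp (fun t => t + s) (fun t => sqrt (W alpha t x))); [smooth | apply sqrt_W_cont].
    + intros t _. unfold s. rewrite W_scaled by trivial. unfold profile.
      rewrite <- (sqrt_Rsqr (Rpower x (gam alpha))) at 1 by lra.
      rewrite <- sqrt_mult_alt by apply Rle_0_sqr. apply sqrt_minus_1.
  - apply ex_RInt_cont, C.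
  - apply ex_RInt_cont. intros. apply continuous_const.
Qed.

Lemma gam_pos : 0 < gam alpha.
Proof. apply Rdiv_lt_0_compat; lra. Qed.

Lemma gam_lt_1 : gam alpha < 1.
Proof. unfold gam. apply Rmult_lt_reg_r with (2 * alpha); [lra|]. field_simplify; lra. Qed.

Lemma Rpower_large (c B : R) : 0 < c -> exists M, 0 < M /\ forall x, M <= x -> B <= Rpower x c.
Proof.
  intros Hc. exists (exp (B / c)). split; [apply exp_pos|]. intros x Hx.
  assert (B / c <= ln x).
  { rewrite <- (ln_exp (B / c)). pose proof (exp_pos (B / c)).
    destruct Hx as [Hx | <-]; [left; now apply ln_increasing | lra]. }
  unfold Rpower. pose proof (exp_ineq1_le (c * ln x)).
  apply Rmult_le_compat_l with (r := c) in H; [|lra].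
  replace (c * (B / c)) with B in H by (field; lra). lra.
Qed.

Lemma S_asymptotic : tends (fun x => Rpower x (- gam alpha) * S alpha x) (profile_mass alpha / PI).
Proof.
  pose proof PI_RGT_0 as HPI. pose proof PI2_1.
  intros eps He.
  destruct (profile_line_integral eps He) as [M HM].
  set (L := Rmax M 0). assert (M <= L) by apply Rmax_l. assert (0 <= L) by apply Rmax_r.
  specialize (HM (- L) L ltac:(lra) ltac:(lra)). apply Rabs_def2 in HM.
  destruct (Rpower_large (gam alpha) (2 * L / eps) gam_pos) as (N & HN0 & HN).
  exists N. intros x Hx. specialize (HN x Hx).
  pose proof (S_upper x ltac:(lra)) as Hu. pose proof (S_lower x L ltac:(lra) H1) as Hl.
  rewrite Rpower_Ropp.
  set (X := Rpower x (gam alpha)) in *.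
  assert (HX : 0 < X) by apply exp_pos.
  assert (2 * L <= eps * X).
  { apply Rmult_le_compat_l with (r := eps) in HN; [|lra].
    replace (eps * (2 * L / eps)) with (2 * L) in HN by (field; lra). trivial. }
  replace (/ X * S alpha x - profile_mass alpha / PI) with ((PI * S alpha x - X * profile_mass alpha) * / (X * PI)) by (field; lra).
  assert (HXP : 0 < / (X * PI)) by (apply Rinv_0_lt_compat; nra).
  rewrite Rabs_mult, (Rabs_pos_eq (/ (X * PI))) by lra.
  apply Rmult_lt_reg_r with (X * PI); [nra|].
  rewrite Rmult_assoc, Rinv_l, Rmult_1_r by (apply Rgt_not_eq; nra).
  assert (Hlow : X * (profile_mass alpha - eps) <= X * RInt (profile alpha) (- L) L) by (apply Rmult_le_compat_l; lra).
  assert (0 < eps * X) by (apply Rmult_lt_0_compat; lra).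
  (* The lower estimate loses [eps * X] from the truncated profile and at most [eps * X] from
     [2 * L]; together they stay below [PI * eps * X]. *)
  assert (0 < (eps * X) * (PI - 2)) by (apply Rmult_lt_0_compat; lra).
  apply Rabs_def1; lra.
Qed.

Lemma profile_mass_pos : 0 < profile_mass alpha.
Proof.
  assert (0 < 1 / (2 * alpha)) by (apply Rdiv_lt_0_compat; lra).
  unfold profile_mass. apply Rmult_lt_0_compat; trivial.
  apply Rdiv_lt_0_compat; [apply Rmult_lt_0_compat|]; apply Gamma_pos; lra.
Qed.

(* [Aconst ^ gam] is the growth constant of [tau]. *)
Lemma Aconst_profile_mass :
  Rpower (Aconst alpha) (gam alpha) = 2 * (1 + alpha) * Rpower (rho alpha) (gam alpha) * (profile_mass alpha / PI).
Proof.
  pose proof PI_RGT_0 as HPI.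
  set (b := 1 / (2 * alpha)).
  assert (Hb : 0 < b) by (apply Rdiv_lt_0_compat; lra).
  assert (E1 : Gamma (3 / 2) = / 2 * Gamma (1 / 2)).
  { replace (3 / 2) with (1 / 2 + 1) by field. rewrite Gamma_succ by lra. field. }
  assert (E2 : Gamma (b + 3 / 2) = gam alpha * Gamma (gam alpha)).
  { replace (b + 3 / 2) with (gam alpha + 1) by (unfold gam, b; field; lra).
    apply Gamma_succ, gam_pos. }
  pose proof (Gamma_pos (1 / 2) ltac:(lra)) as Hh.
  pose proof (Gamma_pos b Hb) as Hgb. pose proof (Gamma_pos (gam alpha) gam_pos) as Hgg.
  pose proof gam_pos as Hg.
  assert (E3 : sqrt PI = Gamma (1 / 2)).
  { rewrite <- Gamma_half_sqr. apply sqrt_square. lra. }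
  assert (Hsa : 0 < sqrt alpha) by (apply sqrt_lt_R0; lra).
  unfold profile_mass. fold b. rewrite E1, E2.
  unfold Aconst. fold b. fold (gam alpha).
  set (Q := / sqrt (PI * alpha) * (Gamma b / Gamma (gam alpha))).
  assert (HQ : 0 < Q).
  { apply Rmult_lt_0_compat; [apply Rinv_0_lt_compat, sqrt_lt_R0; nra | now apply Rdiv_lt_0_compat]. }
  (* The exponent in [Aconst] is 1 / gam, so the power gam restores [Q]. *)
  assert (HP : Rpower (Rpower Q (2 * alpha / (alpha + 1))) (gam alpha) = Q).
  { rewrite Rpower_mult. replace (2 * alpha / (alpha + 1) * gam alpha) with 1 by (unfold gam; field; lra).
    now apply Rpower_1. }
  rewrite <- Rpower_mult_distr by (lra || apply exp_pos). rewrite HP.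
  unfold rho. rewrite <- Rpower_mult_distr by (apply exp_pos || apply Rdiv_lt_0_compat; lra).
  rewrite Rpower_mult.
  replace (1 / (alpha + 1) * gam alpha) with b by (unfold gam, b; field; lra).
  assert (E4 : Rpower ((alpha + 1) / alpha) (gam alpha) * Rpower alpha b
               = Rpower (1 + alpha) (gam alpha) * / sqrt alpha).
  { unfold Rdiv. rewrite <- Rpower_mult_distr by (lra || apply Rinv_0_lt_compat; lra).
    rewrite Rmult_assoc. f_equal; [f_equal; ring|].
    rewrite <- Rpower_sqrt by lra. rewrite <- Rpower_Ropp.
    replace (Rpower (/ alpha) (gam alpha)) with (Rpower alpha (- gam alpha)).
    - rewrite <- Rpower_plus. f_equal. unfold gam, b. field. lra.
    - unfold Rpower. rewrite ln_Rinv by lra. f_equal. ring. }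
  rewrite E4. unfold Q. rewrite sqrt_mult_alt, E3 by lra.
  rewrite <- Gamma_half_sqr.
  replace b with (gam alpha - 1 / 2) at 2 by (unfold gam, b; field; lra).
  replace (1 + alpha) with (2 * alpha * gam alpha) at 2 by (unfold gam; field; lra).
  replace (gam alpha - 1 / 2) with (1 / (2 * alpha)) by (unfold gam; field; lra).
  field. repeat split; lra.
Qed.
End Alpha.

(** * The action near [rho] *)

Lemma RInt_half_disc (r : R) : 0 < r ->
  RInt (fun x => sqrt (r ^ 2 - x ^ 2)) (- r) r = r ^ 2 * (PI / 2).
Proof.
  intros Hr. pose proof PI_RGT_0 as HPI.
  assert (E : RInt (fun x => sqrt (r ^ 2 - x ^ 2)) (- r) r
    = RInt (fun x => sqrt (r ^ 2 - x ^ 2)) (r * sin (- (PI / 2))) (r * sin (PI / 2))).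
  { rewrite sin_neg, sin_PI2. f_equal; ring. }
  rewrite E.
  rewrite <- (RInt_comp (V := R_CompleteNormedModule) _ (fun p => r * sin p) (fun p => r * cos p)).
  - transitivity (RInt (fun p => r ^ 2 * cos p ^ 2) (- (PI / 2)) (PI / 2)).
    + apply RInt_ext. intros p Hp. rewrite Rmin_left, Rmax_right in Hp by lra.
      unfold scal; simpl. unfold mult; simpl. req.
      replace (r * (r * 1) - r * sin p * (r * sin p * 1)) with (Rsqr (r * cos p)).
      * rewrite sqrt_Rsqr; [ring|]. apply Rmult_le_pos; [lra|]. apply cos_ge_0; lra.
      * unfold Rsqr. pose proof (sin2_cos2 p). unfold Rsqr in *. nra.
    + apply is_RInt_unique.
      replace (r ^ 2 * (PI / 2)) with
        (minus (r ^ 2 / 2 * (PI / 2 + sin (PI / 2) * cos (PI / 2)))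
               (r ^ 2 / 2 * (- (PI / 2) + sin (- (PI / 2)) * cos (- (PI / 2))))).
      * apply (is_RInt_derive (V := R_CompleteNormedModule) (fun p => r ^ 2 / 2 * (p + sin p * cos p))).
        -- intros p _. auto_derive; trivial. req. pose proof (sin2_cos2 p). unfold Rsqr in *.
           replace (sin p * (1 * - sin p)) with (- (1 - cos p * cos p)) by lra. field.
        -- intros p _. smooth.
      * unfold minus, plus, opp; simpl. rewrite cos_neg, cos_PI2. field.
  - intros p _. apply continuous_comp; [smooth | apply continuous_sqrt].
  - intros p _. split; [|smooth]. auto_derive; trivial. req. ring.
Qed.

Lemma RInt_half_ellipse (H c M : R) : 0 < H -> 0 < c -> sqrt (H / c) <= M ->
  RInt (fun x => sqrt (H - c * x ^ 2)) (- M) M = PI * H / (2 * sqrt c).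
Proof.
  intros HH Hc HM.
  assert (Hr : 0 < sqrt (H / c)) by (apply sqrt_lt_R0, Rdiv_lt_0_compat; lra).
  set (r := sqrt (H / c)) in *.
  assert (Hr2 : r ^ 2 = H / c).
  { unfold r. simpl. rewrite Rmult_1_r. apply sqrt_sqrt. apply Rlt_le, Rdiv_lt_0_compat; lra. }
  assert (Hcr : c * r ^ 2 = H) by (rewrite Hr2; field; lra).
  assert (C : forall x : R, continuous (fun x => sqrt (H - c * x ^ 2)) x).
  { intros x. apply continuous_comp; [smooth | apply continuous_sqrt]. }
  rewrite <- (RInt_cont_Chasles _ (- M) (- r) M), <- (RInt_cont_Chasles _ (- r) r M) by trivial.
  rewrite (RInt_eq_0 _ (- M) (- r)), (RInt_eq_0 _ r M).
  - transitivity (0 + (RInt (fun x => sqrt c * sqrt (r ^ 2 - x ^ 2)) (- r) r + 0)).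
    + req. do 2 f_equal. apply RInt_ext. intros x _. rewrite <- sqrt_mult_alt by lra. f_equal. lra.
    + rewrite RInt_Rmult.
      * rewrite RInt_half_disc, Hr2 by trivial. req.
        assert (0 < sqrt c) by now apply sqrt_lt_R0.
        replace (H / c) with (H / (sqrt c * sqrt c)) by (rewrite sqrt_sqrt; lra). field. lra.
      * apply ex_RInt_cont. intros x. apply continuous_comp; [smooth | apply continuous_sqrt].
  - intros x Hx. rewrite Rmin_left, Rmax_right in Hx by lra. apply sqrt_neg_0.
    assert (r ^ 2 <= x ^ 2) by nra. nra.
  - intros x Hx. rewrite Rmin_left, Rmax_right in Hx by lra. apply sqrt_neg_0.
    assert (r ^ 2 <= x ^ 2) by nra. nra.
Qed.

Section Alpha.
Variable alpha : R.
Hypothesis Halpha : 1 < alpha.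

(** The second derivative of [excess] at 0 is 4 (alpha + 1). Its continuity bounds the second
    derivative [f2] of the difference, and two applications of the mean value theorem carry the
    bound to the difference itself. *)
Lemma excess_quadratic (eps : R) : 0 < eps ->
  exists d, 0 < d /\ forall r, Rabs r <= d ->
    Rabs (excess alpha r - 2 * (alpha + 1) * r ^ 2) <= eps * r ^ 2.
Proof.
  intros He.
  set (f2 := fun r => 4 * alpha * exp (2 * alpha * r) + 4 * exp (- 2 * r) - 4 * (alpha + 1)).
  assert (C : continuous f2 0) by (unfold f2; smooth).
  apply continuity_pt_filterlim in C.
  destruct (C eps He) as [d [Hd HC]]. exists (d / 2). split; [lra|].
  assert (H2 : forall r, Rabs r <= d / 2 -> Rabs (f2 r) <= eps).
  { intros r Hr. destruct (Req_dec r 0) as [-> | Hne].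
    - unfold f2. rewrite !Rmult_0_r, exp_0, Rabs_right; lra.
    - left. simpl in HC. unfold R_dist in HC. specialize (HC r).
      replace (f2 r) with (f2 r - f2 0).
      + apply HC. split; [split; [exact Logic.I | auto]|]. rewrite Rminus_0_r. lra.
      + unfold f2 at 2. rewrite !Rmult_0_r, exp_0. ring. }
  set (f1 := fun r => 2 * exp (2 * alpha * r) - 2 * exp (- 2 * r) - 4 * (alpha + 1) * r).
  assert (D1 : forall r : R, is_derive f1 r (f2 r)).
  { intros r. unfold f1, f2. auto_derive; trivial. req. ring. }
  assert (H1 : forall r, Rabs r <= d / 2 -> Rabs (f1 r) <= eps * Rabs r).
  { intros r Hr.
    destruct (MVT_gen f1 0 r f2) as (c & Hc & E).
    - intros; apply D1.
    - intros x _. apply ex_derive_continuity_pt. eexists; apply D1.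
    - assert (f1 0 = 0) by (unfold f1; rewrite !Rmult_0_r, exp_0; ring).
      replace (f1 r) with (f2 c * r) by lra. rewrite Rabs_mult.
      apply Rmult_le_compat_r; [apply Rabs_pos|]. apply H2.
      revert Hc Hr. unfold Rmin, Rmax, Rabs.
      destruct (Rle_dec 0 r), (Rcase_abs r), (Rcase_abs c); lra. }
  intros r Hr.
  set (f0 := fun r => excess alpha r - 2 * (alpha + 1) * r ^ 2).
  assert (D0 : forall r : R, is_derive f0 r (f1 r)).
  { intros x. unfold f0, f1, excess. auto_derive; trivial. req. field. lra. }
  destruct (MVT_gen f0 0 r f1) as (c & Hc & E).
  - intros; apply D0.
  - intros x _. apply ex_derive_continuity_pt. eexists; apply D0.
  - assert (f0 0 = 0) by (unfold f0, excess; rewrite !Rmult_0_r, exp_0; field; lra).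
    fold (f0 r). replace (f0 r) with (f1 c * r) by lra. rewrite Rabs_mult.
    assert (Hcr : Rabs c <= Rabs r).
    { revert Hc. unfold Rmin, Rmax, Rabs.
      destruct (Rle_dec 0 r), (Rcase_abs r), (Rcase_abs c); lra. }
    specialize (H1 c ltac:(lra)).
    replace (r ^ 2) with (Rabs r * Rabs r) by (rewrite <- Rabs_mult, Rabs_pos_eq; nra).
    rewrite <- Rmult_assoc. apply Rmult_le_compat_r; [apply Rabs_pos|].
    apply Rle_trans with (1 := H1). apply Rmult_le_compat_l; lra.
Qed.

(** The right derivative of S at [rho]: with c = 2 (alpha + 1) and H = e^(2 tmin) h, the limiting
    half-ellipse has area pi H / (2 sqrt c). *)
Definition slope : R := exp (2 * tmin alpha) / (2 * sqrt (2 * (alpha + 1))).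

Lemma W_tmin (r h : R) :
  W alpha (r + tmin alpha) (rho alpha + h)
  = exp (2 * r) * (exp (2 * tmin alpha) * h - excess alpha r).
Proof.
  rewrite W_level, level_excess by trivial. rewrite Rmult_plus_distr_l, exp_plus.
  assert (exp (2 * tmin alpha) * exp (-2 * tmin alpha) = 1).
  { rewrite <- exp_plus. replace (2 * tmin alpha + -2 * tmin alpha) with 0 by ring. apply exp_0. }
  replace (rho alpha + h - (rho alpha + exp (-2 * tmin alpha) * excess alpha r))
    with (h - exp (-2 * tmin alpha) * excess alpha r) by ring.
  rewrite !Rmult_assoc. f_equal. rewrite Rmult_minus_distr_l, <- Rmult_assoc, H. ring.
Qed.

(* [sqrt W] vanishes for [r^2 >= H] because [excess r >= r^2], and on [r^2 <= H] the potential
   is squeezed between two parabolas. *)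
Lemma S_near_rho (eps : R) : 0 < eps < 1 ->
  exists d, 0 < d /\ forall h, 0 < h < d ->
    exp (- eps) * (exp (2 * tmin alpha) / (2 * sqrt (2 * (alpha + 1) + eps))) <= S alpha (rho alpha + h) / h
    <= exp eps * (exp (2 * tmin alpha) / (2 * sqrt (2 * (alpha + 1) - eps))).
Proof.
  intros [He He1]. pose proof PI_RGT_0 as HPI.
  destruct (excess_quadratic eps He) as (d0 & Hd0 & Hq).
  (* For |r| <= m the quadratic approximation holds, and the factor e^r of the root lies between
     e^(-eps) and e^eps. *)
  set (m := Rmin d0 eps).
  assert (Hm : 0 < m) by (apply Rmin_glb_lt; lra).
  assert (Hm1 : m <= d0) by apply Rmin_l. assert (Hm2 : m <= eps) by apply Rmin_r.
  pose proof (exp_pos (2 * tmin alpha)) as HE.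
  exists (m ^ 2 / exp (2 * tmin alpha)).
  split; [apply Rdiv_lt_0_compat; trivial; nra|].
  intros h [Hh Hhd].
  set (H := exp (2 * tmin alpha) * h).
  assert (HH : 0 < H) by (unfold H; nra).
  assert (HHm : H < m ^ 2).
  { unfold H. apply Rmult_lt_compat_l with (r := exp (2 * tmin alpha)) in Hhd; trivial.
    replace (exp (2 * tmin alpha) * (m ^ 2 / exp (2 * tmin alpha))) with (m ^ 2) in Hhd by (field; lra).
    trivial. }
  set (x := rho alpha + h).
  set (M := Rabs x + Rabs (tmin alpha) + sqrt H).
  pose proof (Rabs_pos x). pose proof (Rabs_pos (tmin alpha)). pose proof (sqrt_pos H).
  pose proof (Rle_abs (tmin alpha)). pose proof (Rle_abs (- tmin alpha)). rewrite Rabs_Ropp in *.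
  assert (HS : PI * S alpha x = RInt (fun r => sqrt (W alpha (r + tmin alpha) x)) (- M) M).
  { rewrite (RInt_shift (fun t => sqrt (W alpha t x))) by (intros; apply sqrt_W_cont).
    symmetry. apply S_window; trivial; unfold M; lra. }
  assert (CW : forall r : R, continuous (fun r => sqrt (W alpha (r + tmin alpha) x)) r).
  { intros r. apply (continuous_comp (fun t => t + tmin alpha) (fun t => sqrt (W alpha t x)));
      [smooth | apply sqrt_W_cont]. }
  assert (CE : forall c : R, forall r : R, continuous (fun r => sqrt (H - c * r ^ 2)) r).
  { intros c r. apply continuous_comp; [smooth | apply continuous_sqrt]. }
  assert (Hell : forall c, 1 <= c -> RInt (fun r => sqrt (H - c * r ^ 2)) (- M) M = PI * H / (2 * sqrt c)).
  { intros c Hc. apply RInt_half_ellipse; try lra.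
    assert (sqrt (H / c) <= sqrt H); [|unfold M; lra].
    apply sqrt_le_1_alt. apply Rmult_le_reg_r with c; [lra|].
    unfold Rdiv. rewrite Rmult_assoc, Rinv_l by lra. nra. }
  assert (Hcase : forall r, r ^ 2 < H -> Rabs r <= m).
  { intros r Hr. apply Rabs_le. assert (r ^ 2 < m ^ 2) by lra. nra. }
  assert (Hz : forall r, H <= r ^ 2 -> sqrt (W alpha (r + tmin alpha) x) = 0).
  { intros r Hr. apply sqrt_neg_0. unfold x. rewrite W_tmin. fold H.
    pose proof (excess_ge alpha Halpha r). pose proof (exp_pos (2 * r)). nra. }
  assert (Hz' : forall c r, 1 <= c -> H <= r ^ 2 -> sqrt (H - c * r ^ 2) = 0).
  { intros c r Hc Hr. apply sqrt_neg_0. nra. }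
  assert (Hfac : forall r, sqrt (W alpha (r + tmin alpha) x) = exp r * sqrt (H - excess alpha r)).
  { intros r. unfold x. rewrite W_tmin. fold H.
    replace (exp (2 * r)) with (Rsqr (exp r)) by (unfold Rsqr; rewrite <- exp_plus; f_equal; ring).
    rewrite sqrt_mult_alt, sqrt_Rsqr; trivial; [left; apply exp_pos | apply Rle_0_sqr]. }
  assert (Hup : PI * S alpha x <= exp eps * (PI * H / (2 * sqrt (2 * (alpha + 1) - eps)))).
  { rewrite <- Hell by lra.
    rewrite <- RInt_Rmult by (apply ex_RInt_cont; intros; apply CE).
    rewrite HS. apply RInt_cont_le; [unfold M; lra | apply CW | |].
    - intros r. apply (cont_scal (exp eps)), CE.
    - intros r _. destruct (Rle_lt_dec H (r ^ 2)) as [Hr | Hr].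
      + rewrite Hz by trivial. rewrite Hz' by lra. lra.
      + rewrite Hfac. specialize (Hcase r Hr). specialize (Hq r ltac:(lra)).
        apply Rabs_le_between in Hq. apply Rabs_le_between in Hcase.
        apply Rmult_le_compat; [left; apply exp_pos | apply sqrt_pos | apply exp_le_exp; lra |].
        apply sqrt_le_1_alt. lra. }
  assert (Hlow : exp (- eps) * (PI * H / (2 * sqrt (2 * (alpha + 1) + eps))) <= PI * S alpha x).
  { rewrite <- Hell by lra.
    rewrite <- RInt_Rmult by (apply ex_RInt_cont; intros; apply CE).
    rewrite HS. apply RInt_cont_le; [unfold M; lra | | apply CW |].
    - intros r. apply (cont_scal (exp (- eps))), CE.
    - intros r _. destruct (Rle_lt_dec H (r ^ 2)) as [Hr | Hr].
      + rewrite Hz by trivial. rewrite Hz' by lra. lra.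
      + rewrite Hfac. specialize (Hcase r Hr). specialize (Hq r ltac:(lra)).
        apply Rabs_le_between in Hq. apply Rabs_le_between in Hcase.
        apply Rmult_le_compat; [left; apply exp_pos | apply sqrt_pos | apply exp_le_exp; lra |].
        apply sqrt_le_1_alt. lra. }
  assert (Hs1 : 0 < sqrt (2 * (alpha + 1) - eps)) by (apply sqrt_lt_R0; lra).
  assert (Hs2 : 0 < sqrt (2 * (alpha + 1) + eps)) by (apply sqrt_lt_R0; lra).
  assert (Hph : 0 < PI * h) by nra.
  split; apply Rmult_le_reg_r with (PI * h); trivial.
  - replace (S alpha x / h * (PI * h)) with (PI * S alpha x) by (field; lra).
    apply Rle_trans with (2 := Hlow). unfold H. right. field. lra.
  - replace (S alpha x / h * (PI * h)) with (PI * S alpha x) by (field; lra).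
    apply Rle_trans with (1 := Hup). unfold H. right. field. lra.
Qed.

Lemma S_slope (eps : R) : 0 < eps ->
  exists d, 0 < d /\ forall h, 0 < h < d -> Rabs (S alpha (rho alpha + h) / h - slope) < eps.
Proof.
  intros He.
  (* The sign s treats the upper and the lower bound of [S_near_rho] by one continuity argument. *)
  assert (C : forall s : R, s = 1 \/ s = -1 ->
    exists d, 0 < d /\ forall e, 0 < e < d ->
      Rabs (exp (s * e) * (exp (2 * tmin alpha) / (2 * sqrt (2 * (alpha + 1) - s * e))) - slope) < eps).
  { intros s Hs.
    assert (C : continuous (fun e => exp (s * e) * (exp (2 * tmin alpha) / (2 * sqrt (2 * (alpha + 1) - s * e)))) 0).
    { assert (0 < sqrt (2 * (alpha + 1) - s * 0)) by (apply sqrt_lt_R0; lra). smooth.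
      unfold Rminus in *. repeat split; lra. }
    apply continuity_pt_filterlim in C. destruct (C eps He) as [d [Hd HC]].
    exists d. split; trivial. intros e Hed. simpl in HC. unfold R_dist in HC.
    specialize (HC e).
    assert (E : exp (s * 0) * (exp (2 * tmin alpha) / (2 * sqrt (2 * (alpha + 1) - s * 0))) = slope).
    { unfold slope. rewrite Rmult_0_r, exp_0, Rminus_0_r. ring. }
    rewrite E in HC. apply HC. split; [split; [exact Logic.I | lra]|].
    rewrite Rminus_0_r, Rabs_pos_eq; lra. }
  destruct (C 1) as (d1 & Hd1 & C1); [auto|]. destruct (C (-1)) as (d2 & Hd2 & C2); [auto|].
  set (e := Rmin (Rmin d1 d2) 1 / 2).
  assert (Hm : 0 < Rmin (Rmin d1 d2) 1) by (repeat apply Rmin_glb_lt; lra).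
  pose proof (Rmin_r (Rmin d1 d2) 1). pose proof (Rmin_l (Rmin d1 d2) 1).
  pose proof (Rmin_l d1 d2). pose proof (Rmin_r d1 d2).
  specialize (C1 e ltac:(unfold e; lra)). specialize (C2 e ltac:(unfold e; lra)).
  rewrite !Rmult_1_l in C1.
  replace (-1 * e) with (- e) in C2 by ring.
  replace (2 * (alpha + 1) - - e) with (2 * (alpha + 1) + e) in C2 by ring.
  destruct (S_near_rho e ltac:(unfold e; lra)) as (d & Hd & HS).
  exists d. split; trivial. intros h Hh. specialize (HS h Hh).
  apply Rabs_def2 in C1. apply Rabs_def2 in C2. apply Rabs_def1; lra.
Qed.

End Alpha.

(** * Rotation of the contour *)

(* Real and imaginary part of the principal square root of [a + i b]; on the cut [b = 0], [a <= 0]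
   the imaginary part has the junk value [0], while the real part stays continuous. *)
Definition csqrt_re (a b : R) : R := sqrt ((sqrt (a ^ 2 + b ^ 2) + a) / 2).
Definition csqrt_im (a b : R) : R := b / (2 * csqrt_re a b).

Definition off_cut (a b : R) : Prop := b <> 0 \/ 0 < a.

Lemma cmod_gt (a b : R) : off_cut a b -> 0 < sqrt (a ^ 2 + b ^ 2) + a.
Proof.
  intros H. pose proof (sqrt_pos (a ^ 2 + b ^ 2)).
  destruct (Rlt_le_dec 0 a) as [Ha | Ha]; [lra|].
  destruct H as [Hb | Hb]; [|lra].
  assert (sqrt (Rsqr (- a)) < sqrt (a ^ 2 + b ^ 2)).
  { apply sqrt_lt_1_alt. split; [apply Rle_0_sqr|]. unfold Rsqr.
    assert (0 < b ^ 2) by (apply pow2_gt_0; trivial). nra. }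
  rewrite sqrt_Rsqr in * by lra. lra.
Qed.

Lemma csqrt_re_pos (a b : R) : off_cut a b -> 0 < csqrt_re a b.
Proof. intros H. apply sqrt_lt_R0. pose proof (cmod_gt a b H). lra. Qed.

Lemma csqrt_spec (a b : R) : off_cut a b ->
  csqrt_re a b ^ 2 - csqrt_im a b ^ 2 = a /\ 2 * csqrt_re a b * csqrt_im a b = b
  /\ sqrt (a ^ 2 + b ^ 2) = csqrt_re a b ^ 2 + csqrt_im a b ^ 2.
Proof.
  intros H. pose proof (csqrt_re_pos a b H) as Hp. pose proof (cmod_gt a b H) as Hm.
  assert (E1 : csqrt_re a b ^ 2 = (sqrt (a ^ 2 + b ^ 2) + a) / 2).
  { apply pow2_sqrt. lra. }
  assert (E2 : 2 * csqrt_re a b * csqrt_im a b = b) by (unfold csqrt_im; field; lra).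
  assert (E3 : sqrt (a ^ 2 + b ^ 2) * sqrt (a ^ 2 + b ^ 2) = a ^ 2 + b ^ 2) by (apply sqrt_sqrt; nra).
  set (m := sqrt (a ^ 2 + b ^ 2)) in *. set (p := csqrt_re a b) in *. set (q := csqrt_im a b) in *.
  assert (E4 : q ^ 2 = (m - a) / 2).
  { apply Rmult_eq_reg_l with (4 * p ^ 2); [|nra].
    replace (4 * p ^ 2 * q ^ 2) with ((2 * p * q) ^ 2) by ring. rewrite E2, E1. nra. }
  repeat split; lra.
Qed.

(** The two formulas are the real and imaginary parts of (da + i db) / (2 (p + i q)). *)
Lemma csqrt_derive (a b : R -> R) (s da db : R) :
  is_derive a s da -> is_derive b s db -> off_cut (a s) (b s) ->
  let p := csqrt_re (a s) (b s) in let q := csqrt_im (a s) (b s) in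
  is_derive (fun s => csqrt_re (a s) (b s)) s ((p * da + q * db) / (2 * (p ^ 2 + q ^ 2))) /\
  is_derive (fun s => csqrt_im (a s) (b s)) s ((p * db - q * da) / (2 * (p ^ 2 + q ^ 2))).
Proof.
  intros Ha Hb Hc p q.
  destruct (csqrt_spec _ _ Hc) as (E1 & E2 & E3). fold p q in E1, E2, E3.
  pose proof (csqrt_re_pos _ _ Hc) as Hp. fold p in Hp.
  pose proof (cmod_gt _ _ Hc) as Hm.
  assert (Hm0 : 0 < sqrt (a s ^ 2 + b s ^ 2)) by nra.
  assert (Hm1 : 0 < a s ^ 2 + b s ^ 2).
  { apply Rnot_le_lt. intros Hle. rewrite sqrt_neg_0 in Hm0 by trivial. lra. }
  assert (D1 : is_derive (fun s => csqrt_re (a s) (b s)) s ((p * da + q * db) / (2 * (p ^ 2 + q ^ 2)))).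
  { unfold csqrt_re. auto_derive.
    - split; [eexists; apply Ha|]. split; [eexists; apply Hb|]. simpl in Hm1, Hm.
      repeat split; try lra. eexists; apply Ha.
    - replace (Derive (fun x => a x) s) with da by (symmetry; now apply is_derive_unique).
      replace (Derive (fun x => b x) s) with db by (symmetry; now apply is_derive_unique). req.
      assert (Ep : sqrt ((sqrt (a s * (a s * 1) + b s * (b s * 1)) + a s) * / 2) = p) by reflexivity.
      rewrite Ep.
      assert (Em : sqrt (a s * (a s * 1) + b s * (b s * 1)) = p ^ 2 + q ^ 2) by (rewrite <- E3; reflexivity).
      rewrite Em. rewrite <- E1, <- E2. simpl. field. nra. }
  split; trivial.
  unfold csqrt_im.
  replace ((p * db - q * da) / (2 * (p ^ 2 + q ^ 2)))
    with ((db * (2 * p) - b s * (2 * ((p * da + q * db) / (2 * (p ^ 2 + q ^ 2))))) / (2 * p) ^ 2).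
  - apply (is_derive_div b (fun s => 2 * csqrt_re (a s) (b s))); trivial; [|fold p; lra].
    apply (is_derive_scal (fun s => csqrt_re (a s) (b s)) s 2). exact D1.
  - rewrite <- E2. field. nra.
Qed.

Lemma csqrt_re_0 (a : R) : csqrt_re a 0 = sqrt a.
Proof.
  unfold csqrt_re. replace (a ^ 2 + 0 ^ 2) with (Rsqr a) by (unfold Rsqr; ring).
  rewrite sqrt_Rsqr_abs. unfold Rabs. destruct (Rcase_abs a) as [H | H].
  - replace ((- a + a) / 2) with 0 by field. rewrite sqrt_0. symmetry. apply sqrt_neg_0. lra.
  - f_equal. field.
Qed.

Lemma csqrt_re_cont_2d (a b : R -> R -> R) (u v : R) :
  continuity_2d_pt a u v -> continuity_2d_pt b u v ->
  continuity_2d_pt (fun u v => csqrt_re (a u v) (b u v)) u v.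
Proof.
  intros Ha Hb. unfold csqrt_re, Rdiv.
  apply continuous_sqrt_2d. apply continuity_2d_pt_mult; [|apply continuity_2d_pt_const].
  apply continuity_2d_pt_plus; trivial. apply continuous_sqrt_2d.
  simpl. repeat first [apply continuity_2d_pt_plus | apply continuity_2d_pt_mult
    | apply continuity_2d_pt_const | assumption].
Qed.

Lemma csqrt_im_cont_2d (a b : R -> R -> R) (u v : R) :
  continuity_2d_pt a u v -> continuity_2d_pt b u v -> off_cut (a u v) (b u v) ->
  continuity_2d_pt (fun u v => csqrt_im (a u v) (b u v)) u v.
Proof.
  intros Ha Hb Hc. unfold csqrt_im, Rdiv.
  apply continuity_2d_pt_mult; trivial. apply continuity_2d_pt_inv.
  - apply continuity_2d_pt_mult; [apply continuity_2d_pt_const | now apply csqrt_re_cont_2d].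
  - pose proof (csqrt_re_pos _ _ Hc). lra.
Qed.

(** Concavity of the sine on [0, pi]: the difference has derivative l (cos(l u) - cos u),
    nonnegative there, and vanishes at u = 0. *)
Lemma sin_scale (l u : R) : 0 <= l <= 1 -> 0 <= u <= PI -> l * sin u <= sin (l * u).
Proof.
  intros Hl Hu.
  destruct (MVT_gen (fun u => sin (l * u) - l * sin u) 0 u (fun u => l * (cos (l * u) - cos u)))
    as (c & Hc & E).
  - intros z _. auto_derive; trivial. req. ring.
  - intros z _. apply ex_derive_continuity_pt. auto_derive; trivial.
  - rewrite Rmin_left, Rmax_right in Hc by lra.
    rewrite !Rmult_0_r, sin_0 in E.
    assert (cos c <= cos (l * c)) by (apply cos_decr_1; nra).
    assert (0 <= l * (cos (l * c) - cos c) * (u - 0)).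
    { repeat apply Rmult_le_pos; lra. }
    lra.
Qed.

(** * Cauchy's theorem for the root of W on rectangles *)

Section Contour.
Variables alpha x : R.
Hypothesis Halpha : 1 < alpha.
Hypothesis Hx : rho alpha < x.

(** Real and imaginary part of W at t + i phi; the functions with suffix [_t] are their
    t-derivatives, and by Cauchy-Riemann the phi-derivatives are [- Wi_t] and [Wr_t]. *)
Let Wr (t phi : R) := x * exp (2 * t) * cos (2 * phi) - exp ((2 * alpha + 2) * t) * cos ((2 * alpha + 2) * phi) - 1.
Let Wi (t phi : R) := x * exp (2 * t) * sin (2 * phi) - exp ((2 * alpha + 2) * t) * sin ((2 * alpha + 2) * phi).
Let Wr_t (t phi : R) := 2 * x * exp (2 * t) * cos (2 * phi)
  - (2 * alpha + 2) * exp ((2 * alpha + 2) * t) * cos ((2 * alpha + 2) * phi).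
Let Wi_t (t phi : R) := 2 * x * exp (2 * t) * sin (2 * phi)
  - (2 * alpha + 2) * exp ((2 * alpha + 2) * t) * sin ((2 * alpha + 2) * phi).
Let phi1 := PI / (alpha + 1).
Let p (t phi : R) := csqrt_re (Wr t phi) (Wi t phi).
Let q (t phi : R) := csqrt_im (Wr t phi) (Wi t phi).

Lemma phi1_bounds : 0 < phi1 < PI / 2 /\ (alpha + 1) * phi1 = PI.
Proof.
  pose proof PI_RGT_0. unfold phi1. repeat split.
  - apply Rdiv_lt_0_compat; lra.
  - apply Rmult_lt_reg_r with (alpha + 1); [lra|]. unfold Rdiv. rewrite Rmult_assoc, Rinv_l by lra. nra.
  - field. lra.
Qed.

Lemma phi_bounds (phi : R) : 0 < phi <= phi1 -> 0 < 2 * phi < PI /\ 0 < (alpha + 1) * phi <= PI.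
Proof. intros H. destruct phi1_bounds as [H1 H2]. nra. Qed.

Lemma sin_phi_pos (phi : R) : 0 < phi <= phi1 -> 0 < sin (2 * phi).
Proof. intros H. apply phi_bounds in H. apply sin_gt_0; lra. Qed.

(** If the larger angle is at most pi this is [sin_scale] with factor 1 / (alpha + 1); otherwise
    that angle lies between pi and 2 pi, where the sine is at most 0. *)
Lemma sin_multiple_le (phi : R) : 0 < phi <= phi1 ->
  sin ((2 * alpha + 2) * phi) <= (alpha + 1) * sin (2 * phi).
Proof.
  intros H. pose proof (phi_bounds phi H) as [H1 H2]. pose proof (sin_phi_pos phi H).
  destruct (Rle_lt_dec ((2 * alpha + 2) * phi) PI) as [Hl | Hl].
  - pose proof (sin_scale (/ (alpha + 1)) ((2 * alpha + 2) * phi)) as Hs.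
    assert (Hinv : 0 <= / (alpha + 1) <= 1).
    { split; [left; apply Rinv_0_lt_compat; lra|]. rewrite <- Rinv_1. apply Rinv_le_contravar; lra. }
    specialize (Hs Hinv ltac:(nra)).
    replace (/ (alpha + 1) * ((2 * alpha + 2) * phi)) with (2 * phi) in Hs by (field; lra).
    apply Rmult_le_compat_l with (r := alpha + 1) in Hs; [|lra].
    rewrite <- Rmult_assoc, Rinv_r, Rmult_1_l in Hs by lra. trivial.
  - assert (sin ((2 * alpha + 2) * phi) <= 0) by (apply sin_le_0; nra). nra.
Qed.

(* Where [W] is real on the ray of angle [phi], concavity of the sine and [x > rho] make it
   positive. *)
Lemma W_off_cut (t phi : R) : 0 < phi <= phi1 -> off_cut (Wr t phi) (Wi t phi).
Proof.
  intros H. destruct (Req_dec (Wi t phi) 0) as [E | E]; [right | now left].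
  pose proof (phi_bounds phi H) as [H1 H2]. pose proof (sin_phi_pos phi H) as Hs.
  pose proof (sin_multiple_le phi H) as Hml.
  pose proof (rho_pos alpha Halpha) as Hrho.
  pose proof (rho_scale alpha Halpha) as Hrs. pose proof (exp_tmin alpha Halpha) as Htm.
  set (E0 := exp (-2 * tmin alpha)) in *.
  assert (HE0 : 0 < E0) by apply exp_pos.
  unfold Wi in E. unfold Wr.
  replace ((2 * alpha + 2) * t) with (2 * t + 2 * alpha * t) in * by ring.
  rewrite exp_plus in *.
  set (e := exp (2 * t)) in *. set (s := exp (2 * alpha * t)) in *.
  assert (He : 0 < e) by apply exp_pos. assert (Hs0 : 0 < s) by apply exp_pos.
  set (P := (2 * alpha + 2) * phi) in *.
  assert (E' : x * sin (2 * phi) = s * sin P).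
  { apply Rmult_eq_reg_l with e; lra. }
  assert (HsP : 0 < sin P) by nra.
  assert (HP : 0 < P < PI).
  { split; [unfold P; nra|]. apply Rnot_le_lt. intros Hle.
    assert (sin P <= 0) by (apply sin_le_0; unfold P in *; nra). lra. }
  (* Since [rho alpha] equals [(alpha + 1) * exp (2 * alpha * tmin alpha)], this bound and x > rho
     place t to the right of [tmin alpha]. *)
  assert (Hge : x <= (alpha + 1) * s).
  { assert (x * sin (2 * phi) <= s * ((alpha + 1) * sin (2 * phi))) by nra. nra. }
  assert (Hts : exp (2 * alpha * tmin alpha) < s).
  { rewrite Htm. apply Rmult_lt_reg_l with (alpha + 1); [lra|].
    apply Rlt_le_trans with (2 := Hge). apply Rle_lt_trans with (2 := Hx). rewrite Hrs. right. field. lra. }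
  apply exp_lt_inv in Hts.
  assert (He1 : / E0 < e).
  { unfold E0, e. rewrite <- exp_Ropp. apply exp_increasing. nra. }
  assert (Hsin : alpha / (alpha + 1) * sin P <= sin (2 * alpha * phi)).
  { replace (2 * alpha * phi) with (alpha / (alpha + 1) * P) by (unfold P; field; lra).
    apply sin_scale; [|lra]. split; [apply Rdiv_le_0_compat; lra|].
    apply Rmult_le_reg_r with (alpha + 1); [lra|]. unfold Rdiv. rewrite Rmult_assoc, Rinv_l; lra. }
  assert (Hdiff : sin (2 * alpha * phi) = sin P * cos (2 * phi) - cos P * sin (2 * phi)).
  { rewrite <- sin_minus. f_equal. unfold P. ring. }
  assert (Hx1 : E0 < x * (alpha / (alpha + 1))).
  { apply Rmult_lt_reg_r with ((alpha + 1) / alpha); [apply Rdiv_lt_0_compat; lra|].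
    replace (x * (alpha / (alpha + 1)) * ((alpha + 1) / alpha)) with x by (field; lra). lra. }
  assert (Hx2 : 1 < e * (x * (alpha / (alpha + 1)))).
  { apply Rmult_lt_compat_r with (r := E0) in He1; trivial. rewrite Rinv_l in He1 by lra.
    apply Rlt_trans with (1 := He1). now apply Rmult_lt_compat_l. }
  (* Multiplying the real part by [sin P] and inserting [E'] produces the addition formula for sin(P
     - 2 phi) = sin(2 alpha phi), which [Hsin] bounds from below by a multiple of [sin P]. *)
  assert (Hkey : (x * e * cos (2 * phi) - e * s * cos P) * sin P = e * x * sin (2 * alpha * phi)).
  { rewrite Hdiff.
    replace ((x * e * cos (2 * phi) - e * s * cos P) * sin P)
      with (e * (x * cos (2 * phi) * sin P - cos P * (s * sin P))) by ring.
    rewrite <- E'. ring. }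
  apply Rmult_lt_reg_r with (sin P); trivial. rewrite Rmult_0_l.
  rewrite Rmult_minus_distr_r, Hkey.
  assert (e * x * (alpha / (alpha + 1) * sin P) <= e * x * sin (2 * alpha * phi)).
  { apply Rmult_le_compat_l; trivial. nra. }
  nra.
Qed.

Lemma W_cont_2d (u v : R) :
  continuity_2d_pt Wr u v /\ continuity_2d_pt Wi u v /\ continuity_2d_pt Wr_t u v /\ continuity_2d_pt Wi_t u v.
Proof. unfold Wr, Wi, Wr_t, Wi_t. repeat split; cont2d. Qed.

Lemma p_cont_2d (u v : R) : continuity_2d_pt p u v.
Proof. destruct (W_cont_2d u v) as (H1 & H2 & _). now apply csqrt_re_cont_2d. Qed.

Let q_t (t phi : R) := (p t phi * Wi_t t phi - q t phi * Wr_t t phi) / (2 * (p t phi ^ 2 + q t phi ^ 2)).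

Lemma q_t_cont_2d (t phi : R) : 0 < phi <= phi1 -> continuity_2d_pt q_t t phi.
Proof.
  intros H. destruct (W_cont_2d t phi) as (H1 & H2 & H3 & H4).
  pose proof (W_off_cut t phi H) as Hc. pose proof (csqrt_re_pos _ _ Hc) as Hp.
  assert (Hq : continuity_2d_pt q t phi) by now apply csqrt_im_cont_2d.
  pose proof (p_cont_2d t phi) as Hpc.
  unfold q_t, Rdiv. apply continuity_2d_pt_mult.
  - apply continuity_2d_pt_minus; now apply continuity_2d_pt_mult.
  - apply continuity_2d_pt_inv.
    + simpl. repeat first [assumption | apply continuity_2d_pt_const | apply continuity_2d_pt_plus | apply continuity_2d_pt_mult].
    + fold (p t phi) in Hp. nra.
Qed.

(* Cauchy-Riemann: the [phi]-derivative of the real part is minus the [t]-derivative of the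
   imaginary part. *)
Lemma p_derive (t phi : R) : 0 < phi <= phi1 -> is_derive (fun phi => p t phi) phi (- q_t t phi).
Proof.
  intros H.
  replace (- q_t t phi) with
    ((p t phi * (- Wi_t t phi) + q t phi * Wr_t t phi) / (2 * (p t phi ^ 2 + q t phi ^ 2))).
  - apply (csqrt_derive (fun phi => Wr t phi) (fun phi => Wi t phi)); [| |now apply W_off_cut].
    + unfold Wr, Wi_t. auto_derive; trivial. req. ring.
    + unfold Wi, Wr_t. auto_derive; trivial. req. ring.
  - unfold q_t. pose proof (csqrt_re_pos _ _ (W_off_cut t phi H)) as Hp. fold (p t phi) in Hp.
    field. nra.
Qed.

Lemma q_derive (t phi : R) : 0 < phi <= phi1 -> is_derive (fun t => q t phi) t (q_t t phi).
Proof.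
  intros H. apply (csqrt_derive (fun t => Wr t phi) (fun t => Wi t phi)); [| |now apply W_off_cut].
  - unfold Wr, Wr_t. auto_derive; trivial. req. ring.
  - unfold Wi, Wi_t. auto_derive; trivial. req. ring.
Qed.

(** Cauchy's theorem in differential form: the integrand -q_t is an exact t-derivative, so only the
    vertical sides contribute. The angle 0 is excluded because there the root fails to be
    differentiable at the zeros of W. *)
Lemma RInt_p_derive (t0 t1 phi : R) : 0 < phi < phi1 ->
  is_derive (fun phi => RInt (fun t => p t phi) t0 t1) phi (q t0 phi - q t1 phi).
Proof.
  intros H.
  assert (Hloc : locally phi (fun z => 0 < z <= phi1)).
  { apply (locally_R _ _ (Rmin phi (phi1 - phi))); [apply Rmin_glb_lt; lra|].
    intros y Hy. pose proof (Rmin_l phi (phi1 - phi)). pose proof (Rmin_r phi (phi1 - phi)).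
    apply Rabs_def2 in Hy. lra. }
  assert (E : q t0 phi - q t1 phi = RInt (fun t => Derive (fun phi => p t phi) phi) t0 t1).
  { transitivity (RInt (fun t => - q_t t phi) t0 t1).
    - symmetry. apply is_RInt_unique.
      replace (q t0 phi - q t1 phi) with (minus (- q t1 phi) (- q t0 phi))
        by (unfold minus, plus, opp; simpl; ring).
      apply (is_RInt_derive (V := R_CompleteNormedModule) (fun t => - q t phi)).
      + intros t _. apply (is_derive_opp (V := R_NormedModule) (fun t => q t phi)), q_derive. lra.
      + intros t _. apply (continuous_opp (V := R_NormedModule) (fun t => q_t t phi)).
        apply (continuity_2d_fst q_t), q_t_cont_2d. lra.
    - apply RInt_ext. intros t _. symmetry. apply is_derive_unique, p_derive. lra. }
  rewrite E. apply (is_derive_RInt_param (fun phi t => p t phi)).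
  - generalize Hloc. apply filter_imp. intros z Hz t _. eexists. now apply p_derive.
  - intros t _. apply (continuity_2d_pt_ext_loc (fun z t => - q_t t z)).
    + destruct Hloc as [d Hd]. exists d. intros u v Hu _. symmetry. apply is_derive_unique, p_derive.
      apply Hd, Hu.
    + apply continuity_2d_pt_opp. apply (continuity_2d_swap q_t), q_t_cont_2d. lra.
  - apply filter_forall. intros z. apply ex_RInt_cont. intros t. apply (continuity_2d_fst p), p_cont_2d.
Qed.

Lemma p_phi0 (t : R) : p t 0 = sqrt (W alpha t x).
Proof.
  unfold p. replace (Wi t 0) with 0.
  - rewrite csqrt_re_0. f_equal. unfold Wr, W. rewrite !Rmult_0_r, cos_0. ring.
  - unfold Wi. rewrite !Rmult_0_r, sin_0. ring.
Qed.

(** [err_left] dominates |W + 1|, which measures the distance of the root from i. [err_right]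
    dominates its distance from r = -i e^((alpha+1)(t + i phi)), whose imaginary part is the cosine
    term in [q_right]. *)
Let err_left (t : R) := x * exp (2 * t) + exp ((2 * alpha + 2) * t).
Let err_right (t : R) := 2 * (x * exp (2 * t) + 1) / exp ((alpha + 1) * t).

(** |sqrt W - i| |sqrt W + i| = |W + 1|. The condition on t makes the imaginary part of W positive,
    hence q > 0, so the second factor is at least 1. *)
Lemma q_left (t phi : R) : 0 < phi <= phi1 -> (alpha + 1) * exp (2 * alpha * t) < x ->
  Rabs (q t phi - 1) <= err_left t.
Proof.
  intros H Ht.
  pose proof (W_off_cut t phi H) as Hc. pose proof (csqrt_re_pos _ _ Hc) as Hp.
  destruct (csqrt_spec _ _ Hc) as (E1 & E2 & _). fold (p t phi) in *. fold (q t phi) in *.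
  pose proof (sin_phi_pos phi H) as Hs. pose proof (sin_multiple_le phi H) as Hm.
  pose proof (exp_pos (2 * t)) as He. pose proof (exp_pos (2 * alpha * t)) as Hs0.
  pose proof (rho_pos alpha Halpha).
  assert (Hwi : 0 < Wi t phi).
  { unfold Wi. replace ((2 * alpha + 2) * t) with (2 * t + 2 * alpha * t) by ring. rewrite exp_plus.
    assert (exp (2 * alpha * t) * sin ((2 * alpha + 2) * phi) < x * sin (2 * phi)).
    { apply Rle_lt_trans with (exp (2 * alpha * t) * ((alpha + 1) * sin (2 * phi))).
      - apply Rmult_le_compat_l; lra.
      - nra. }
    nra. }
  assert (Hq : 0 < q t phi) by nra.
  set (X := x * exp (2 * t)) in *. set (Y := exp ((2 * alpha + 2) * t)) in *.
  assert (HX : 0 < X) by (unfold X; nra). assert (HY : 0 < Y) by apply exp_pos.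
  assert (Hmod : (Wr t phi + 1) ^ 2 + Wi t phi ^ 2 <= err_left t ^ 2).
  { unfold Wr, Wi, err_left. fold X Y.
    pose proof (sin2_cos2 (2 * phi)) as N1. pose proof (sin2_cos2 ((2 * alpha + 2) * phi)) as N2.
    unfold Rsqr in N1, N2.
    set (c1 := cos (2 * phi)) in *. set (s1 := sin (2 * phi)) in *.
    set (c2 := cos ((2 * alpha + 2) * phi)) in *. set (s2 := sin ((2 * alpha + 2) * phi)) in *.
    replace (s1 * s1 + c1 * c1) with (s1 ^ 2 + c1 ^ 2) in N1 by ring.
    replace (s2 * s2 + c2 * c2) with (s2 ^ 2 + c2 ^ 2) in N2 by ring.
    replace ((X * c1 - Y * c2 - 1 + 1) ^ 2 + (X * s1 - Y * s2) ^ 2)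
      with (X ^ 2 * (s1 ^ 2 + c1 ^ 2) + Y ^ 2 * (s2 ^ 2 + c2 ^ 2) - 2 * (X * Y) * (c1 * c2 + s1 * s2)) by ring.
    rewrite N1, N2. pose proof (pow2_ge_0 (c1 + c2)). pose proof (pow2_ge_0 (s1 + s2)).
    assert (- 1 <= c1 * c2 + s1 * s2) by lra.
    assert (0 < X * Y) by nra. nra. }
  assert (Hid : (p t phi ^ 2 + (q t phi - 1) ^ 2) * (p t phi ^ 2 + (q t phi + 1) ^ 2)
                = (Wr t phi + 1) ^ 2 + Wi t phi ^ 2) by (rewrite <- E1, <- E2; ring).
  assert (Hel : 0 < err_left t) by (unfold err_left; fold X Y; lra).
  apply Rabs_le. 
  assert ((q t phi - 1) ^ 2 <= err_left t ^ 2).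
  { apply Rle_trans with (2 := Hmod). rewrite <- Hid.
    pose proof (pow2_ge_0 (p t phi)) as Hp2. pose proof (pow2_ge_0 (q t phi - 1)) as Hq2.
    assert (Hq3 : 1 <= (q t phi + 1) ^ 2) by nra.
    apply Rle_trans with ((p t phi ^ 2 + (q t phi - 1) ^ 2) * 1); [lra|].
    apply Rmult_le_compat_l; lra. }
  split; nra.
Qed.

(** With r = -i e^((alpha+1)(t + i phi)) one has (sqrt W - r)(sqrt W + r) = x e^(2(t + i phi)) - 1,
    of modulus at most X + 1. The factor |sqrt W + r| is at least E / sqrt 2: up to angle B = pi/4
    and beyond pi/2 the imaginary parts of the root and of r do not oppose each other, and in
    between sin^2 B >= 1/2 suffices. *)
Lemma q_right (t phi : R) : 0 < phi < phi1 -> x * exp (2 * t) < exp ((2 * alpha + 2) * t) ->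
  Rabs (q t phi + exp ((alpha + 1) * t) * cos ((alpha + 1) * phi)) <= err_right t.
Proof.
  intros H Ht.
  assert (H' : 0 < phi <= phi1) by lra.
  pose proof (W_off_cut t phi H') as Hc. pose proof (csqrt_re_pos _ _ Hc) as Hp.
  destruct (csqrt_spec _ _ Hc) as (E1 & E2 & _). fold (p t phi) in *. fold (q t phi) in *.
  pose proof (sin_phi_pos phi H') as Hs. pose proof (phi_bounds phi H') as [Hb1 Hb2].
  pose proof (rho_pos alpha Halpha). pose proof PI_RGT_0 as HPI.
  set (E := exp ((alpha + 1) * t)) in *. set (B := (alpha + 1) * phi) in *.
  assert (HE : 0 < E) by apply exp_pos.
  assert (HE2 : exp ((2 * alpha + 2) * t) = E * E) by (unfold E; rewrite <- exp_plus; f_equal; ring).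
  assert (HB2 : (2 * alpha + 2) * phi = 2 * B) by (unfold B; ring).
  set (X := x * exp (2 * t)) in *.
  assert (HX : 0 < X) by (unfold X; pose proof (exp_pos (2 * t)); nra).
  assert (Hsb : 0 <= sin B) by (apply sin_ge_0; lra).
  assert (N1 : sin B ^ 2 + cos B ^ 2 = 1) by (pose proof (sin2_cos2 B); unfold Rsqr in *; lra).
  assert (HWi : Wi t phi = X * sin (2 * phi) - E * E * sin (2 * B)).
  { unfold Wi. fold X. rewrite HE2, HB2. reflexivity. }
  assert (HWr : Wr t phi = X * cos (2 * phi) - E * E * cos (2 * B) - 1).
  { unfold Wr. fold X. rewrite HE2, HB2. reflexivity. }
  set (P := p t phi) in *. set (Q := q t phi) in *.
  assert (Hsq : forall u v, 0 <= u * v -> u ^ 2 <= (v + u) ^ 2).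
  { intros u v Huv. pose proof (pow2_ge_0 v). replace ((v + u) ^ 2) with (v ^ 2 + 2 * (u * v) + u ^ 2) by ring. lra. }
  assert (HsP : E ^ 2 * sin B ^ 2 <= (P + E * sin B) ^ 2).
  { rewrite <- Rpow_mult_distr. apply Hsq. repeat apply Rmult_le_pos; lra. }
  assert (HE3 : E ^ 2 * sin B ^ 2 + E ^ 2 * cos B ^ 2 = E ^ 2) by (rewrite <- Rmult_plus_distr_l, N1; ring).
  assert (HE4 : 0 < E ^ 2) by (apply pow2_gt_0; lra).
  (* The two roots [+-(-i e^((alpha+1) w))] of [-e^(2 (alpha+1) w)] are told apart by the signs. *)
  assert (HY : E ^ 2 / 2 <= (P + E * sin B) ^ 2 + (Q - E * cos B) ^ 2).
  { destruct (Rle_lt_dec B (PI / 4)) as [C1 | C1].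
    - assert (sin (2 * phi) <= sin (2 * B)) by (apply sin_incr_1; unfold B in *; nra).
      assert (0 <= cos B) by (apply cos_ge_0; lra).
      assert (Wi t phi < 0) by (rewrite HWi; nra).
      assert (Q < 0) by nra.
      assert (E ^ 2 * cos B ^ 2 <= (Q - E * cos B) ^ 2); [|lra].
      replace (E ^ 2 * cos B ^ 2) with ((- (E * cos B)) ^ 2) by ring.
      apply Hsq. assert (0 <= E * cos B) by (apply Rmult_le_pos; lra). nra.
    - destruct (Rle_lt_dec B (PI / 2)) as [C2 | C2].
      + assert (cos (2 * B) <= 0) by (apply cos_le_0; lra).
        rewrite cos_2a in *.
        assert (1 / 2 <= sin B ^ 2) by nra.
        pose proof (pow2_ge_0 (Q - E * cos B)).
        assert (E ^ 2 * (1 / 2) <= E ^ 2 * sin B ^ 2) by (apply Rmult_le_compat_l; lra). lra.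
      + assert (sin (2 * B) <= 0) by (apply sin_le_0; lra).
        assert (cos B <= 0) by (apply cos_le_0; lra).
        assert (0 < Wi t phi) by (rewrite HWi; nra).
        assert (0 < Q) by nra.
        assert (E ^ 2 * cos B ^ 2 <= (Q - E * cos B) ^ 2); [|lra].
        replace (E ^ 2 * cos B ^ 2) with ((- (E * cos B)) ^ 2) by ring.
        apply Hsq. assert (0 <= E * - cos B) by (apply Rmult_le_pos; lra). nra. }
  assert (Hid : ((P - E * sin B) ^ 2 + (Q + E * cos B) ^ 2) * ((P + E * sin B) ^ 2 + (Q - E * cos B) ^ 2)
    = (X * cos (2 * phi) - 1) ^ 2 + (X * sin (2 * phi)) ^ 2).
  { replace (((P - E * sin B) ^ 2 + (Q + E * cos B) ^ 2) * ((P + E * sin B) ^ 2 + (Q - E * cos B) ^ 2))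
      with ((P ^ 2 - Q ^ 2 + E * E * (cos B * cos B - sin B * sin B)) ^ 2
            + (2 * P * Q + E * E * (2 * sin B * cos B)) ^ 2) by ring.
    rewrite <- cos_2a, <- sin_2a, E1, E2, HWr, HWi. ring. }
  assert (Hmod : (X * cos (2 * phi) - 1) ^ 2 + (X * sin (2 * phi)) ^ 2 <= (X + 1) ^ 2).
  { pose proof (sin2_cos2 (2 * phi)) as N2. unfold Rsqr in N2.
    pose proof (COS_bound (2 * phi)).
    replace ((X * cos (2 * phi) - 1) ^ 2 + (X * sin (2 * phi)) ^ 2)
      with (X ^ 2 * (sin (2 * phi) * sin (2 * phi) + cos (2 * phi) * cos (2 * phi)) - 2 * X * cos (2 * phi) + 1) by ring.
    rewrite N2. nra. }
  assert (Herr : err_right t * E = 2 * (X + 1)) by (unfold err_right; fold E X; field; lra).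
  assert (Her0 : 0 < err_right t) by (unfold err_right; fold E X; apply Rdiv_lt_0_compat; lra).
  assert (Hfin : (Q + E * cos B) ^ 2 <= err_right t ^ 2).
  { set (Y2 := (P + E * sin B) ^ 2 + (Q - E * cos B) ^ 2) in *.
    set (Z := Q + E * cos B) in *.
    assert (Hz : Z ^ 2 * (E ^ 2 / 2) <= (X + 1) ^ 2).
    { apply Rle_trans with (Z ^ 2 * Y2).
      - apply Rmult_le_compat_l; trivial. apply pow2_ge_0.
      - apply Rle_trans with (2 := Hmod). rewrite <- Hid.
        pose proof (pow2_ge_0 (P - E * sin B)). apply Rmult_le_compat_r; lra. }
    apply Rmult_le_reg_r with (E ^ 2); [lra|].
    replace (err_right t ^ 2 * E ^ 2) with ((2 * (X + 1)) ^ 2) by (rewrite <- Herr; ring).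
    pose proof (pow2_ge_0 (X + 1)). lra. }
  apply Rabs_le. split; nra.
Qed.

(** [G] removes from the horizontal integral the limiting contributions of both vertical sides: phi
    on the left, and on the right a multiple of sin((alpha+1) phi), which vanishes at phi = 0 and at
    [phi1]. What remains has derivative at most [err_left t0 + err_right t1]. *)
Lemma contour_shift (t0 t1 : R) :
  (alpha + 1) * exp (2 * alpha * t0) < x -> x * exp (2 * t1) < exp ((2 * alpha + 2) * t1) ->
  Rabs (RInt (fun t => p t phi1) t0 t1 - RInt (fun t => sqrt (W alpha t x)) t0 t1 - phi1)
  <= (err_left t0 + err_right t1) * phi1.
Proof.
  intros H0 H1. destruct phi1_bounds as [Hphi Hphi'].
  set (E := exp ((alpha + 1) * t1)).
  set (G := fun phi => RInt (fun t => p t phi) t0 t1 - phi - E / (alpha + 1) * sin ((alpha + 1) * phi)).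
  (* [MVT_gen] places its point in the closed interval while the derivative is known only in the
     open one; the value 0 at the ends keeps the bound valid there. *)
  set (dG := fun phi => if Rlt_dec 0 phi then if Rlt_dec phi phi1 then
     q t0 phi - q t1 phi - 1 - E * cos ((alpha + 1) * phi) else 0 else 0).
  assert (Hnn : 0 <= err_left t0 + err_right t1).
  { assert (0 < phi1 / 2 < phi1) by lra.
    pose proof (q_left t0 (phi1 / 2) ltac:(lra) H0). pose proof (q_right t1 (phi1 / 2) ltac:(lra) H1).
    pose proof (Rabs_pos (q t0 (phi1 / 2) - 1)).
    pose proof (Rabs_pos (q t1 (phi1 / 2) + exp ((alpha + 1) * t1) * cos ((alpha + 1) * (phi1 / 2)))). lra. }
  destruct (MVT_gen G 0 phi1 dG) as (c & Hc & HE).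
  - rewrite Rmin_left, Rmax_right by lra. intros phi Hp. unfold G, dG.
    destruct (Rlt_dec 0 phi); [|lra]. destruct (Rlt_dec phi phi1); [|lra].
    apply (is_derive_minus (V := R_NormedModule) (fun phi => RInt (fun t => p t phi) t0 t1 - phi)).
    + apply (is_derive_minus (V := R_NormedModule)); [now apply RInt_p_derive | apply (is_derive_id (K := R_AbsRing))].
    + auto_derive; trivial. req. field. lra.
  - intros phi _. apply continuity_pt_filterlim. change (continuous G phi). unfold G.
    apply (cont_minus (fun phi => RInt (fun t => p t phi) t0 t1 - phi)); [|smooth].
    apply (cont_minus); [|apply continuous_id].
    apply continuous_RInt_param. intros; apply p_cont_2d.
  - unfold G in HE. rewrite Hphi', sin_PI, !Rmult_0_r, sin_0, !Rmult_0_r in HE.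
    assert (E0 : RInt (fun t => p t 0) t0 t1 = RInt (fun t => sqrt (W alpha t x)) t0 t1).
    { apply RInt_ext. intros; apply p_phi0. }
    rewrite E0 in HE.
    replace (RInt (fun t => p t phi1) t0 t1 - RInt (fun t => sqrt (W alpha t x)) t0 t1 - phi1)
      with (dG c * (phi1 - 0)) by lra.
    rewrite Rabs_mult, (Rabs_pos_eq (phi1 - 0)), Rminus_0_r by lra.
    apply Rmult_le_compat_r; [lra|]. unfold dG.
    destruct (Rlt_dec 0 c); [|rewrite Rabs_R0; lra]. destruct (Rlt_dec c phi1); [|rewrite Rabs_R0; lra].
    pose proof (q_left t0 c ltac:(lra) H0) as B1. pose proof (q_right t1 c ltac:(lra) H1) as B2. fold E in B2.
    apply Rabs_le_between in B1. apply Rabs_le_between in B2. apply Rabs_le. lra.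
Qed.

Lemma p_line_integral : line_integral (fun t => p t phi1) (PI * S alpha x + phi1).
Proof.
  intros eps He. destruct phi1_bounds as [Hphi _]. pose proof (rho_pos alpha Halpha) as Hrho.
  assert (L1 : tends (fun s => (alpha + 1) * exp (2 * alpha * - s)) ((alpha + 1) * 0)).
  { apply tends_scal. apply (tends_squeeze _ (fun s => exp (- (2 * alpha) * s))).
    - exists 0. intros s _. rewrite Rminus_0_r, Rabs_pos_eq by (left; apply exp_pos).
      right. f_equal. ring.
    - apply tends_exp_neg. lra. }
  rewrite Rmult_0_r in L1. destruct (L1 x) as [M1 HM1]; [lra|].
  assert (L2 : tends (fun s => phi1 * err_left (- s)) (phi1 * (x * 0 + 0))).
  { apply tends_scal. unfold err_left. apply (tends_plus (fun s => x * exp (2 * - s))).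
    - apply tends_scal. apply (tends_squeeze _ (fun s => exp (- (2) * s))); [|apply tends_exp_neg; lra].
      exists 0. intros s _. rewrite Rminus_0_r, Rabs_pos_eq by (left; apply exp_pos).
      right. f_equal. ring.
    - apply (tends_squeeze _ (fun s => exp (- (2 * alpha + 2) * s))); [|apply tends_exp_neg; lra].
      exists 0. intros s _. rewrite Rminus_0_r, Rabs_pos_eq by (left; apply exp_pos).
      right. f_equal. ring. }
  replace (phi1 * (x * 0 + 0)) with 0 in L2 by ring.
  destruct (L2 (eps / 2)) as [M2 HM2]; [lra|].
  assert (L3 : tends (fun s => x * exp (- (2 * alpha) * s)) (x * 0)) by (apply tends_scal, tends_exp_neg; lra).
  rewrite Rmult_0_r in L3. destruct (L3 1) as [M3 HM3]; [lra|].
  (* This is [err_right] times [phi1]. It tends to 0 because alpha > 1 makes the root of u^(2 alpha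
     + 2) outgrow u^2. *)
  assert (L4 : tends (fun s => 2 * phi1 * (x * exp (- (alpha - 1) * s) + exp (- (alpha + 1) * s))) (2 * phi1 * (x * 0 + 0))).
  { apply tends_scal, tends_plus; [apply tends_scal|]; apply tends_exp_neg; lra. }
  replace (2 * phi1 * (x * 0 + 0)) with 0 in L4 by ring.
  destruct (L4 (eps / 2)) as [M4 HM4]; [lra|].
  exists (Rmax (Rmax M1 M2) (Rmax (Rmax M3 M4) (Rabs x))).
  intros a b Ha Hb.
  pose proof (Rmax_l (Rmax M1 M2) (Rmax (Rmax M3 M4) (Rabs x))).
  pose proof (Rmax_r (Rmax M1 M2) (Rmax (Rmax M3 M4) (Rabs x))).
  pose proof (Rmax_l M1 M2). pose proof (Rmax_r M1 M2).
  pose proof (Rmax_l (Rmax M3 M4) (Rabs x)). pose proof (Rmax_r (Rmax M3 M4) (Rabs x)).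
  pose proof (Rmax_l M3 M4). pose proof (Rmax_r M3 M4).
  specialize (HM1 (- a) ltac:(lra)). specialize (HM2 (- a) ltac:(lra)).
  specialize (HM3 b ltac:(lra)). specialize (HM4 b ltac:(lra)).
  rewrite !Ropp_involutive, !Rminus_0_r in *.
  apply Rabs_def2 in HM1. apply Rabs_def2 in HM2. apply Rabs_def2 in HM3. apply Rabs_def2 in HM4.
  assert (Hb2 : x * exp (2 * b) < exp ((2 * alpha + 2) * b)).
  { replace (2 * b) with (- (2 * alpha) * b + (2 * alpha + 2) * b) at 1 by ring. rewrite exp_plus.
    pose proof (exp_pos ((2 * alpha + 2) * b)). nra. }
  pose proof (contour_shift a b (proj1 HM1) Hb2) as HC.
  rewrite S_window in HC by (trivial; lra).
  assert (HR : err_right b * phi1 = 2 * phi1 * (x * exp (- (alpha - 1) * b) + exp (- (alpha + 1) * b))).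
  { unfold err_right. pose proof (exp_pos ((alpha + 1) * b)).
    replace (- (alpha - 1) * b) with (2 * b + - ((alpha + 1) * b)) by ring.
    replace (- (alpha + 1) * b) with (- ((alpha + 1) * b)) by ring.
    rewrite exp_plus, exp_Ropp. field. lra. }
  rewrite Rmult_plus_distr_r, HR in HC.
  replace (RInt (fun t => p t phi1) a b - (PI * S alpha x + phi1))
    with (RInt (fun t => p t phi1) a b - PI * S alpha x - phi1) by ring.
  lra.
Qed.

End Contour.

(** * The integral equation for [S] *)

Lemma tends_inv (c : R) : tends (fun s => c / s) 0.
Proof.
  intros eps He. exists (Rabs c / eps + 1). intros s Hs.
  pose proof (Rabs_pos c).
  assert (0 <= Rabs c / eps) by (apply Rdiv_le_0_compat; lra).
  rewrite Rminus_0_r. unfold Rdiv. rewrite Rabs_mult, Rabs_inv, (Rabs_pos_eq s) by lra.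
  apply Rmult_lt_reg_r with s; [lra|]. rewrite Rmult_assoc, Rinv_l, Rmult_1_r by lra.
  apply Rlt_le_trans with (eps * (Rabs c / eps + 1)).
  - rewrite Rmult_plus_distr_l. replace (eps * (Rabs c / eps)) with (Rabs c) by (field; lra). lra.
  - apply Rmult_le_compat_l; lra.
Qed.

(** The Poisson formula on the upper half-plane: with z = a + (b1 + i b2)^2 the denominator is |y -
    z|^2 and 2 b1 b2 is the imaginary part of z, so the value is the real part of sqrt(z - a).
    Taking b1 and b2 as parameters keeps complex roots out. After y = a + s^2 the denominator
    factors as D1 D2 and partial fractions apply. *)
Lemma half_line_root_integral (a b1 b2 : R) : 0 < b1 -> 0 < b2 ->
  line_integral (fun y => 2 * b1 * b2 / PI * (sqrt (y - a) / ((y - a - b1 ^ 2 + b2 ^ 2) ^ 2 + (2 * b1 * b2) ^ 2))) b1.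
Proof.
  intros H1 H2. pose proof PI_RGT_0 as HPI.
  set (g := fun y => 2 * b1 * b2 / PI * (sqrt (y - a) / ((y - a - b1 ^ 2 + b2 ^ 2) ^ 2 + (2 * b1 * b2) ^ 2))).
  assert (Hden : forall y, 0 < (y - a - b1 ^ 2 + b2 ^ 2) ^ 2 + (2 * b1 * b2) ^ 2).
  { intros y. pose proof (pow2_ge_0 (y - a - b1 ^ 2 + b2 ^ 2)).
    assert (0 < (2 * b1 * b2) ^ 2) by (apply pow2_gt_0; nra). lra. }
  assert (Cg : forall y : R, continuous g y).
  { intros y. unfold g.
    apply (cont_mult (fun _ => 2 * b1 * b2 / PI)); [apply continuous_const|].
    apply (cont_mult (fun y => sqrt (y - a))).
    - apply continuous_comp; [smooth | apply continuous_sqrt].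
    - specialize (Hden y). smooth. simpl in Hden. unfold Rminus in Hden. lra. }
  set (D1 := fun s => (s - b1) ^ 2 + b2 ^ 2). set (D2 := fun s => (s + b1) ^ 2 + b2 ^ 2).
  assert (HD1 : forall s, 0 < D1 s).
  { intros s. unfold D1. pose proof (pow2_ge_0 (s - b1)). assert (0 < b2 ^ 2) by (apply pow2_gt_0; lra). lra. }
  assert (HD2 : forall s, 0 < D2 s).
  { intros s. unfold D2. pose proof (pow2_ge_0 (s + b1)). assert (0 < b2 ^ 2) by (apply pow2_gt_0; lra). lra. }
  (* The partial-fraction primitive. At +oo the logarithms cancel and each arctangent gives pi/2, so
     the limit is b1; at s = 0 it vanishes. *)
  set (Phi := fun s => b2 / (2 * PI) * (ln (D1 s) - ln (D2 s))
     + b1 / PI * (atan ((s - b1) / b2) + atan ((s + b1) / b2))).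
  assert (DPhi : forall s : R, is_derive Phi s (4 * b1 * b2 / PI * (s ^ 2 / (D1 s * D2 s)))).
  { intros s. specialize (HD1 s). specialize (HD2 s). unfold Phi, D1, D2 in *. simpl in *.
    auto_derive; [unfold Rminus in *; repeat split; lra|]. req. field.
    unfold Rminus in *. repeat split; try lra; nra. }
  assert (HPhi : forall B, a <= B -> RInt g a B = Phi (sqrt (B - a))).
  { intros B HB. pose proof (sqrt_pos (B - a)) as Hs. set (s := sqrt (B - a)) in *.
    assert (HBs : B = s ^ 2 + a).
    { unfold s. simpl. rewrite Rmult_1_r, sqrt_sqrt; lra. }
    assert (E : RInt g a B = RInt g (0 ^ 2 + a) (s ^ 2 + a)) by (rewrite HBs; f_equal; ring).
    rewrite E. rewrite <- (RInt_comp (V := R_CompleteNormedModule) g (fun s => s ^ 2 + a) (fun s => 2 * s)).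
    - transitivity (RInt (fun s => 4 * b1 * b2 / PI * (s ^ 2 / (D1 s * D2 s))) 0 s).
      + apply RInt_ext. intros u Hu. rewrite Rmin_left, Rmax_right in Hu by lra.
        unfold scal; simpl. unfold mult; simpl. unfold g. req.
        replace (u * (u * 1) + a - a) with (u ^ 2) by ring.
        rewrite sqrt_pow2 by lra.
        replace ((u ^ 2 - b1 ^ 2 + b2 ^ 2) ^ 2 + (2 * b1 * b2) ^ 2) with (D1 u * D2 u) by (unfold D1, D2; ring).
        specialize (HD1 u). specialize (HD2 u). field. lra.
      + apply is_RInt_unique. replace (Phi s) with (minus (Phi s) (Phi 0)).
        * apply (is_RInt_derive (V := R_CompleteNormedModule)); [intros; apply DPhi|].
          intros u _. specialize (HD1 u). specialize (HD2 u). unfold D1, D2 in *. simpl in *. smooth.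
          unfold Rminus in *. nra.
        * unfold minus, plus, opp; simpl. unfold Phi.
          replace (D1 0) with (D2 0) by (unfold D1, D2; ring).
          replace ((0 - b1) / b2) with (- ((0 + b1) / b2)) by (field; lra). rewrite atan_opp. ring.
    - intros u _. apply Cg.
    - intros u _. split; [|smooth]. auto_derive; trivial. req. ring. }
  assert (LPhi : tends Phi (b2 / (2 * PI) * 0 + b1 / PI * (PI / 2 + PI / 2))).
  { unfold Phi. apply (tends_plus (fun s => b2 / (2 * PI) * (ln (D1 s) - ln (D2 s)))).
    (* D2 - D1 = 4 s b1 and, for s >= 2 b1, D1 >= s^2 / 4; hence ln(D2 / D1) <= D2 / D1 - 1 <= 16 b1
       / s. *)
    - apply tends_scal. apply (tends_squeeze _ (fun s => 16 * b1 / s)); [|apply tends_inv].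
      exists (2 * b1). intros s Hs. rewrite Rminus_0_r.
      specialize (HD1 s). specialize (HD2 s).
      assert (D1 s <= D2 s) by (unfold D1, D2; nra).
      assert (Hl : ln (D1 s) <= ln (D2 s)).
      { destruct (Rle_lt_or_eq_dec _ _ H) as [E | E]; [left; now apply ln_increasing | rewrite E; lra]. }
      rewrite <- Rabs_Ropp, Rabs_pos_eq by lra.
      replace (- (ln (D1 s) - ln (D2 s))) with (ln (D2 s / D1 s)) by (rewrite ln_div by trivial; ring).
      assert (Hq : 0 < D2 s / D1 s) by (apply Rdiv_lt_0_compat; lra).
      pose proof (exp_ineq1_le (ln (D2 s / D1 s))) as Hln. rewrite exp_ln in Hln by trivial.
      assert (D2 s / D1 s <= 1 + 16 * b1 / s); [|lra].
      apply Rmult_le_reg_r with (D1 s * s); [nra|].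
      replace (D2 s / D1 s * (D1 s * s)) with (D2 s * s) by (field; lra).
      replace ((1 + 16 * b1 / s) * (D1 s * s)) with (D1 s * (s + 16 * b1)) by (field; lra).
      assert (Hs4 : s ^ 2 / 4 <= D1 s) by (unfold D1; nra).
      assert (D2 s = D1 s + 4 * s * b1) by (unfold D1, D2; ring).
      assert (s ^ 2 / 4 * (16 * b1) <= D1 s * (16 * b1)) by (apply Rmult_le_compat_r; lra).
      nra.
    - apply (tends_scal (fun s => atan ((s - b1) / b2) + atan ((s + b1) / b2))).
      apply (tends_plus (fun s => atan ((s - b1) / b2))); apply atan_tends; intros B.
      + exists (B * b2 + b1). intros s Hs. apply Rmult_le_reg_r with b2; trivial.
        unfold Rdiv. rewrite Rmult_assoc, Rinv_l by lra. lra.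
      + exists (B * b2 - b1). intros s Hs. apply Rmult_le_reg_r with b2; trivial.
        unfold Rdiv. rewrite Rmult_assoc, Rinv_l by lra. lra. }
  replace (b2 / (2 * PI) * 0 + b1 / PI * (PI / 2 + PI / 2)) with b1 in LPhi by (field; lra).
  intros eps He. destruct (LPhi eps He) as [M HM].
  exists (Rmax (Rabs a) (M ^ 2 + a)). intros A B HA HB.
  pose proof (Rmax_l (Rabs a) (M ^ 2 + a)). pose proof (Rmax_r (Rabs a) (M ^ 2 + a)).
  pose proof (Rle_abs a). pose proof (Rle_abs (- a)). rewrite Rabs_Ropp in *.
  pose proof (pow2_ge_0 M).
  rewrite <- (RInt_cont_Chasles _ A a B) by trivial.
  rewrite (RInt_eq_0 g A a).
  - rewrite Rplus_0_l, HPhi by lra. apply HM.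
    apply Rle_trans with (Rabs M); [apply Rle_abs|].
    rewrite <- sqrt_Rsqr_abs. apply sqrt_le_1_alt. unfold Rsqr. lra.
  - intros y Hy. rewrite Rmin_left, Rmax_right in Hy by lra. unfold g.
    rewrite sqrt_neg_0 by lra. unfold Rdiv. ring.
Qed.

(** This is |x e^(i theta) - y|^2. It has no zero for x > 0, so [ker] continues K(x/y) / y to every
    real y and the integrals can run over the whole line. *)
Definition kden (alpha x y : R) : R := x ^ 2 + y ^ 2 - 2 * x * y * cos (theta alpha).
Definition ker (alpha x y : R) : R := sin (theta alpha) / PI * (x / kden alpha x y).

Section Alpha.
Variable alpha : R.
Hypothesis Halpha : 1 < alpha.

Lemma theta_bounds : 0 < theta alpha < PI.
Proof.
  pose proof PI_RGT_0. unfold theta. split; [apply Rdiv_lt_0_compat; lra|].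
  apply Rmult_lt_reg_r with (1 + alpha); [lra|]. unfold Rdiv. rewrite Rmult_assoc, Rinv_l by lra. nra.
Qed.

Lemma sin_theta_pos : 0 < sin (theta alpha).
Proof. pose proof theta_bounds. apply sin_gt_0; lra. Qed.

(** The lower constant in the comparison of [kden] with x^2 + y^2; it is positive because theta lies
    strictly between 0 and pi. *)
Definition kgap : R := 1 - Rabs (cos (theta alpha)).

Lemma kgap_pos : 0 < kgap <= 1.
Proof.
  unfold kgap. pose proof (Rabs_pos (cos (theta alpha))). split; [|lra].
  pose proof sin_theta_pos. pose proof (sin2_cos2 (theta alpha)) as E. unfold Rsqr in E.
  assert (Rabs (cos (theta alpha)) < 1); [|lra]. apply Rabs_def1; nra.
Qed.

Lemma kden_bounds (x y : R) :
  kgap * (x ^ 2 + y ^ 2) <= kden alpha x y <= 2 * (x ^ 2 + y ^ 2).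
Proof.
  unfold kgap, kden. set (c := cos (theta alpha)).
  assert (Hc : Rabs (2 * x * y * c) <= (x ^ 2 + y ^ 2) * Rabs c).
  { rewrite Rabs_mult. apply Rmult_le_compat_r; [apply Rabs_pos|]. apply Rabs_le.
    pose proof (pow2_ge_0 (x - y)). pose proof (pow2_ge_0 (x + y)). split; lra. }
  apply Rabs_le_between in Hc.
  assert (Rabs c <= 1) by (unfold c; pose proof (COS_bound (theta alpha)); apply Rabs_le; lra).
  pose proof (pow2_ge_0 x). pose proof (pow2_ge_0 y). split; nra.
Qed.

Lemma kden_pos (x y : R) : 0 < x -> 0 < kden alpha x y.
Proof.
  intros Hx. pose proof (kden_bounds x y). pose proof kgap_pos. pose proof (pow2_ge_0 y).
  assert (0 < x ^ 2) by (apply pow2_gt_0; lra). nra.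
Qed.

Lemma ker_pos (x y : R) : 0 < x -> 0 < ker alpha x y.
Proof.
  intros Hx. unfold ker. pose proof (kden_pos x y Hx). pose proof sin_theta_pos. pose proof PI_RGT_0.
  apply Rmult_lt_0_compat; apply Rdiv_lt_0_compat; trivial.
Qed.

Lemma K_ker (x y : R) : 0 < x -> 0 < y -> K alpha (x / y) / y = ker alpha x y.
Proof.
  intros Hx Hy. unfold K, ker. pose proof (kden_pos x y Hx) as H. unfold kden in *.
  pose proof PI_RGT_0. simpl in *. field. repeat split; try lra.
Qed.

Lemma ker_cont (x y : R) : 0 < x -> continuous (fun y => ker alpha x y) y.
Proof.
  intros Hx. pose proof (kden_pos x y Hx) as H. unfold ker, kden in *. simpl in *. smooth.
  unfold Rminus in *. lra.
Qed.

(** For fixed t, W is affine in its second argument, so this is the Poisson formula with a =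
    [level alpha t] and z = x e^(i theta). The factor e^(2t) leaves the root as e^t, whence [b1] and
    [b2] are the parts of the root divided by e^t. *)
Lemma ker_sqrt_W (x t : R) : 0 < x ->
  line_integral (fun y => ker alpha x y * sqrt (W alpha t y))
    (csqrt_re (exp (2 * t) * (x * cos (theta alpha) - level alpha t)) (exp (2 * t) * (x * sin (theta alpha)))).
Proof.
  intros Hx. pose proof sin_theta_pos as Hs. pose proof PI_RGT_0 as HPI.
  set (A := exp (2 * t) * (x * cos (theta alpha) - level alpha t)).
  set (B := exp (2 * t) * (x * sin (theta alpha))).
  pose proof (exp_pos t) as Het.
  assert (He2 : exp (2 * t) = exp t * exp t) by (rewrite <- exp_plus; f_equal; ring).
  assert (HB : 0 < B) by (unfold B; rewrite He2; apply Rmult_lt_0_compat; nra).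
  assert (Hoff : off_cut A B) by (left; lra).
  destruct (csqrt_spec A B Hoff) as (E1 & E2 & _). pose proof (csqrt_re_pos A B Hoff) as Hp.
  set (p := csqrt_re A B) in *. set (q := csqrt_im A B) in *.
  assert (Hq : 0 < q) by nra.
  set (b1 := p / exp t). set (b2 := q / exp t).
  assert (Hb1 : 0 < b1) by (apply Rdiv_lt_0_compat; lra).
  assert (Hb2 : 0 < b2) by (apply Rdiv_lt_0_compat; lra).
  assert (F1 : b1 ^ 2 - b2 ^ 2 = x * cos (theta alpha) - level alpha t).
  { apply Rmult_eq_reg_l with (exp (2 * t)); [|pose proof (exp_pos (2 * t)); lra].
    fold A. rewrite <- E1, He2. unfold b1, b2. field. lra. }
  assert (F2 : 2 * b1 * b2 = x * sin (theta alpha)).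
  { apply Rmult_eq_reg_l with (exp (2 * t)); [|pose proof (exp_pos (2 * t)); lra].
    fold B. rewrite <- E2, He2. unfold b1, b2. field. lra. }
  replace p with (exp t * b1) by (unfold b1; field; lra).
  pose proof (half_line_root_integral (level alpha t) b1 b2 Hb1 Hb2) as HL.
  assert (Hker : forall y, kden alpha x y
    = (y - level alpha t - b1 ^ 2 + b2 ^ 2) ^ 2 + (2 * b1 * b2) ^ 2).
  { intros y. replace (y - level alpha t - b1 ^ 2 + b2 ^ 2) with (y - x * cos (theta alpha)) by lra.
    rewrite F2. unfold kden. pose proof (sin2_cos2 (theta alpha)) as N. unfold Rsqr in N.
    replace (x ^ 2) with (x ^ 2 * (sin (theta alpha) * sin (theta alpha) + cos (theta alpha) * cos (theta alpha)))
      by (rewrite N; ring). ring. }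
  apply (line_integral_ext (fun y => exp t * (2 * b1 * b2 / PI *
     (sqrt (y - level alpha t) / ((y - level alpha t - b1 ^ 2 + b2 ^ 2) ^ 2 + (2 * b1 * b2) ^ 2))))).
  - intros y. rewrite <- Hker, F2, W_level, He2.
    rewrite sqrt_mult_alt, sqrt_square by nra. unfold ker.
    pose proof (kden_pos x y Hx). field. lra.
  - apply (line_integral_scal (fun y => 2 * b1 * b2 / PI *
     (sqrt (y - level alpha t) / ((y - level alpha t - b1 ^ 2 + b2 ^ 2) ^ 2 + (2 * b1 * b2) ^ 2)))); trivial.
    intros y. apply (cont_mult (fun _ => 2 * b1 * b2 / PI)); [apply continuous_const|].
    apply (cont_mult (fun y => sqrt (y - level alpha t))).
    + apply continuous_comp; [smooth | apply continuous_sqrt].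
    + pose proof (kden_pos x y Hx) as Hd. rewrite Hker in Hd. simpl in Hd. smooth.
      unfold Rminus in *. lra.
Qed.

Lemma S_equation (x : R) : rho alpha < x ->
  line_integral (fun y => ker alpha x y * S alpha y) (S alpha x + / (1 + alpha)).
Proof.
  intros Hx. pose proof PI_RGT_0 as HPI. pose proof (rho_pos alpha Halpha).
  assert (Hx0 : 0 < x) by lra.
  assert (H1 : line_integral (fun y => PI * (ker alpha x y * S alpha y)) (PI * S alpha x + PI / (alpha + 1))).
  { apply (Tonelli_line (fun t y => ker alpha x y * sqrt (W alpha t y))
      (fun t => csqrt_re (exp (2 * t) * (x * cos (theta alpha) - level alpha t)) (exp (2 * t) * (x * sin (theta alpha))))).
    - intros t y. apply continuity_2d_pt_mult; [|apply sqrt_W_cont_2d].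
      pose proof (kden_pos x y Hx0) as Hd. unfold ker, kden, Rdiv in *. simpl in *.
      apply continuity_2d_pt_mult; [apply continuity_2d_pt_const|].
      apply continuity_2d_pt_mult; [apply continuity_2d_pt_const|].
      apply continuity_2d_pt_inv; [cont2d | lra].
    - intros t y. apply Rmult_le_pos; [left; now apply ker_pos | apply sqrt_pos].
    - intros t. apply (continuity_2d_fst (fun t _ => csqrt_re (exp (2 * t) * (x * cos (theta alpha) - level alpha t)) (exp (2 * t) * (x * sin (theta alpha)))) t 0).
      unfold level. apply csqrt_re_cont_2d; cont2d.
    - intros y. apply (cont_mult (fun _ => PI)); [apply continuous_const|].
      apply (cont_mult (fun y => ker alpha x y)); [now apply ker_cont | now apply S_continuous].
    - intros t. now apply ker_sqrt_W.
    - intros y. replace (PI * (ker alpha x y * S alpha y)) with (ker alpha x y * (PI * S alpha y)) by ring.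
      apply (line_integral_scal (fun t => sqrt (W alpha t y))); [intros; apply sqrt_W_cont | now apply S_line_integral].
    (* At the angle [phi1] the double angle is theta and the multiple 2 alpha + 2 gives 2 pi, so the
       rotated W is the complex number obtained from the Poisson formula. *)
    - apply (line_integral_ext _ _ _) with (2 := p_line_integral alpha x Halpha Hx).
      intros t. rewrite <- (W_level alpha t (x * cos (theta alpha))). unfold W.
      replace (2 * (PI / (alpha + 1))) with (theta alpha) by (unfold theta; field; lra).
      replace ((2 * alpha + 2) * (PI / (alpha + 1))) with (2 * PI) by (field; lra).
      rewrite cos_2PI, sin_2PI. f_equal; ring. }
  apply (line_integral_scal _ _ (/ PI)) in H1.
  - replace (S alpha x + / (1 + alpha)) with (/ PI * (PI * S alpha x + PI / (alpha + 1))) by (field; lra).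
    apply (line_integral_ext _ _ _) with (2 := H1). intros y. field. lra.
  - intros y. apply (cont_mult (fun _ => PI)); [apply continuous_const|].
    apply (cont_mult (fun y => ker alpha x y)); [now apply ker_cont | now apply S_continuous].
Qed.

End Alpha.

(** * Kernel estimates *)

Lemma line_integral_minus (f g : R -> R) (I J : R) :
  (forall x : R, continuous f x) -> (forall x : R, continuous g x) ->
  line_integral f I -> line_integral g J -> line_integral (fun t => f t - g t) (I - J).
Proof.
  intros Cf Cg HI HJ eps He.
  destruct (HI (eps / 2)) as [M HM]; [lra|]. destruct (HJ (eps / 2)) as [N HN]; [lra|].
  exists (Rmax M N). intros a b Ha Hb. pose proof (Rmax_l M N). pose proof (Rmax_r M N).
  specialize (HM a b ltac:(lra) ltac:(lra)). specialize (HN a b ltac:(lra) ltac:(lra)).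
  rewrite RInt_Rminus by now apply ex_RInt_cont.
  apply Rabs_def2 in HM. apply Rabs_def2 in HN. apply Rabs_def1; lra.
Qed.

Lemma line_integral_le (f g : R -> R) (I J : R) :
  (forall x : R, continuous f x) -> (forall x : R, continuous g x) -> (forall x, f x <= g x) ->
  line_integral f I -> line_integral g J -> I <= J.
Proof.
  intros Cf Cg Hle HI HJ. apply le_epsilon. intros eps He.
  destruct (HI (eps / 2)) as [M HM]; [lra|]. destruct (HJ (eps / 2)) as [N HN]; [lra|].
  set (L := Rmax (Rmax M N) 0).
  assert (0 <= L) by apply Rmax_r. assert (HL : Rmax M N <= L) by apply Rmax_l.
  pose proof (Rmax_l M N). pose proof (Rmax_r M N).
  specialize (HM (- L) L ltac:(lra) ltac:(lra)). specialize (HN (- L) L ltac:(lra) ltac:(lra)).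
  assert (RInt f (- L) L <= RInt g (- L) L) by (apply RInt_cont_le; auto; lra).
  apply Rabs_def2 in HM. apply Rabs_def2 in HN. lra.
Qed.

Lemma line_integral_abs_le (f g : R -> R) (I J : R) :
  (forall x : R, continuous f x) -> (forall x : R, continuous g x) -> (forall x, Rabs (f x) <= g x) ->
  line_integral f I -> line_integral g J -> Rabs I <= J.
Proof.
  intros Cf Cg Hle HI HJ. apply Rabs_le. split.
  - assert (-1 * J <= I); [|lra].
    apply (line_integral_le (fun t => -1 * g t) f); trivial.
    + intros t. apply (cont_scal (-1)), Cg.
    + intros t. specialize (Hle t). apply Rabs_le_between in Hle. lra.
    + now apply line_integral_scal.
  - apply (line_integral_le f g); trivial.
    intros t. specialize (Hle t). apply Rabs_le_between in Hle. lra.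
Qed.

(** [f + g] lies between 0 and [2 * g], so it falls under [line_integral_bounded]; then subtract
    [g]. *)
Lemma line_integral_dominated (f g : R -> R) (J : R) :
  (forall x : R, continuous f x) -> (forall x : R, continuous g x) -> (forall x, Rabs (f x) <= g x) ->
  line_integral g J -> exists I, line_integral f I.
Proof.
  intros Cf Cg Hle HJ.
  assert (Hle' : forall t, - g t <= f t <= g t) by (intros t; apply Rabs_le_between, Hle).
  assert (Cs : forall x : R, continuous (fun t => f t + g t) x).
  { intros. now apply (cont_plus). }
  assert (G0 : forall t, 0 <= g t) by (intros t; specialize (Hle' t); lra).
  destruct (line_integral_bounded (fun t => f t + g t) (2 * J)) as [I HI]; trivial.
  - intros t. specialize (Hle' t). lra.
  - intros a b Hab. apply Rle_trans with (RInt (fun t => 2 * g t) a b).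
    + apply RInt_cont_le; trivial.
      * intros t. apply (cont_scal 2), Cg.
      * intros t _. specialize (Hle' t). lra.
    + rewrite RInt_Rmult by now apply ex_RInt_cont.
      apply Rmult_le_compat_l; [lra|]. now apply line_integral_RInt_le.
  - exists (I - J). apply (line_integral_ext (fun t => f t + g t - g t)); [intros; ring|].
    now apply (line_integral_minus (fun t => f t + g t)).
Qed.

Definition ker_x (alpha x y : R) : R := sin (theta alpha) / PI * ((y ^ 2 - x ^ 2) / kden alpha x y ^ 2).

Section Alpha.
Variable alpha : R.
Hypothesis Halpha : 1 < alpha.
Let m := kgap alpha.

Lemma shifted_square (x y h : R) : 0 < x -> Rabs h <= x / 2 ->
  (x ^ 2 + y ^ 2) / 4 <= (x + h) ^ 2 + y ^ 2 <= 9 / 4 * (x ^ 2 + y ^ 2).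
Proof.
  intros Hx Hh. apply Rabs_le_between in Hh. pose proof (pow2_ge_0 y). split; nra.
Qed.

Lemma den_increment (x y h : R) : 0 < x -> Rabs h <= x / 2 ->
  kden alpha (x + h) y - kden alpha x y = h * (2 * x - 2 * y * cos (theta alpha) + h) /\
  Rabs (2 * x - 2 * y * cos (theta alpha) + h) * x <= 7 / 2 * (x ^ 2 + y ^ 2).
Proof.
  intros Hx Hh. split; [unfold kden; ring|].
  assert (Rabs (2 * x - 2 * y * cos (theta alpha) + h) <= 5 / 2 * x + 2 * Rabs y).
  { assert (Hc : Rabs (y * cos (theta alpha)) <= Rabs y).
    { rewrite Rabs_mult. rewrite <- (Rmult_1_r (Rabs y)) at 2.
      apply Rmult_le_compat_l; [apply Rabs_pos|]. pose proof (COS_bound (theta alpha)). apply Rabs_le; lra. }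
    apply Rabs_le_between in Hc. apply Rabs_le_between in Hh. apply Rabs_le. lra. }
  apply Rle_trans with ((5 / 2 * x + 2 * Rabs y) * x); [apply Rmult_le_compat_r; lra|].
  rewrite <- (pow2_abs y). pose proof (pow2_ge_0 (x - Rabs y)). nra.
Qed.

(** This bound, [ker_taylor] and [ker_x_lipschitz] are all stated with a multiple of [ker alpha x y]
    itself. Integrated against S they become multiples of [T alpha x], and convergence comes for
    free. *)
Lemma ker_x_bound (x y : R) : 0 < x -> Rabs (ker_x alpha x y) <= / (m * x) * ker alpha x y.
Proof.
  intros Hx. pose proof (kgap_pos alpha Halpha) as Hm. fold m in Hm.
  pose proof (kden_bounds alpha x y) as Hd. fold m in Hd. pose proof (kden_pos alpha Halpha x y Hx) as HD.
  unfold ker_x, ker. set (D := kden alpha x y) in *.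
  assert (Hk : 0 < sin (theta alpha) / PI).
  { apply Rdiv_lt_0_compat; [now apply sin_theta_pos | apply PI_RGT_0]. }
  rewrite Rabs_mult, (Rabs_pos_eq (sin (theta alpha) / PI)) by lra.
  replace (/ (m * x) * (sin (theta alpha) / PI * (x / D)))
    with (sin (theta alpha) / PI * (/ (m * D))) by (pose proof PI_RGT_0; field; repeat split; lra).
  apply Rmult_le_compat_l; [lra|].
  unfold Rdiv. rewrite Rabs_mult, (Rabs_pos_eq (/ D ^ 2)) by (left; apply Rinv_0_lt_compat, pow2_gt_0; lra).
  apply Rmult_le_reg_r with (m * D ^ 2); [apply Rmult_lt_0_compat; [|apply pow2_gt_0]; lra|].
  replace (Rabs (y ^ 2 - x ^ 2) * / D ^ 2 * (m * D ^ 2)) with (m * Rabs (y ^ 2 - x ^ 2)) by (field; lra).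
  replace (/ (m * D) * (m * D ^ 2)) with D by (field; lra).
  apply Rle_trans with (2 := proj1 Hd). apply Rmult_le_compat_l; [lra|].
  pose proof (pow2_ge_0 x). pose proof (pow2_ge_0 y). apply Rabs_le. lra.
Qed.

Lemma ker_taylor (x y h : R) : 0 < x -> Rabs h <= x / 2 ->
  Rabs (ker alpha (x + h) y - ker alpha x y - h * ker_x alpha x y)
    <= 22 / m ^ 2 * (h / x) ^ 2 * ker alpha x y.
Proof.
  intros Hx Hh. pose proof (kgap_pos alpha Halpha) as Hm. fold m in Hm.
  assert (Hxh : 0 < x + h) by (apply Rabs_le_between in Hh; lra).
  pose proof (kden_bounds alpha x y) as Hd. pose proof (kden_pos alpha Halpha x y Hx) as HD.
  pose proof (kden_bounds alpha (x + h) y) as Hd'. pose proof (kden_pos alpha Halpha (x + h) y Hxh) as HD'.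
  fold m in Hd, Hd'.
  destruct (den_increment x y h Hx Hh) as [Hinc Hinc2].
  pose proof (shifted_square x y h Hx Hh) as Hsq.
  pose proof PI_RGT_0 as HPI. pose proof (sin_theta_pos alpha Halpha) as Hs.
  assert (Hk : 0 < sin (theta alpha) / PI) by now apply Rdiv_lt_0_compat.
  unfold ker, ker_x. set (D := kden alpha x y) in *. set (D' := kden alpha (x + h) y) in *.
  set (k := sin (theta alpha) / PI) in *.
  set (L := 2 * x - 2 * y * cos (theta alpha) + h) in *. set (N := x ^ 2 + y ^ 2) in *.
  assert (HDN : D = y ^ 2 - x ^ 2 + x * (2 * x - 2 * y * cos (theta alpha))) by (unfold D, kden; ring).
  set (num := - (y ^ 2 - x ^ 2) * L - x * D).
  assert (E : k * ((x + h) / D') - k * (x / D) - h * (k * ((y ^ 2 - x ^ 2) / D ^ 2))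
              = k * (h ^ 2 * num / (D ^ 2 * D'))).
  { assert (Hq : D' = D + h * L) by lra.
    replace (k * (h ^ 2 * num / (D ^ 2 * D'))) with (k * (h * ((y ^ 2 - x ^ 2) * (D - D') - x * h * D)) / (D ^ 2 * D')).
    - assert (Hxx : (x + h) * D - x * D' = h * (y ^ 2 - x ^ 2 - x * h)).
      { rewrite Hq. unfold L. rewrite HDN. ring. }
      replace (k * ((x + h) / D') - k * (x / D) - h * (k * ((y ^ 2 - x ^ 2) / D ^ 2)))
        with (k * (((x + h) * D - x * D') * D - h * (y ^ 2 - x ^ 2) * D') / (D ^ 2 * D')) by (field; lra).
      rewrite Hxx. f_equal. ring.
    - unfold num. replace (D - D') with (- h * L) by lra. field. lra. }
  rewrite E, Rabs_mult, (Rabs_pos_eq k) by lra.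
  replace (22 / m ^ 2 * (h / x) ^ 2 * (k * (x / D))) with (k * (22 / m ^ 2 * h ^ 2 / (x * D))) by (field; lra).
  apply Rmult_le_compat_l; [lra|].
  assert (HN : 0 < N) by (unfold N; pose proof (pow2_ge_0 y); assert (0 < x ^ 2) by (apply pow2_gt_0; lra); lra).
  assert (HQ : 0 < D ^ 2 * D') by (apply Rmult_lt_0_compat; [apply pow2_gt_0|]; lra).
  unfold Rdiv at 1. rewrite Rabs_mult, (Rabs_pos_eq (/ (D ^ 2 * D'))) by (left; now apply Rinv_0_lt_compat).
  rewrite Rabs_mult, (Rabs_pos_eq (h ^ 2)) by apply pow2_ge_0.
  apply Rmult_le_reg_r with (D ^ 2 * D' * x); [now apply Rmult_lt_0_compat|].
  replace (h ^ 2 * Rabs num * / (D ^ 2 * D') * (D ^ 2 * D' * x)) with (h ^ 2 * (Rabs num * x)) by (field; lra).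
  replace (22 / m ^ 2 * h ^ 2 / (x * D) * (D ^ 2 * D' * x)) with (h ^ 2 * (22 / m ^ 2 * (D * D'))) by (field; lra).
  apply Rmult_le_compat_l; [apply pow2_ge_0|].
  (* The two terms of [num] give 7/2 + 2 = 11/2. With D >= m N and D' >= m N / 4 the constant
     becomes 4 times 11/2, that is 22. *)
  apply Rle_trans with (11 / 2 * N ^ 2).
  - unfold num. apply Rle_trans with (Rabs (y ^ 2 - x ^ 2) * (Rabs L * x) + x * x * D).
    + pose proof (Rabs_triang (- (y ^ 2 - x ^ 2) * L) (- (x * D))) as Ht.
      rewrite Rabs_Ropp, (Rabs_pos_eq (x * D)), Rabs_mult, Rabs_Ropp in Ht by nra.
      unfold Rminus in *. nra.
    + assert (Rabs (y ^ 2 - x ^ 2) <= N).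
      { unfold N. pose proof (pow2_ge_0 x). pose proof (pow2_ge_0 y). apply Rabs_le. lra. }
      assert (Rabs (y ^ 2 - x ^ 2) * (Rabs L * x) <= N * (7 / 2 * N)).
      { apply Rmult_le_compat; trivial; [apply Rabs_pos|]. apply Rmult_le_pos; [apply Rabs_pos | lra]. }
      assert (x * x * D <= N * (2 * N)).
      { apply Rmult_le_compat; try lra; [nra|]. unfold N. pose proof (pow2_ge_0 y). nra. }
      nra.
  - apply Rle_trans with (22 / m ^ 2 * (m * N * (m * (N / 4)))).
    + right. field. lra.
    + apply Rmult_le_compat_l; [apply Rlt_le, Rdiv_lt_0_compat; nra|].
      apply Rmult_le_compat; try lra; try nra.
Qed.

Lemma ker_x_lipschitz (x y h : R) : 0 < x -> Rabs h <= x / 2 ->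
  Rabs (ker_x alpha (x + h) y - ker_x alpha x y) <= 528 / m ^ 3 * (Rabs h / x ^ 2) * ker alpha x y.
Proof.
  intros Hx Hh. pose proof (kgap_pos alpha Halpha) as Hm. fold m in Hm.
  assert (Hxh : 0 < x + h) by (apply Rabs_le_between in Hh; lra).
  pose proof (kden_bounds alpha x y) as Hd. pose proof (kden_pos alpha Halpha x y Hx) as HD.
  pose proof (kden_bounds alpha (x + h) y) as Hd'. pose proof (kden_pos alpha Halpha (x + h) y Hxh) as HD'.
  fold m in Hd, Hd'.
  destruct (den_increment x y h Hx Hh) as [Hinc Hinc2].
  pose proof (shifted_square x y h Hx Hh) as Hsq.
  pose proof PI_RGT_0 as HPI. pose proof (sin_theta_pos alpha Halpha) as Hs.
  assert (Hk : 0 < sin (theta alpha) / PI) by now apply Rdiv_lt_0_compat.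
  unfold ker, ker_x. set (D := kden alpha x y) in *. set (D' := kden alpha (x + h) y) in *.
  set (k := sin (theta alpha) / PI) in *.
  set (L := 2 * x - 2 * y * cos (theta alpha) + h) in *. set (N := x ^ 2 + y ^ 2) in *.
  set (num := - (y ^ 2 - x ^ 2) * L * (D + D') - (2 * x + h) * D ^ 2).
  assert (E : k * ((y ^ 2 - (x + h) ^ 2) / D' ^ 2) - k * ((y ^ 2 - x ^ 2) / D ^ 2)
              = k * (h * num / (D ^ 2 * D' ^ 2))).
  { assert (Hq : D' - D = h * L) by lra.
    replace (k * (h * num / (D ^ 2 * D' ^ 2)))
      with (k * (- (y ^ 2 - x ^ 2) * (D' - D) * (D + D') - h * (2 * x + h) * D ^ 2) / (D ^ 2 * D' ^ 2)).
    - field. lra.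
    - unfold num. rewrite Hq. field. lra. }
  rewrite E, Rabs_mult, (Rabs_pos_eq k) by lra.
  replace (528 / m ^ 3 * (Rabs h / x ^ 2) * (k * (x / D))) with (k * (528 / m ^ 3 * Rabs h / (x * D))) by (field; lra).
  apply Rmult_le_compat_l; [lra|].
  assert (HN : 0 < N) by (unfold N; pose proof (pow2_ge_0 y); assert (0 < x ^ 2) by (apply pow2_gt_0; lra); lra).
  assert (HQ : 0 < D ^ 2 * D' ^ 2) by (apply Rmult_lt_0_compat; apply pow2_gt_0; lra).
  unfold Rdiv at 1. rewrite Rabs_mult, (Rabs_pos_eq (/ (D ^ 2 * D' ^ 2))) by (left; now apply Rinv_0_lt_compat).
  rewrite Rabs_mult.
  apply Rmult_le_reg_r with (D ^ 2 * D' ^ 2 * x); [now apply Rmult_lt_0_compat|].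
  replace (Rabs h * Rabs num * / (D ^ 2 * D' ^ 2) * (D ^ 2 * D' ^ 2 * x)) with (Rabs h * (Rabs num * x)) by (field; lra).
  replace (528 / m ^ 3 * Rabs h / (x * D) * (D ^ 2 * D' ^ 2 * x)) with (Rabs h * (528 / m ^ 3 * (D * (D' * D')))) by (field; lra).
  apply Rmult_le_compat_l; [apply Rabs_pos|].
  assert (HD'2 : D' <= 9 / 2 * N) by lra.
  (* The terms are at most 7/2 * 13/2 and 5/2 * 4 times N^3, in sum below 33. The denominator D D'^2
     is at least m^3 N^3 / 16, and 16 * 33 = 528. *)
  apply Rle_trans with (33 * (N * (N * N))).
  - unfold num. apply Rle_trans with (Rabs (y ^ 2 - x ^ 2) * (Rabs L * x) * (D + D') + (2 * x + h) * x * (D * D)).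
    + assert (H2 : 0 <= 2 * x + h) by lra.
      pose proof (Rabs_triang (- (y ^ 2 - x ^ 2) * L * (D + D')) (- ((2 * x + h) * D ^ 2))) as Ht.
      assert (HD2 : 0 <= (2 * x + h) * D ^ 2) by (apply Rmult_le_pos; trivial; apply pow2_ge_0).
      rewrite Rabs_Ropp, (Rabs_pos_eq ((2 * x + h) * D ^ 2)), !Rabs_mult, Rabs_Ropp, (Rabs_pos_eq (D + D')) in Ht by lra.
      apply Rle_trans with ((Rabs (y ^ 2 - x ^ 2) * Rabs L * (D + D') + (2 * x + h) * D ^ 2) * x).
      * apply Rmult_le_compat_r; [lra|]. exact Ht.
      * right. ring.
    + assert (Rabs (y ^ 2 - x ^ 2) <= N).
      { unfold N. pose proof (pow2_ge_0 x). pose proof (pow2_ge_0 y). apply Rabs_le. lra. }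
      assert (Rabs (y ^ 2 - x ^ 2) * (Rabs L * x) * (D + D') <= N * (7 / 2 * N) * (13 / 2 * N)).
      { assert (HLx : 0 <= Rabs L * x) by (apply Rmult_le_pos; [apply Rabs_pos | lra]).
        apply Rmult_le_compat; [apply Rmult_le_pos; [apply Rabs_pos | trivial] | lra | | lra].
        apply Rmult_le_compat; trivial. apply Rabs_pos. }
      assert ((2 * x + h) * x * (D * D) <= 5 / 2 * N * (2 * N * (2 * N))).
      { apply Rabs_le_between in Hh. apply Rmult_le_compat; try nra.
        unfold N. pose proof (pow2_ge_0 y). nra. }
      assert (0 < N * (N * N)) by (repeat apply Rmult_lt_0_compat; lra). lra.
  - apply Rle_trans with (528 / m ^ 3 * (m * N * (m * (N / 4) * (m * (N / 4))))).
    + right. field. lra.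
    + assert (HD'3 : m * (N / 4) <= D').
      { apply Rle_trans with (2 := proj1 Hd'). apply Rmult_le_compat_l; lra. }
      assert (0 < m * (N / 4)) by (apply Rmult_lt_0_compat; lra).
      apply Rmult_le_compat_l; [apply Rlt_le, Rdiv_lt_0_compat; [lra | apply pow_lt; lra]|].
      apply Rmult_le_compat; [apply Rmult_le_pos; lra | apply Rmult_le_pos; lra | lra |].
      apply Rmult_le_compat; lra.
Qed.

(** For fixed x both kernels are comparable to 1 / (1 + y^2). This transports convergence from one
    point above rho, where [S_equation] supplies it, to every x > 0. *)
Lemma ker_compare (x x0 : R) : 0 < x -> 0 < x0 ->
  exists C, 0 < C /\ forall y, ker alpha x y <= C * ker alpha x0 y.
Proof.
  intros Hx Hx0. pose proof (kgap_pos alpha Halpha) as Hm. fold m in Hm.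
  pose proof PI_RGT_0 as HPI. pose proof (sin_theta_pos alpha Halpha) as Hs.
  assert (Hk : 0 < sin (theta alpha) / PI) by now apply Rdiv_lt_0_compat.
  set (r := 1 + (x0 / x) ^ 2).
  assert (Hr : 1 <= r) by (unfold r; pose proof (pow2_ge_0 (x0 / x)); lra).
  assert (Hrx : x0 ^ 2 <= r * x ^ 2).
  { unfold r. replace ((1 + (x0 / x) ^ 2) * x ^ 2) with (x ^ 2 + x0 ^ 2) by (field; lra).
    pose proof (pow2_ge_0 x). lra. }
  assert (Hp0 : 0 < 2 * r / m) by (apply Rdiv_lt_0_compat; lra).
  assert (Hp1 : 0 < x / x0) by (apply Rdiv_lt_0_compat; lra).
  exists (x / x0 * (2 * r / m)). split; [now apply Rmult_lt_0_compat|].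
  intros y.
  pose proof (kden_bounds alpha x y) as Hd. pose proof (kden_pos alpha Halpha x y Hx) as HD.
  pose proof (kden_bounds alpha x0 y) as Hd'. pose proof (kden_pos alpha Halpha x0 y Hx0) as HD'.
  fold m in Hd, Hd'. unfold ker. set (D := kden alpha x y) in *. set (D' := kden alpha x0 y) in *.
  set (k := sin (theta alpha) / PI) in *.
  replace (x / x0 * (2 * r / m) * (k * (x0 / D'))) with (k * (x * (2 * r / m / D'))) by (field; lra).
  apply Rmult_le_compat_l; [lra|]. unfold Rdiv at 1. apply Rmult_le_compat_l; [lra|].
  apply Rmult_le_reg_r with (D * D'); [nra|].
  replace (/ D * (D * D')) with D' by (field; lra).
  replace (2 * r / m / D' * (D * D')) with (2 * r / m * D) by (field; lra).
  apply Rle_trans with (2 * r / m * (m * (x ^ 2 + y ^ 2))).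
  - replace (2 * r / m * (m * (x ^ 2 + y ^ 2))) with (2 * (r * x ^ 2 + r * y ^ 2)) by (field; lra).
    pose proof (pow2_ge_0 y). nra.
  - apply Rmult_le_compat_l; lra.
Qed.

End Alpha.

(** * The derivative of [S] *)

Definition line_value (f : R -> R) : R := epsilon (inhabits 0) (line_integral f).

Lemma line_value_spec (f : R -> R) : (exists I, line_integral f I) -> line_integral f (line_value f).
Proof. apply epsilon_spec. Qed.

(* [T] is smooth across [rho] and agrees with [S + 1 / (1 + alpha)] on [rho, +oo), so it carries the
   one-sided derivative of [S] at [rho]; [T1] is its derivative. *)
Definition T (alpha x : R) : R := line_value (fun y => ker alpha x y * S alpha y).
Definition T1 (alpha x : R) : R := line_value (fun y => ker_x alpha x y * S alpha y).

Section Alpha.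
Variable alpha : R.
Hypothesis Halpha : 1 < alpha.
Let m := kgap alpha.

Lemma kerS_cont (x y : R) : 0 < x -> continuous (fun y => ker alpha x y * S alpha y) y.
Proof.
  intros Hx. apply (cont_mult (fun y => ker alpha x y));
    [now apply ker_cont | now apply S_continuous].
Qed.

Lemma ker_x_cont (x y : R) : 0 < x -> continuous (fun y => ker_x alpha x y) y.
Proof.
  intros Hx. pose proof (kden_pos alpha Halpha x y Hx) as H. unfold ker_x, kden in *. simpl in *. smooth.
  unfold Rminus in *. nra.
Qed.

Lemma ker_xS_cont (x y : R) : 0 < x -> continuous (fun y => ker_x alpha x y * S alpha y) y.
Proof.
  intros Hx. apply (cont_mult (fun y => ker_x alpha x y));
    [now apply ker_x_cont | now apply S_continuous].
Qed.

Lemma kerS_ge_0 (x y : R) : 0 < x -> 0 <= ker alpha x y * S alpha y.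
Proof. intros Hx. apply Rmult_le_pos; [left; now apply ker_pos | now apply S_ge_0]. Qed.

Lemma T_spec (x : R) : 0 < x -> line_integral (fun y => ker alpha x y * S alpha y) (T alpha x).
Proof.
  intros Hx. apply line_value_spec. pose proof (rho_pos alpha Halpha) as Hr.
  (* Any reference point above rho would do, [S_equation] giving convergence there. *)
  set (x0 := rho alpha + 1).
  destruct (ker_compare alpha Halpha x x0 Hx ltac:(unfold x0; lra)) as (C & HC & Hcmp).
  apply (line_integral_dominated _ (fun y => C * (ker alpha x0 y * S alpha y)) (C * (S alpha x0 + / (1 + alpha)))).
  - intros; now apply kerS_cont.
  - intros y. apply cont_scal, kerS_cont. unfold x0; lra.
  - intros y. rewrite Rabs_pos_eq by now apply kerS_ge_0.
    rewrite <- Rmult_assoc. apply Rmult_le_compat_r; [now apply S_ge_0 | apply Hcmp].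
  - apply (line_integral_scal (fun y => ker alpha x0 y * S alpha y)).
    + intros y. apply kerS_cont. unfold x0; lra.
    + apply S_equation; trivial. unfold x0; lra.
Qed.

Lemma ker_xS_abs (x y : R) : 0 < x ->
  Rabs (ker_x alpha x y * S alpha y) <= / (m * x) * (ker alpha x y * S alpha y).
Proof.
  intros Hx. pose proof (S_ge_0 alpha Halpha y). rewrite Rabs_mult, (Rabs_pos_eq (S alpha y)) by trivial.
  rewrite <- Rmult_assoc. apply Rmult_le_compat_r; trivial. now apply ker_x_bound.
Qed.

Lemma T1_spec (x : R) : 0 < x -> line_integral (fun y => ker_x alpha x y * S alpha y) (T1 alpha x).
Proof.
  intros Hx. apply line_value_spec.
  apply (line_integral_dominated _ (fun y => / (m * x) * (ker alpha x y * S alpha y)) (/ (m * x) * T alpha x)).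
  - intros; now apply ker_xS_cont.
  - intros y. now apply cont_scal, kerS_cont.
  - intros y. now apply ker_xS_abs.
  - apply (line_integral_scal (fun y => ker alpha x y * S alpha y)).
    + intros y. now apply kerS_cont.
    + now apply T_spec.
Qed.

Lemma T_ge_0 (x : R) : 0 < x -> 0 <= T alpha x.
Proof.
  intros Hx. apply Rle_trans with (RInt (fun y => ker alpha x y * S alpha y) 0 1).
  - apply RInt_cont_ge_0; [lra | |]; intros; [now apply kerS_cont | now apply kerS_ge_0].
  - apply line_integral_RInt_le; [| |now apply T_spec|lra]; intros; [now apply kerS_cont | now apply kerS_ge_0].
Qed.

Lemma T_above (x : R) : rho alpha < x -> T alpha x = S alpha x + / (1 + alpha).
Proof.
  intros Hx. pose proof (rho_pos alpha Halpha).
  apply (line_integral_unique (fun y => ker alpha x y * S alpha y)); [apply T_spec; lra | now apply S_equation].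
Qed.

Lemma T_taylor (x h : R) : 0 < x -> Rabs h <= x / 2 ->
  Rabs (T alpha (x + h) - T alpha x - h * T1 alpha x) <= 22 / m ^ 2 * (h / x) ^ 2 * T alpha x.
Proof.
  intros Hx Hh. assert (Hxh : 0 < x + h) by (apply Rabs_le_between in Hh; lra).
  apply (line_integral_abs_le
    (fun y => ker alpha (x + h) y * S alpha y - ker alpha x y * S alpha y - h * (ker_x alpha x y * S alpha y))
    (fun y => 22 / m ^ 2 * (h / x) ^ 2 * (ker alpha x y * S alpha y))).
  - intros y. apply cont_minus; [apply cont_minus; now apply kerS_cont | now apply cont_scal, ker_xS_cont].
  - intros y. now apply cont_scal, kerS_cont.
  - intros y. pose proof (S_ge_0 alpha Halpha y).
    replace (ker alpha (x + h) y * S alpha y - ker alpha x y * S alpha y - h * (ker_x alpha x y * S alpha y))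
      with ((ker alpha (x + h) y - ker alpha x y - h * ker_x alpha x y) * S alpha y) by ring.
    rewrite Rabs_mult, (Rabs_pos_eq (S alpha y)) by trivial.
    rewrite <- (Rmult_assoc (22 / m ^ 2 * (h / x) ^ 2)). apply Rmult_le_compat_r; trivial. now apply ker_taylor.
  - apply line_integral_minus.
    + intros y. apply cont_minus; now apply kerS_cont.
    + intros y. now apply cont_scal, ker_xS_cont.
    + apply line_integral_minus; try (intros y; now apply kerS_cont); now apply T_spec.
    + apply (line_integral_scal (fun y => ker_x alpha x y * S alpha y)); [intros y; now apply ker_xS_cont | now apply T1_spec].
  - apply (line_integral_scal (fun y => ker alpha x y * S alpha y)); [intros y; now apply kerS_cont | now apply T_spec].
Qed.

Lemma T1_lipschitz (x h : R) : 0 < x -> Rabs h <= x / 2 ->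
  Rabs (T1 alpha (x + h) - T1 alpha x) <= 528 / m ^ 3 * (Rabs h / x ^ 2) * T alpha x.
Proof.
  intros Hx Hh. assert (Hxh : 0 < x + h) by (apply Rabs_le_between in Hh; lra).
  apply (line_integral_abs_le
    (fun y => ker_x alpha (x + h) y * S alpha y - ker_x alpha x y * S alpha y)
    (fun y => 528 / m ^ 3 * (Rabs h / x ^ 2) * (ker alpha x y * S alpha y))).
  - intros y. apply cont_minus; now apply ker_xS_cont.
  - intros y. now apply cont_scal, kerS_cont.
  - intros y. pose proof (S_ge_0 alpha Halpha y).
    replace (ker_x alpha (x + h) y * S alpha y - ker_x alpha x y * S alpha y)
      with ((ker_x alpha (x + h) y - ker_x alpha x y) * S alpha y) by ring.
    rewrite Rabs_mult, (Rabs_pos_eq (S alpha y)) by trivial.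
    rewrite <- (Rmult_assoc (528 / m ^ 3 * (Rabs h / x ^ 2))). apply Rmult_le_compat_r; trivial. now apply ker_x_lipschitz.
  - apply line_integral_minus; try (intros y; now apply ker_xS_cont); now apply T1_spec.
  - apply (line_integral_scal (fun y => ker alpha x y * S alpha y)); [intros y; now apply kerS_cont | now apply T_spec].
Qed.

Lemma T_derive (x : R) : 0 < x -> is_derive (T alpha) x (T1 alpha x).
Proof.
  intros Hx. apply is_derive_Reals. intros eps He.
  pose proof (kgap_pos alpha Halpha) as Hm. fold m in Hm. pose proof (T_ge_0 x Hx) as HT.
  set (c := 22 / m ^ 2 * (/ x) ^ 2 * T alpha x).
  assert (Hc : 0 <= c).
  { unfold c. apply Rmult_le_pos; trivial. apply Rmult_le_pos; [|apply pow2_ge_0].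
    apply Rlt_le, Rdiv_lt_0_compat; [lra | apply pow_lt; lra]. }
  assert (Hd : 0 < Rmin (x / 2) (eps / (c + 1))).
  { apply Rmin_glb_lt; [lra | apply Rdiv_lt_0_compat; lra]. }
  exists (mkposreal _ Hd). simpl. intros h Hh0 Hh.
  pose proof (Rmin_l (x / 2) (eps / (c + 1))). pose proof (Rmin_r (x / 2) (eps / (c + 1))).
  pose proof (T_taylor x h Hx ltac:(lra)) as Ht.
  assert (Hha : 0 < Rabs h) by now apply Rabs_pos_lt.
  replace ((T alpha (x + h) - T alpha x) / h - T1 alpha x)
    with ((T alpha (x + h) - T alpha x - h * T1 alpha x) * / h) by (field; trivial).
  rewrite Rabs_mult, Rabs_inv.
  apply Rmult_lt_reg_r with (Rabs h); trivial. rewrite Rmult_assoc, Rinv_l, Rmult_1_r by lra.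
  apply Rle_lt_trans with (1 := Ht).
  replace (22 / m ^ 2 * (h / x) ^ 2 * T alpha x) with (c * (Rabs h * Rabs h)).
  - rewrite <- Rmult_assoc. apply Rmult_lt_compat_r; trivial.
    apply Rle_lt_trans with (c * (eps / (c + 1))); [apply Rmult_le_compat_l; lra|].
    apply Rlt_le_trans with ((c + 1) * (eps / (c + 1))).
    + apply Rmult_lt_compat_r; [apply Rdiv_lt_0_compat; lra | lra].
    + right. field. lra.
  - rewrite <- Rabs_mult, Rabs_pos_eq by nra. unfold c. field. lra.
Qed.

Lemma T1_continuous (x : R) : 0 < x -> continuous (T1 alpha) x.
Proof.
  intros Hx. apply continuity_pt_filterlim. intros eps He.
  pose proof (kgap_pos alpha Halpha) as Hm. fold m in Hm. pose proof (T_ge_0 x Hx) as HT.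
  set (c := 528 / m ^ 3 * / x ^ 2 * T alpha x).
  assert (Hc : 0 <= c).
  { unfold c. apply Rmult_le_pos; trivial. apply Rlt_le, Rmult_lt_0_compat.
    - apply Rdiv_lt_0_compat; [lra | apply pow_lt; lra].
    - apply Rinv_0_lt_compat, pow_lt. lra. }
  exists (Rmin (x / 2) (eps / (c + 1))). split.
  { apply Rmin_glb_lt; [lra | apply Rdiv_lt_0_compat; lra]. }
  intros z [_ Hz]. simpl in Hz |- *. unfold R_dist in *.
  pose proof (Rmin_l (x / 2) (eps / (c + 1))). pose proof (Rmin_r (x / 2) (eps / (c + 1))).
  pose proof (T1_lipschitz x (z - x) Hx ltac:(lra)) as Ht.
  rewrite (Rplus_minus x z) in Ht.
  apply Rle_lt_trans with (1 := Ht).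
  replace (528 / m ^ 3 * (Rabs (z - x) / x ^ 2) * T alpha x) with (c * Rabs (z - x)) by (unfold c; field; lra).
  apply Rle_lt_trans with (c * (eps / (c + 1))); [apply Rmult_le_compat_l; lra|].
  apply Rlt_le_trans with ((c + 1) * (eps / (c + 1))).
  - apply Rmult_lt_compat_r; [apply Rdiv_lt_0_compat; lra | lra].
  - right. field. lra.
Qed.

Lemma eq_of_eq_right (f g : R -> R) (x : R) :
  continuous f x -> continuous g x -> (forall y, x < y -> f y = g y) -> f x = g x.
Proof.
  intros Cf Cg H. apply Rminus_diag_uniq, cond_eq. intros eps He. rewrite Rminus_0_r.
  assert (C : continuity_pt (fun t => f t - g t) x) by (apply continuity_pt_filterlim; now apply cont_minus).
  destruct (C eps He) as [d [Hd HC]]. specialize (HC (x + d / 2)). simpl in HC. unfold R_dist in HC.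
  rewrite H, Rminus_diag, Rminus_0_l, Rabs_Ropp in HC by lra. apply HC.
  split; [split; [exact Logic.I | lra]|]. replace (x + d / 2 - x) with (d / 2) by ring.
  rewrite Rabs_pos_eq; lra.
Qed.

Lemma T_continuous (x : R) : 0 < x -> continuous (T alpha) x.
Proof.
  intros Hx. apply (ex_derive_continuous (K := R_AbsRing) (V := R_NormedModule)).
  eexists. now apply T_derive.
Qed.

Lemma T_eq (x : R) : rho alpha <= x -> T alpha x = S alpha x + / (1 + alpha).
Proof.
  intros [Hx | <-]; [now apply T_above|]. pose proof (rho_pos alpha Halpha).
  apply (eq_of_eq_right (T alpha) (fun x => S alpha x + / (1 + alpha))).
  - now apply T_continuous.
  - apply (cont_plus (S alpha)); [now apply S_continuous | apply continuous_const].
  - intros y Hy. now apply T_above.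
Qed.

Lemma S_derive (x : R) : rho alpha < x -> is_derive (S alpha) x (T1 alpha x).
Proof.
  intros Hx. pose proof (rho_pos alpha Halpha).
  apply (is_derive_ext_loc (fun x => T alpha x - / (1 + alpha))).
  - apply (locally_R _ _ (x - rho alpha)); [lra|]. intros y Hy. apply Rabs_def2 in Hy.
    rewrite T_eq by lra. req. ring.
  - replace (T1 alpha x) with (minus (T1 alpha x) 0) by (unfold minus, plus, opp; simpl; ring).
    apply (is_derive_minus (V := R_NormedModule) (T alpha) (fun _ => / (1 + alpha))).
    + apply T_derive. lra.
    + apply (is_derive_const (K := R_AbsRing) (V := R_NormedModule)).
Qed.

(** Unlike [S_derive] this includes x = rho, where only the right derivative of S equals [T1]. *)
Lemma S_difference (x : R) : rho alpha <= x ->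
  exists c, 0 <= c /\ forall h, 0 < h <= x / 2 ->
    Rabs ((S alpha (x + h) - S alpha x) / h - T1 alpha x) <= c * h.
Proof.
  intros Hx. pose proof (rho_pos alpha Halpha). pose proof (kgap_pos alpha Halpha) as Hm. fold m in Hm.
  pose proof (T_ge_0 x ltac:(lra)) as HT.
  exists (22 / m ^ 2 * (/ x) ^ 2 * T alpha x). split.
  { apply Rmult_le_pos; trivial. apply Rmult_le_pos; [|apply pow2_ge_0].
    apply Rlt_le, Rdiv_lt_0_compat; [lra | apply pow_lt; lra]. }
  intros h Hh. pose proof (T_taylor x h ltac:(lra)) as Ht.
  rewrite (Rabs_pos_eq h) in Ht by lra. specialize (Ht ltac:(lra)).
  rewrite !T_eq in Ht by lra.
  replace ((S alpha (x + h) - S alpha x) / h - T1 alpha x)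
    with ((S alpha (x + h) + / (1 + alpha) - (S alpha x + / (1 + alpha)) - h * T1 alpha x) * / h) by (field; lra).
  rewrite Rabs_mult, (Rabs_pos_eq (/ h)) by (left; apply Rinv_0_lt_compat; lra).
  apply Rmult_le_reg_r with h; [lra|]. rewrite Rmult_assoc, Rinv_l, Rmult_1_r by lra.
  apply Rle_trans with (1 := Ht). rewrite T_eq by lra. right. field. lra.
Qed.

Lemma T1_ge_0 (x : R) : rho alpha <= x -> 0 <= T1 alpha x.
Proof.
  intros Hx. destruct (S_difference x Hx) as (c & Hc & HS). pose proof (rho_pos alpha Halpha).
  apply le_epsilon. intros eps He.
  set (h := Rmin (x / 2) (eps / (c + 1))).
  assert (Hh : 0 < h) by (apply Rmin_glb_lt; [lra | apply Rdiv_lt_0_compat; lra]).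
  assert (Hh1 : h <= x / 2) by apply Rmin_l. assert (Hh2 : h <= eps / (c + 1)) by apply Rmin_r.
  specialize (HS h ltac:(lra)). apply Rabs_le_between in HS.
  assert (0 <= (S alpha (x + h) - S alpha x) / h).
  { apply Rdiv_le_0_compat; trivial. pose proof (S_le alpha Halpha x (x + h) ltac:(lra)). lra. }
  assert (c * h <= eps); [|lra].
  apply Rle_trans with ((c + 1) * (eps / (c + 1))).
  - apply Rmult_le_compat; lra.
  - right. field. lra.
Qed.

(** The right difference quotient of S at rho is evaluated twice: through T by [S_difference], and
    from the parabolic minimum by [S_slope]. *)
Lemma T1_rho : T1 alpha (rho alpha) = slope alpha.
Proof.
  destruct (S_difference (rho alpha) ltac:(lra)) as (c & Hc & HS). pose proof (rho_pos alpha Halpha).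
  apply Rminus_diag_uniq, cond_eq. intros eps He. rewrite Rminus_0_r.
  destruct (S_slope alpha Halpha (eps / 2) ltac:(lra)) as (d & Hd & HS2).
  set (h := Rmin (d / 2) (Rmin (rho alpha / 2) (eps / (4 * (c + 1))))).
  assert (Hh : 0 < h) by (repeat apply Rmin_glb_lt; try lra; apply Rdiv_lt_0_compat; lra).
  assert (Hh1 : h <= d / 2) by apply Rmin_l.
  assert (Hh2 : h <= Rmin (rho alpha / 2) (eps / (4 * (c + 1)))) by apply Rmin_r.
  pose proof (Rmin_l (rho alpha / 2) (eps / (4 * (c + 1)))). pose proof (Rmin_r (rho alpha / 2) (eps / (4 * (c + 1)))).
  specialize (HS h ltac:(lra)). specialize (HS2 h ltac:(lra)).
  rewrite (S_eq_0 alpha (rho alpha)), Rminus_0_r in HS by lra.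
  assert (c * h <= eps / 4).
  { apply Rle_trans with ((c + 1) * (eps / (4 * (c + 1)))).
    - apply Rmult_le_compat; lra.
    - right. field. lra. }
  apply Rabs_le_between in HS. apply Rabs_def2 in HS2. apply Rabs_def1; lra.
Qed.

Lemma S_half_line (f : R -> R) (I : R) : (forall y : R, continuous f y) ->
  line_integral (fun y => f y * S alpha y) I ->
  tends (fun N => RInt (fun y => f y * S alpha y) (rho alpha) N) I.
Proof.
  intros Cf HI eps He. destruct (HI eps He) as [M HM]. pose proof (rho_pos alpha Halpha).
  exists (Rmax M 0). intros N HN. pose proof (Rmax_l M 0). pose proof (Rmax_r M 0).
  specialize (HM (- N) N ltac:(lra) ltac:(lra)).
  assert (C : forall y : R, continuous (fun y => f y * S alpha y) y).
  { intros y. apply (cont_mult f); [apply Cf | now apply S_continuous]. }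
  rewrite <- (RInt_cont_Chasles _ (- N) (rho alpha) N) in HM by trivial.
  rewrite (RInt_eq_0 _ (- N) (rho alpha)), Rplus_0_l in HM; trivial.
  intros y Hy. rewrite Rmax_right in Hy by lra. rewrite S_eq_0 by lra. req. ring.
Qed.

Lemma ker_decay (x y : R) : 0 < x -> 0 < y -> ker alpha x y <= x / (m * y ^ 2).
Proof.
  intros Hx Hy. pose proof (kgap_pos alpha Halpha) as Hm. fold m in Hm. pose proof PI_RGT_0.
  pose proof (kden_bounds alpha x y) as [Hd _]. fold m in Hd. pose proof (kden_pos alpha Halpha x y Hx).
  pose proof (sin_theta_pos alpha Halpha). pose proof (SIN_bound (theta alpha)). pose proof PI2_1.
  assert (Hk : 0 <= sin (theta alpha) / PI <= 1).
  { split; [apply Rdiv_le_0_compat; lra|]. apply Rmult_le_reg_r with PI; trivial.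
    unfold Rdiv. rewrite Rmult_assoc, Rinv_l by lra. lra. }
  unfold ker. rewrite <- (Rmult_1_l (x / (m * y ^ 2))).
  assert (0 < y ^ 2) by (apply pow_lt; lra). pose proof (pow2_ge_0 x).
  apply Rmult_le_compat; [lra | apply Rdiv_le_0_compat; lra | lra |].
  unfold Rdiv. apply Rmult_le_compat_l; [lra|]. apply Rinv_le_contravar; [|nra].
  apply Rmult_lt_0_compat; lra.
Qed.

Lemma tends_Rpower_neg (c : R) : 0 < c -> tends (fun x => Rpower x (- c)) 0.
Proof.
  intros Hc eps He. destruct (Rpower_large c (/ eps + 1) Hc) as (M & HM0 & HM).
  exists M. intros x Hx. specialize (HM x Hx).
  rewrite Rminus_0_r, Rpower_Ropp, Rabs_pos_eq by (left; apply Rinv_0_lt_compat, exp_pos).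
  assert (0 < / eps) by now apply Rinv_0_lt_compat.
  rewrite <- (Rinv_inv eps). apply Rinv_lt_contravar; [|lra].
  apply Rmult_lt_0_compat; trivial. apply exp_pos.
Qed.

(** The kernel decays like N^(-2) and S grows like N^gam, so the product is of order N^(gam - 1),
    and gam < 1. *)
Lemma boundary_term (x : R) : 0 < x -> tends (fun N => N * ker alpha x N * S alpha N) 0.
Proof.
  intros Hx. pose proof (kgap_pos alpha Halpha) as Hm. fold m in Hm. pose proof PI_RGT_0.
  pose proof (profile_mass_pos alpha Halpha) as HI.
  assert (Hl := tends_scal _ _ (x / m * (profile_mass alpha / PI)) (tends_Rpower_neg (1 - gam alpha) ltac:(pose proof (gam_lt_1 alpha Halpha); lra))).
  rewrite Rmult_0_r in Hl. revert Hl. apply tends_squeeze.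
  exists 1. intros N HN.
  pose proof (ker_pos alpha Halpha x N Hx). pose proof (S_ge_0 alpha Halpha N).
  rewrite Rminus_0_r, Rabs_pos_eq by (apply Rmult_le_pos; [apply Rmult_le_pos|]; lra).
  assert (HS : S alpha N <= Rpower N (gam alpha) * (profile_mass alpha / PI)).
  { apply Rmult_le_reg_l with PI; trivial. apply Rle_trans with (1 := S_upper alpha Halpha N ltac:(lra)).
    right. field. lra. }
  apply Rle_trans with (N * (x / (m * N ^ 2)) * (Rpower N (gam alpha) * (profile_mass alpha / PI))).
  - apply Rmult_le_compat; trivial; [apply Rmult_le_pos; lra|].
    apply Rmult_le_compat_l; [lra|]. apply ker_decay; lra.
  - right. replace (- (1 - gam alpha)) with (gam alpha + - (1)) by ring.
    rewrite Rpower_plus, Rpower_Ropp, Rpower_1 by lra. field. lra.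
Qed.

(* Integration by parts, using that [y ker x y] is a function of [x / y]. *)
Lemma homogeneous_equation (x : R) : 0 < x ->
  tends (fun N => RInt (fun y => ker alpha x y * (y * T1 alpha y)) (rho alpha) N) (x * T1 alpha x).
Proof.
  intros Hx. pose proof (rho_pos alpha Halpha) as Hr.
  assert (D : forall y : R, 0 < y -> is_derive (fun y => y * ker alpha x y) y (- (x * ker_x alpha x y))).
  { intros y Hy. pose proof (kden_pos alpha Halpha x y Hx) as Hd. pose proof PI_RGT_0.
    unfold ker, ker_x, kden in *. simpl in *. auto_derive; [unfold Rminus in *; repeat split; lra|]. req.
    field. unfold Rminus in *. repeat split; lra. }
  assert (E : forall N, rho alpha <= N ->
    RInt (fun y => ker alpha x y * (y * T1 alpha y)) (rho alpha) N
    = N * ker alpha x N * S alpha N + x * RInt (fun y => ker_x alpha x y * S alpha y) (rho alpha) N).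
  { intros N HN.
    (* Integration by parts asks for a two-sided derivative at the end point rho, where S has a
       corner; [SS] is the differentiable function that agrees with S to the right. The boundary
       term at rho vanishes with S. *)
    set (SS := fun y => T alpha y - / (1 + alpha)).
    assert (HSS : forall y, rho alpha <= y -> SS y = S alpha y) by (intros y Hy; unfold SS; rewrite T_eq by trivial; ring).
    assert (DSS : forall y : R, 0 < y -> is_derive SS y (T1 alpha y)).
    { intros y Hy. replace (T1 alpha y) with (minus (T1 alpha y) 0) by (unfold minus, plus, opp; simpl; ring).
      apply (is_derive_minus (V := R_NormedModule) (T alpha) (fun _ => / (1 + alpha))).
      - now apply T_derive.
      - apply (is_derive_const (K := R_AbsRing) (V := R_NormedModule)). }
    assert (Hp : is_RInt (fun y => plus (scal (- (x * ker_x alpha x y)) (SS y)) (scal (y * ker alpha x y) (T1 alpha y)))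
                   (rho alpha) N
                   (minus (scal (N * ker alpha x N) (SS N)) (scal (rho alpha * ker alpha x (rho alpha)) (SS (rho alpha))))).
    { apply (is_RInt_scal_derive (V := R_CompleteNormedModule) (fun y => y * ker alpha x y) SS);
        rewrite Rmin_left, Rmax_right by lra; intros y Hy.
      - apply D. lra.
      - apply DSS. lra.
      - apply (continuous_opp (V := R_NormedModule) (fun y => x * ker_x alpha x y)). now apply cont_scal, ker_x_cont.
      - apply T1_continuous. lra. }
    apply (is_RInt_unique (V := R_CompleteNormedModule)) in Hp.
    rewrite (HSS N), (HSS (rho alpha)), (S_eq_0 alpha (rho alpha)) in Hp by lra.
    assert (C1 : ex_RInt (fun y => ker_x alpha x y * S alpha y) (rho alpha) N).
    { apply ex_RInt_cont. intros; now apply ker_xS_cont. }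
    assert (C2 : ex_RInt (fun y => ker alpha x y * (y * T1 alpha y)) (rho alpha) N).
    { apply ex_RInt_cont_on; [lra|]. intros y Hy.
      apply (cont_mult (fun y => ker alpha x y)); [now apply ker_cont|].
      apply (cont_mult (fun y => y)); [apply continuous_id | apply T1_continuous; lra]. }
    assert (E2 : RInt (fun y => plus (scal (- (x * ker_x alpha x y)) (SS y)) (scal (y * ker alpha x y) (T1 alpha y))) (rho alpha) N
      = - x * RInt (fun y => ker_x alpha x y * S alpha y) (rho alpha) N
        + RInt (fun y => ker alpha x y * (y * T1 alpha y)) (rho alpha) N).
    { rewrite <- RInt_Rmult by trivial. rewrite <- RInt_Rplus; trivial.
      - apply RInt_ext. intros y Hy. rewrite Rmin_left, Rmax_right in Hy by lra.
        rewrite HSS by lra. unfold plus, scal; simpl. unfold mult; simpl. req. ring.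
      - apply (ex_RInt_scal (V := R_NormedModule) _ _ _ (- x)), C1. }
    rewrite E2 in Hp. unfold minus, plus, opp, scal in Hp; simpl in Hp. unfold mult in Hp; simpl in Hp. lra. }
  assert (L : tends (fun N => N * ker alpha x N * S alpha N + x * RInt (fun y => ker_x alpha x y * S alpha y) (rho alpha) N)
                (0 + x * T1 alpha x)).
  { apply tends_plus; [now apply boundary_term|]. apply tends_scal. apply S_half_line.
    - intros y. now apply ker_x_cont.
    - now apply T1_spec. }
  rewrite Rplus_0_l in L. intros eps He. destruct (L eps He) as [M HM]. exists (Rmax M (rho alpha)).
  intros N HN. pose proof (Rmax_l M (rho alpha)). pose proof (Rmax_r M (rho alpha)).
  rewrite E by lra. apply HM. lra.
Qed.

Lemma inhomogeneous_equation (x : R) : rho alpha <= x ->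
  tends (fun N => RInt (fun y => ker alpha x y * S alpha y) (rho alpha) N) (S alpha x + / (1 + alpha)).
Proof.
  intros Hx. pose proof (rho_pos alpha Halpha). apply S_half_line.
  - intros y. apply ker_cont; trivial. lra.
  - rewrite <- T_eq by trivial. apply T_spec. lra.
Qed.

(* Landau's interpolation: [S ~ C x^gam] together with the second-order bound of [T_taylor] forces
   [x S' ~ gam C x^gam]. *)
Lemma T1_asymptotic :
  tends (fun x => Rpower x (- gam alpha) * (x * T1 alpha x)) (gam alpha * (profile_mass alpha / PI)).
Proof.
  pose proof (rho_pos alpha Halpha) as Hr. pose proof (gam_pos alpha Halpha) as Hg.
  pose proof (kgap_pos alpha Halpha) as Hm. fold m in Hm.
  pose proof PI_RGT_0 as HPI. pose proof (profile_mass_pos alpha Halpha) as HI.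
  set (g := gam alpha) in *. set (C := profile_mass alpha / PI).
  assert (HC : 0 < C) by now apply Rdiv_lt_0_compat.
  intros eps He.
  set (B := 22 / m ^ 2 * (C + 1)).
  assert (HB : 0 < B).
  { unfold B. apply Rmult_lt_0_compat; [apply Rdiv_lt_0_compat; [lra | apply pow_lt; lra] | lra]. }
  assert (Hder : is_derive (fun e => Rpower (1 + e) g) 0 g).
  { unfold Rpower. auto_derive; [lra|]. req. rewrite Rplus_0_r, ln_1, Rmult_0_r, exp_0. field. }
  apply is_derive_Reals in Hder.
  destruct (Hder (eps / (4 * C)) ltac:(apply Rdiv_lt_0_compat; lra)) as [d0 Hd0].
  (* The relative step h / x. Below 1/2 [T_taylor] applies, below d0 the difference quotient of
     (1+e)^gam is close to gam, and the last bound makes the second-order error, after division by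
     e, at most eps / 2. *)
  set (e := Rmin (1 / 2) (Rmin (d0 / 2) (eps / (4 * B)))).
  assert (Hd0p : 0 < d0) by apply cond_pos.
  assert (He0 : 0 < e) by (repeat apply Rmin_glb_lt; try lra; apply Rdiv_lt_0_compat; lra).
  assert (He1 : e <= 1 / 2) by apply Rmin_l.
  assert (He2 : e <= Rmin (d0 / 2) (eps / (4 * B))) by apply Rmin_r.
  pose proof (Rmin_l (d0 / 2) (eps / (4 * B))). pose proof (Rmin_r (d0 / 2) (eps / (4 * B))).
  specialize (Hd0 e ltac:(lra)). rewrite Rabs_pos_eq in Hd0 by lra. specialize (Hd0 ltac:(lra)).
  rewrite Rplus_0_l in Hd0.
  replace (1 + 0) with 1 in Hd0 by ring.
  replace (Rpower 1 g) with 1 in Hd0 by (unfold Rpower; rewrite ln_1, Rmult_0_r, exp_0; reflexivity).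
  set (P := Rpower (1 + e) g) in *.
  assert (HP : 0 < P) by apply exp_pos.
  set (s := fun x => Rpower x (- g) * S alpha x).
  assert (Ls : tends s C) by now apply S_asymptotic.
  (* The accuracy of the asymptotics of S is fixed after the step e, since the division by e
     magnifies it. *)
  set (k := Rmin 1 (eps * e / (8 * (P + 1)))).
  assert (Hk : 0 < k).
  { apply Rmin_glb_lt; [lra|]. apply Rdiv_lt_0_compat; [nra | lra]. }
  assert (Hk2 : k <= eps * e / (8 * (P + 1))) by apply Rmin_r.
  assert (Hk1 : k <= 1) by apply Rmin_l.
  destruct (Ls k Hk) as [M1 HM1].
  destruct (tends_Rpower_neg g Hg 1 ltac:(lra)) as [M2 HM2].
  exists (Rmax (rho alpha) (Rmax M1 M2)). intros x Hx.
  pose proof (Rmax_l (rho alpha) (Rmax M1 M2)). pose proof (Rmax_r (rho alpha) (Rmax M1 M2)).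
  pose proof (Rmax_l M1 M2). pose proof (Rmax_r M1 M2).
  assert (Hx0 : 0 < x) by lra.
  pose proof (HM1 x ltac:(lra)) as S1. pose proof (HM1 (x + e * x) ltac:(nra)) as S2.
  specialize (HM2 x ltac:(lra)). rewrite Rminus_0_r, Rabs_pos_eq in HM2 by (left; apply exp_pos).
  set (X := Rpower x (- g)) in *.
  assert (HX : 0 < X) by apply exp_pos.
  pose proof (T_taylor x (e * x) Hx0) as Ht. rewrite (Rabs_pos_eq (e * x)) in Ht by nra.
  specialize (Ht ltac:(nra)). rewrite !T_eq in Ht by nra.
  replace (e * x / x) with e in Ht by (field; lra).
  assert (EX : Rpower (x + e * x) (- g) = X * / P).
  { unfold X, P. rewrite <- Rpower_Ropp, Rpower_mult_distr by lra. f_equal. ring. }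
  unfold s in S1, S2. rewrite EX in S2. fold X in S1.
  apply Rabs_def2 in S1. apply Rabs_def2 in S2.
  set (a := X * S alpha x) in *.
  set (b := X * S alpha (x + e * x)).
  assert (Sb : P * (C - k) < b < P * (C + k)).
  { replace (X * / P * S alpha (x + e * x)) with (b / P) in S2 by (unfold b; field; lra).
    assert (Hb : b = P * (b / P)) by (field; lra). rewrite Hb.
    split; apply Rmult_lt_compat_l; lra. }
  set (z := X * (x * T1 alpha x)).
  assert (Hz : Rabs (b - a - e * z) <= 22 / m ^ 2 * e ^ 2 * (a + X / (1 + alpha))).
  { apply Rmult_le_compat_l with (r := X) in Ht; [|lra].
    rewrite <- (Rabs_pos_eq X) in Ht at 1 by lra. rewrite <- Rabs_mult in Ht.
    replace (X * (S alpha (x + e * x) + / (1 + alpha) - (S alpha x + / (1 + alpha)) - e * x * T1 alpha x))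
      with (b - a - e * z) in Ht by (unfold a, b, z; ring).
    apply Rle_trans with (1 := Ht). right. unfold a. field. lra. }
  assert (HaX : a + X / (1 + alpha) <= 2 * (C + 1)).
  { assert (X / (1 + alpha) <= 1); [|lra].
    apply Rmult_le_reg_r with (1 + alpha); [lra|]. unfold Rdiv. rewrite Rmult_assoc, Rinv_l; lra. }
  assert (HeB : e * B <= eps / 4).
  { apply Rle_trans with (eps / (4 * B) * B); [apply Rmult_le_compat_r; lra|]. right. field. lra. }
  assert (Hz2 : Rabs (b - a - e * z) <= e * (eps / 2)).
  { apply Rle_trans with (1 := Hz). apply Rle_trans with (22 / m ^ 2 * e ^ 2 * (2 * (C + 1))).
    - apply Rmult_le_compat_l; trivial. apply Rmult_le_pos; [|apply pow2_ge_0].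
      apply Rlt_le, Rdiv_lt_0_compat; [lra | apply pow_lt; lra].
    - replace (22 / m ^ 2 * e ^ 2 * (2 * (C + 1))) with (e * (2 * (e * B))) by (unfold B; field; lra).
      apply Rmult_le_compat_l; lra. }
  assert (HPe : Rabs (P - 1 - g * e) <= e * (eps / (4 * C))).
  { replace (P - 1 - g * e) with (((P - 1) / e - g) * e) by (field; lra).
    rewrite Rabs_mult, (Rabs_pos_eq e), Rmult_comm by lra. apply Rmult_le_compat_l; lra. }
  assert (HkP : (P + 1) * k <= e * (eps / 8)).
  { apply Rle_trans with ((P + 1) * (eps * e / (8 * (P + 1)))); [apply Rmult_le_compat_l; lra|].
    right. field. lra. }
  assert (HPC : Rabs (C * (P - 1 - g * e)) <= e * (eps / 4)).
  { rewrite Rabs_mult, (Rabs_pos_eq C) by lra.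
    apply Rle_trans with (C * (e * (eps / (4 * C)))); [apply Rmult_le_compat_l; lra|]. right. field. lra. }
  apply Rabs_le_between in Hz2. apply Rabs_le_between in HPC.
  assert (e * Rabs (z - g * C) < e * eps).
  { rewrite <- (Rabs_pos_eq e) at 1 by lra. rewrite <- Rabs_mult.
    assert (0 < e * eps) by nra. apply Rabs_def1; nra. }
  apply Rmult_lt_reg_l with e; trivial.
Qed.

End Alpha.

(** * Uniqueness *)

Lemma is_RInt_gen_tends (f : R -> R) (a l : R) :
  (forall N, a <= N -> ex_RInt f a N) -> tends (fun N => RInt f a N) l ->
  is_RInt_gen f (at_point a) (Rbar_locally p_infty) l.
Proof.
  intros Hex Hl. apply filterlimi_locally. intros eps.
  destruct (Hl eps (cond_pos eps)) as [M HM].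
  apply (Filter_prod _ _ _ (fun a' => a' = a) (fun b => Rmax M a < b)).
  - reflexivity.
  - exists (Rmax M a). auto.
  - intros a' b -> Hb. pose proof (Rmax_l M a). pose proof (Rmax_r M a).
    exists (RInt f a b). split.
    + apply RInt_R_correct, Hex. lra.
    + apply HM. lra.
Qed.

Lemma is_RInt_gen_tends_inv (f : R -> R) (a l : R) :
  is_RInt_gen f (at_point a) (Rbar_locally p_infty) l ->
  (exists M, forall N, M <= N -> ex_RInt f a N) /\ tends (fun N => RInt f a N) l.
Proof.
  intros H.
  assert (H' : forall eps : posreal, exists M, forall N, M <= N ->
            exists z, is_RInt f a N z /\ Rabs (z - l) < eps).
  { intros eps. apply filterlimi_locally with (eps := eps) in H.
    destruct H as [Q P HQ [M HP] HPQ]. exists (M + 1). intros N HN.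
    apply (HPQ a N); [apply HQ | apply HP; lra]. }
  split.
  - destruct (H' (mkposreal 1 Rlt_0_1)) as [M HM]. exists M. intros N HN.
    destruct (HM N HN) as (z & Hz & _). now exists z.
  - intros eps He. destruct (H' (mkposreal eps He)) as [M HM]. exists M. intros N HN.
    destruct (HM N HN) as (z & Hz & Hb). rewrite (is_RInt_unique _ _ _ _ Hz). exact Hb.
Qed.

Lemma tends_le (F G : R -> R) (l k : R) :
  tends F l -> tends G k -> (exists M, forall x, M <= x -> F x <= G x) -> l <= k.
Proof.
  intros HF HG [M HM]. apply le_epsilon. intros eps He.
  destruct (HF (eps / 2)) as [A HA]; [lra|]. destruct (HG (eps / 2)) as [B HB]; [lra|].
  set (x := Rmax M (Rmax A B)).
  assert (M <= x) by apply Rmax_l. assert (Rmax A B <= x) by apply Rmax_r.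
  pose proof (Rmax_l A B). pose proof (Rmax_r A B).
  specialize (HM x ltac:(lra)). specialize (HA x ltac:(lra)). specialize (HB x ltac:(lra)).
  apply Rabs_def2 in HA. apply Rabs_def2 in HB. lra.
Qed.

Lemma tends_is_lim (F : R -> R) (l : R) : tends F l <-> is_lim F p_infty l.
Proof.
  split.
  - intros H. apply is_lim_spec. intros eps. destruct (H eps (cond_pos eps)) as [M HM].
    exists M. intros x Hx. apply HM. lra.
  - intros H eps He. apply is_lim_spec in H. destruct (H (mkposreal eps He)) as [M HM].
    exists (M + 1). intros x Hx. apply HM. lra.
Qed.

(** Integrability is claimed only on large windows, because that is all an improper integral says
    about an arbitrary candidate; smaller windows follow by Chasles. The constant is 2 p for the
    original equation and 0 for differences. *)
Definition half_line_solution (alpha om : R) (d : R -> R) (c : R) : Prop :=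
  forall x, om <= x ->
    (exists M, forall N, M <= N -> ex_RInt (fun y => ker alpha x y * d y) om N) /\
    tends (fun N => RInt (fun y => ker alpha x y * d y) om N) (d x + c).

(** * Comparison with a nonnegative homogeneous solution of exact growth x^gam *)

Section Unique.
Variables alpha om : R.
Hypothesis Halpha : 1 < alpha.
Hypothesis Hom : 0 < om.
Variable f : R -> R.
Hypothesis f_cont : forall y : R, om <= y -> continuous f y.
Hypothesis f_ge_0 : forall y, om <= y -> 0 <= f y.
Hypothesis f_sol : half_line_solution alpha om f 0.
Variable c : R.
Hypothesis Hc : 0 < c.
Hypothesis f_lim : tends (fun y => Rpower y (- gam alpha) * f y) c.

Lemma kerf_ex (x a b : R) : 0 < x -> om <= a <= b -> ex_RInt (fun y => ker alpha x y * f y) a b.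
Proof.
  intros Hx Hab. apply ex_RInt_cont_on; [lra|]. intros y Hy.
  apply (cont_mult (fun y => ker alpha x y)); [now apply ker_cont | apply f_cont; lra].
Qed.

Lemma f_eventually_large : exists N0, om <= N0 /\ forall y, N0 <= y -> c / 2 * Rpower y (gam alpha) <= f y.
Proof.
  destruct (f_lim (c / 2)) as [M HM]; [lra|]. exists (Rmax M om). split; [apply Rmax_r|].
  intros y Hy. pose proof (Rmax_l M om). pose proof (Rmax_r M om). specialize (HM y ltac:(lra)).
  apply Rabs_def2 in HM. rewrite Rpower_Ropp in HM.
  assert (HP : 0 < Rpower y (gam alpha)) by apply exp_pos.
  set (P := Rpower y (gam alpha)) in *.
  replace (f y) with (/ P * f y * P) by (field; lra). apply Rmult_le_compat_r; lra.
Qed.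

(** On the unit interval after N, [f] is bounded below by its growth and the kernel by a constant
    that serves every x in [om, N]. This uniform mass drives the strict improvement of the
    supremum. *)
Lemma f_tail_lower : exists N0, om <= N0 /\ forall N, N0 <= N -> exists k, 0 < k /\
  forall x N', om <= x <= N -> N + 1 <= N' -> k <= RInt (fun y => ker alpha x y * f y) N N'.
Proof.
  destruct f_eventually_large as (N0 & HN0 & Hf). exists N0. split; trivial.
  intros N HN.
  pose proof PI_RGT_0 as HPI. pose proof (sin_theta_pos alpha Halpha) as Hs.
  set (k0 := sin (theta alpha) / PI * (om / (2 * (N ^ 2 + (N + 1) ^ 2)))).
  assert (HD : 0 < 2 * (N ^ 2 + (N + 1) ^ 2)) by nra.
  assert (Hk0 : 0 < k0) by (unfold k0; repeat apply Rmult_lt_0_compat; try apply Rdiv_lt_0_compat; try apply Rinv_0_lt_compat; lra).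
  set (p0 := c / 2 * Rpower N (gam alpha)).
  assert (Hp0 : 0 < p0) by (unfold p0; apply Rmult_lt_0_compat; [lra | apply exp_pos]).
  exists (k0 * p0). split; [now apply Rmult_lt_0_compat|].
  intros x N' Hx HN'.
  assert (Hx0 : 0 < x) by lra.
  rewrite <- (RInt_Chasles (V := R_CompleteNormedModule) _ N (N + 1) N') by (apply kerf_ex; lra).
  assert (0 <= RInt (fun y => ker alpha x y * f y) (N + 1) N').
  { apply RInt_ge_0; [lra | apply kerf_ex; lra|]. intros y Hy.
    apply Rmult_le_pos; [left; now apply ker_pos | apply f_ge_0; lra]. }
  assert (k0 * p0 <= RInt (fun y => ker alpha x y * f y) N (N + 1)).
  { replace (k0 * p0) with ((N + 1 - N) * (k0 * p0)) by ring. rewrite <- RInt_Rconst.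
    apply RInt_le; [lra | apply ex_RInt_const | apply kerf_ex; lra|].
    intros y Hy. apply Rmult_le_compat; try lra.
    - unfold k0, ker. apply Rmult_le_compat_l; [left; now apply Rdiv_lt_0_compat|].
      pose proof (kden_bounds alpha x y) as [_ Hd]. pose proof (kden_pos alpha Halpha x y Hx0).
      unfold Rdiv. apply Rmult_le_compat; try lra; [left; now apply Rinv_0_lt_compat|].
      apply Rinv_le_contravar; trivial. nra.
    - apply Rle_trans with (2 := Hf y ltac:(lra)). unfold p0. apply Rmult_le_compat_l; [lra|].
      unfold Rpower. apply exp_le_exp. pose proof (gam_pos alpha Halpha).
      apply Rmult_le_compat_l; [lra|]. left. apply ln_increasing; lra. }
  unfold plus; simpl. lra.
Qed.

(** [f x] is its own transform, hence at least the part of the integral beyond N. *)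
Lemma f_pos_lower (N : R) : exists k, 0 < k /\ forall x, om <= x <= N -> k <= f x.
Proof.
  destruct f_tail_lower as (N0 & HN0 & Hk).
  destruct (Hk (Rmax N N0) (Rmax_r _ _)) as (k & Hk0 & HkN). exists k. split; trivial.
  intros x Hx. destruct (f_sol x ltac:(lra)) as [_ Hf]. rewrite Rplus_0_r in Hf.
  pose proof (Rmax_l N N0). pose proof (Rmax_r N N0).
  apply (tends_le (fun _ => k) _ _ _) with (2 := Hf).
  - intros eps He. exists 0. intros. rewrite Rminus_diag, Rabs_R0. trivial.
  - exists (Rmax N N0 + 1). intros N' HN'.
    rewrite <- (RInt_Chasles (V := R_CompleteNormedModule) _ om (Rmax N N0) N') by (apply kerf_ex; lra).
    specialize (HkN x N' ltac:(lra) HN').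
    assert (0 <= RInt (fun y => ker alpha x y * f y) om (Rmax N N0)).
    { apply RInt_ge_0; [lra | apply kerf_ex; lra|]. intros y Hy.
      apply Rmult_le_pos; [left; apply ker_pos; trivial; lra | apply f_ge_0; lra]. }
    unfold plus; simpl. lra.
Qed.

Lemma f_pos (x : R) : om <= x -> 0 < f x.
Proof. intros Hx. destruct (f_pos_lower x) as (k & Hk & H). specialize (H x ltac:(lra)). lra. Qed.

Lemma f_upper (N : R) : exists F, 0 < F /\ forall x, om <= x <= N -> f x <= F.
Proof.
  destruct (Rle_lt_dec om N) as [HN | HN].
  - assert (Hex : ex_RInt f om N).
    { apply ex_RInt_cont_on; [lra|]. intros y Hy. apply f_cont; lra. }
    destruct (ex_RInt_ub f om N Hex) as [M HM]. rewrite Rmin_left, Rmax_right in HM by lra.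
    exists (Rmax M 1). split; [pose proof (Rmax_r M 1); lra|].
    intros x Hx. apply Rle_trans with (2 := Rmax_l M 1). apply Rle_trans with (2 := HM x Hx).
    apply Rle_abs.
  - exists 1. split; [lra|]. intros x Hx. lra.
Qed.

(** Split the equation for [e] at N: the head is bounded with the constant [mm], the tail with
    [mm / 2]. Compared with [mm * f x] this saves half of [mm] times the tail integral of [f], which
    is at least [k]. *)
Lemma bound_improvement (e : R -> R) (mm N k : R) :
  half_line_solution alpha om e 0 -> om <= N ->
  (forall x N', om <= x <= N -> N + 1 <= N' -> k <= RInt (fun y => ker alpha x y * f y) N N') ->
  0 <= mm -> (forall y, om <= y -> e y <= mm * f y) -> (forall y, N <= y -> e y <= mm / 2 * f y) ->
  forall x, om <= x <= N -> e x <= mm * f x - mm / 2 * k.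
Proof.
  intros He HN Hk Hm H1 H2 x Hx.
  assert (Hx0 : 0 < x) by lra.
  destruct (He x ltac:(lra)) as [[M HM] Hl]. rewrite Rplus_0_r in Hl.
  destruct (f_sol x ltac:(lra)) as [_ Hf]. rewrite Rplus_0_r in Hf.
  assert (Hr : tends (fun N' => mm * RInt (fun y => ker alpha x y * f y) om N' + - (mm / 2 * k)) (mm * f x + - (mm / 2 * k))).
  { apply tends_plus; [now apply tends_scal|].
    intros eps Heps. exists 0. intros. rewrite Rminus_diag, Rabs_R0. trivial. }
  apply (tends_le _ _ _ _ Hl Hr).
  exists (Rmax M (N + 1)). intros N' HN'. pose proof (Rmax_l M (N + 1)). pose proof (Rmax_r M (N + 1)).
  specialize (HM N' ltac:(lra)).
  assert (X1 : ex_RInt (fun y => ker alpha x y * e y) om N).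
  { apply (ex_RInt_Chasles_1 (V := R_CompleteNormedModule)) with N'; trivial. lra. }
  assert (X2 : ex_RInt (fun y => ker alpha x y * e y) N N').
  { apply (ex_RInt_Chasles_2 (V := R_CompleteNormedModule)) with om; trivial. lra. }
  pose proof (kerf_ex x om N Hx0 ltac:(lra)) as Y1. pose proof (kerf_ex x N N' Hx0 ltac:(lra)) as Y2.
  rewrite <- (RInt_Chasles (V := R_CompleteNormedModule) _ om N N' X1 X2).
  rewrite <- (RInt_Chasles (V := R_CompleteNormedModule) _ om N N' Y1 Y2).
  unfold plus; simpl.
  assert (RInt (fun y => ker alpha x y * e y) om N <= mm * RInt (fun y => ker alpha x y * f y) om N).
  { rewrite <- RInt_Rmult by trivial. apply RInt_le; [lra | trivial | now apply (ex_RInt_scal (V := R_NormedModule))|].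
    intros y Hy. specialize (H1 y ltac:(lra)). pose proof (ker_pos alpha Halpha x y Hx0). nra. }
  assert (RInt (fun y => ker alpha x y * e y) N N' <= mm / 2 * RInt (fun y => ker alpha x y * f y) N N').
  { rewrite <- RInt_Rmult by trivial. apply RInt_le; [lra | trivial | now apply (ex_RInt_scal (V := R_NormedModule))|].
    intros y Hy. specialize (H2 y ltac:(lra)). pose proof (ker_pos alpha Halpha x y Hx0). nra. }
  specialize (Hk x N' Hx ltac:(lra)).
  assert (mm / 2 * k <= mm / 2 * RInt (fun y => ker alpha x y * f y) N N') by (apply Rmult_le_compat_l; lra).
  lra.
Qed.

Lemma ratio_small (e : R -> R) (eps : R) : tends (fun y => Rpower y (- gam alpha) * e y) 0 -> 0 < eps ->
  exists N, om <= N /\ forall y, N <= y -> Rabs (e y) <= eps * f y.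
Proof.
  intros He Heps. destruct f_eventually_large as (N0 & HN0 & Hf).
  destruct (He (eps * (c / 2))) as [M HM]; [nra|].
  exists (Rmax M N0). split; [pose proof (Rmax_r M N0); lra|].
  intros y Hy. pose proof (Rmax_l M N0). pose proof (Rmax_r M N0). specialize (HM y ltac:(lra)).
  specialize (Hf y ltac:(lra)). rewrite Rminus_0_r, Rpower_Ropp, Rabs_mult in HM.
  assert (HP : 0 < Rpower y (gam alpha)) by apply exp_pos.
  set (P := Rpower y (gam alpha)) in *.
  rewrite (Rabs_pos_eq (/ P)) in HM by (left; now apply Rinv_0_lt_compat).
  apply Rmult_lt_compat_r with (r := P) in HM; trivial.
  replace (/ P * Rabs (e y) * P) with (Rabs (e y)) in HM by (field; lra).
  apply Rle_trans with (eps * (c / 2 * P)); [lra|]. apply Rmult_le_compat_l; lra.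
Qed.

Lemma half_line_solution_opp (e : R -> R) :
  half_line_solution alpha om e 0 -> half_line_solution alpha om (fun y => - e y) 0.
Proof.
  intros He x Hx. destruct (He x Hx) as [[M HM] Hl].
  assert (E : forall N, M <= N -> is_RInt (fun y => ker alpha x y * - e y) om N
                                  (- RInt (fun y => ker alpha x y * e y) om N)).
  { intros N HN. apply (is_RInt_ext (V := R_NormedModule) (fun y => opp (ker alpha x y * e y))).
    - intros y _. unfold opp; simpl. req. ring.
    - apply (is_RInt_opp (V := R_NormedModule)), RInt_R_correct, HM, HN. }
  split.
  - exists M. intros N HN. eexists. now apply E.
  - rewrite Rplus_0_r in *. intros eps Heps. destruct (Hl eps Heps) as [M' HM'].
    exists (Rmax M M'). intros N HN. pose proof (Rmax_l M M'). pose proof (Rmax_r M M').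
    rewrite (is_RInt_unique _ _ _ _ (E N ltac:(lra))). specialize (HM' N ltac:(lra)).
    rewrite <- Rabs_Ropp. replace (- (- RInt (fun y => ker alpha x y * e y) om N - - e x))
      with (RInt (fun y => ker alpha x y * e y) om N - e x) by ring. trivial.
Qed.

(* The ratio [|e| / f] would have a positive supremum; as it tends to [0] at infinity, the mass that
   the kernel puts near infinity strictly lowers that supremum. *)
Lemma homogeneous_unique (e : R -> R) :
  half_line_solution alpha om e 0 -> tends (fun y => Rpower y (- gam alpha) * e y) 0 ->
  forall x, om <= x -> e x = 0.
Proof.
  intros He Hlim.
  (* Near infinity the ratio is below 1. On the remaining compact part no continuity of [e] is
     available; boundedness is extracted from the Riemann integrability of [ker alpha om y * e y],
     the kernel being bounded below. *)
  assert (Hbound : exists B, forall y, om <= y -> Rabs (e y) <= B * f y).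
  { destruct (ratio_small e 1 Hlim ltac:(lra)) as (N & HN & Hr).
    destruct (He om ltac:(lra)) as [[M HM] _].
    set (N' := Rmax M N). assert (HN1 : M <= N') by apply Rmax_l. assert (HN2 : N <= N') by apply Rmax_r.
    destruct (ex_RInt_ub _ _ _ (HM N' HN1)) as [b Hb]. rewrite Rmin_left, Rmax_right in Hb by lra.
    destruct (f_pos_lower N') as (k & Hk & Hfk).
    assert (Hker : exists k0, 0 < k0 /\ forall y, om <= y <= N' -> k0 <= ker alpha om y).
    { pose proof PI_RGT_0 as HPI. pose proof (sin_theta_pos alpha Halpha) as Hs.
      assert (Hs' : 0 < sin (theta alpha) / PI) by now apply Rdiv_lt_0_compat.
      exists (sin (theta alpha) / PI * (om / (2 * (om ^ 2 + N' ^ 2)))).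
      assert (HD : 0 < 2 * (om ^ 2 + N' ^ 2)) by nra.
      split; [apply Rmult_lt_0_compat; trivial; now apply Rdiv_lt_0_compat|].
      intros y Hy. unfold ker. apply Rmult_le_compat_l; [lra|].
      pose proof (kden_bounds alpha om y) as [_ Hd]. pose proof (kden_pos alpha Halpha om y Hom).
      unfold Rdiv. apply Rmult_le_compat_l; [lra|]. apply Rinv_le_contravar; trivial. nra. }
    destruct Hker as (k0 & Hk0 & Hker).
    assert (Hb0 : 0 <= b).
    { eapply Rle_trans; [apply Rabs_pos | apply (Hb om); lra]. }
    exists (Rmax 1 (b / k0 / k)). intros y Hy.
    pose proof (f_ge_0 y Hy).
    destruct (Rle_lt_dec N y) as [Hy' | Hy'].
    - apply Rle_trans with (1 := Hr y Hy'). apply Rmult_le_compat_r; trivial. apply Rmax_l.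
    - apply Rle_trans with (b / k0 / k * f y).
      + specialize (Hb y ltac:(lra)). specialize (Hker y ltac:(lra)). specialize (Hfk y ltac:(lra)).
        change (Rabs (ker alpha om y * e y) <= b) in Hb. rewrite Rabs_mult, (Rabs_pos_eq (ker alpha om y)) in Hb by lra.
        assert (k0 * Rabs (e y) <= b).
        { apply Rle_trans with (2 := Hb). apply Rmult_le_compat_r; trivial. apply Rabs_pos. }
        apply Rle_trans with (b / k0).
        * apply Rmult_le_reg_l with k0; trivial. replace (k0 * (b / k0)) with b by (field; lra). trivial.
        * replace (b / k0) with (b / k0 / k * k) at 1 by (field; lra). apply Rmult_le_compat_l; trivial.
          apply Rdiv_le_0_compat; trivial. apply Rdiv_le_0_compat; trivial.
      + apply Rmult_le_compat_r; trivial. apply Rmax_r. }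
  destruct Hbound as [B HB].
  destruct (completeness (fun v => exists y, om <= y /\ v = Rabs (e y) / f y)) as [s [Hs1 Hs2]].
  - exists B. intros v (y & Hy & ->). pose proof (f_pos y Hy).
    apply Rmult_le_reg_r with (f y); trivial. unfold Rdiv. rewrite Rmult_assoc, Rinv_l, Rmult_1_r by lra. now apply HB.
  - exists (Rabs (e om) / f om), om. split; [lra | reflexivity].
  - assert (Hs : forall y, om <= y -> Rabs (e y) <= s * f y).
    { intros y Hy. pose proof (f_pos y Hy). specialize (Hs1 (Rabs (e y) / f y)).
      replace (Rabs (e y)) with (Rabs (e y) / f y * f y) by (field; lra).
      apply Rmult_le_compat_r; [lra|]. apply Hs1. exists y. auto. }
    destruct (Rle_lt_dec s 0) as [Hs0 | Hs0].
    { intros x Hx. specialize (Hs x Hx). pose proof (f_pos x Hx).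
      pose proof (Rabs_pos (e x)). apply Rabs_eq_0. nra. }
    exfalso.
    destruct (ratio_small e (s / 2) Hlim ltac:(lra)) as (N1 & HN1 & Hr).
    destruct f_tail_lower as (N0 & HN0 & Hk).
    set (N := Rmax N1 N0). assert (N1 <= N) by apply Rmax_l. assert (N0 <= N) by apply Rmax_r.
    destruct (Hk N ltac:(lra)) as (k & Hk0 & HkN).
    destruct (f_upper N) as (F & HF & HFN).
    assert (I1 : forall x, om <= x <= N -> Rabs (e x) <= s * f x - s / 2 * k).
    { intros x Hx.
      assert (A1 : e x <= s * f x - s / 2 * k).
      { apply (bound_improvement e s N k); trivial; try lra.
        - intros y Hy. apply Rle_trans with (2 := Hs y Hy). apply Rle_abs.
        - intros y Hy. apply Rle_trans with (2 := Hr y ltac:(lra)). apply Rle_abs. }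
      assert (A2 : - e x <= s * f x - s / 2 * k).
      { apply (bound_improvement (fun y => - e y) s N k); trivial; try lra.
        - now apply half_line_solution_opp.
        - intros y Hy. apply Rle_trans with (2 := Hs y Hy). rewrite <- Rabs_Ropp. apply Rle_abs.
        - intros y Hy. apply Rle_trans with (2 := Hr y ltac:(lra)). rewrite <- Rabs_Ropp. apply Rle_abs. }
      apply Rabs_le. lra. }
    (* The improved bound: s/2 beyond N, and before N the saving (s/2) k rewritten relative to [f]
       through [f <= F]. *)
    set (s' := Rmax (s / 2) (s - s / 2 * (k / F))).
    assert (Hkf : 0 < k / F) by now apply Rdiv_lt_0_compat.
    assert (Hlt : s' < s).
    { unfold s'. apply Rmax_lub_lt; nra. }
    assert (s <= s'); [|lra].
    apply Hs2. intros v (y & Hy & ->). pose proof (f_pos y Hy).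
    apply Rmult_le_reg_r with (f y); trivial. unfold Rdiv at 1. rewrite Rmult_assoc, Rinv_l, Rmult_1_r by lra.
    destruct (Rle_lt_dec N y) as [Hy' | Hy'].
    + apply Rle_trans with (1 := Hr y ltac:(lra)). apply Rmult_le_compat_r; [lra|]. apply Rmax_l.
    + apply Rle_trans with (1 := I1 y ltac:(lra)).
      apply Rle_trans with ((s - s / 2 * (k / F)) * f y); [|apply Rmult_le_compat_r; [lra | apply Rmax_r]].
      specialize (HFN y ltac:(lra)).
      assert (k / F * f y <= k).
      { apply Rle_trans with (k / F * F); [apply Rmult_le_compat_l; lra|]. right. field. lra. }
      nra.
Qed.

End Unique.

(** * The linearised equation *)

Section Final.
Variables alpha omega : R.
Hypothesis Halpha : 1 < alpha.
Hypothesis Homega : 0 < omega.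
Let r := rho alpha / omega.

Lemma ratio_pos : 0 < r.
Proof. apply Rdiv_lt_0_compat; [now apply rho_pos | trivial]. Qed.

Lemma ratio_omega : r * omega = rho alpha.
Proof. unfold r. field. lra. Qed.

Lemma ratio_ge (x : R) : omega <= x -> rho alpha <= r * x.
Proof. intros Hx. pose proof ratio_pos. rewrite <- ratio_omega. apply Rmult_le_compat_l; lra. Qed.

Lemma ker_homogeneous (x y : R) : 0 < x -> r * ker alpha (r * x) (r * y) = ker alpha x y.
Proof.
  intros Hx. pose proof ratio_pos. pose proof PI_RGT_0. pose proof (kden_pos alpha Halpha x y Hx) as Hd.
  unfold ker. replace (kden alpha (r * x) (r * y)) with (r ^ 2 * kden alpha x y) by (unfold kden; ring).
  field. repeat split; lra.
Qed.

(** The kernel is homogeneous of degree -1, so the dilation by [r = rho / omega] carries solutions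
    on [rho, +oo) to solutions on [omega, +oo) with the same constant. *)
Lemma half_line_rescale (g : R -> R) (v c : R) :
  (forall u : R, rho alpha <= u -> continuous g u) ->
  (forall x, rho alpha <= x -> tends (fun N => RInt (fun u => ker alpha x u * g u) (rho alpha) N) (v * g x + c)) ->
  forall x, omega <= x ->
    (forall N, omega <= N -> ex_RInt (fun y => ker alpha x y * g (r * y)) omega N) /\
    tends (fun N => RInt (fun y => ker alpha x y * g (r * y)) omega N) (v * g (r * x) + c).
Proof.
  intros Cg Hg x Hx. pose proof ratio_pos as Hr. pose proof (rho_pos alpha Halpha) as Hrho.
  assert (Hx0 : 0 < x) by lra.
  assert (E : forall N, omega <= N -> is_RInt (fun y => ker alpha x y * g (r * y)) omega N
            (RInt (fun u => ker alpha (r * x) u * g u) (rho alpha) (r * N))).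
  { intros N HN.
    apply (is_RInt_ext (V := R_NormedModule) (fun y => scal r (ker alpha (r * x) (r * y + 0) * g (r * y + 0)))).
    - intros y _. unfold scal; simpl. unfold mult; simpl. rewrite Rplus_0_r.
      rewrite <- (ker_homogeneous x y) by trivial. req. ring.
    - apply (is_RInt_comp_lin (V := R_NormedModule) (fun u => ker alpha (r * x) u * g u)).
      rewrite !Rplus_0_r, ratio_omega.
      apply RInt_R_correct, (ex_RInt_continuous (V := R_CompleteNormedModule)).
      pose proof (ratio_ge N HN). rewrite Rmin_left, Rmax_right by lra. intros u Hu.
      apply (cont_mult (fun u => ker alpha (r * x) u)); [|apply Cg; lra].
      apply ker_cont; trivial. nra. }
  split.
  - intros N HN. eexists. now apply E.
  - intros eps He. destruct (Hg (r * x) (ratio_ge x Hx) eps He) as [M HM].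
    exists (Rmax omega (M / r)). intros N HN.
    pose proof (Rmax_l omega (M / r)). pose proof (Rmax_r omega (M / r)).
    rewrite (is_RInt_unique _ _ _ _ (E N ltac:(lra))). apply HM.
    replace M with (r * (M / r)) by (field; lra). apply Rmult_le_compat_l; lra.
Qed.

Lemma tends_rescale (g : R -> R) (l : R) : tends (fun x => Rpower x (- gam alpha) * g x) l ->
  tends (fun x => Rpower x (- gam alpha) * g (r * x)) (Rpower r (gam alpha) * l).
Proof.
  intros H. pose proof ratio_pos as Hr.
  apply (tends_scal _ _ (Rpower r (gam alpha))) in H.
  intros eps He. destruct (H eps He) as [M HM]. exists (Rmax 1 (M / r)). intros x Hx.
  pose proof (Rmax_l 1 (M / r)). pose proof (Rmax_r 1 (M / r)).
  assert (HMx : M <= r * x).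
  { replace M with (r * (M / r)) by (field; lra). apply Rmult_le_compat_l; lra. }
  specialize (HM (r * x) HMx).
  rewrite <- Rpower_mult_distr, Rpower_Ropp in HM by lra.
  replace (Rpower x (- gam alpha) * g (r * x))
    with (Rpower r (gam alpha) * (/ Rpower r (gam alpha) * Rpower x (- gam alpha) * g (r * x))); trivial.
  assert (0 < Rpower r (gam alpha)) by apply exp_pos. field. lra.
Qed.

Lemma tau_derive (xi : R) : 1 < xi ->
  is_derive (tau alpha) xi (2 * (1 + alpha) * (rho alpha * T1 alpha (rho alpha * xi))).
Proof.
  intros Hxi. pose proof (rho_pos alpha Halpha) as Hr. unfold tau.
  apply (is_derive_scal (fun xi => S alpha (rho alpha * xi)) xi (2 * (1 + alpha))).
  apply (is_derive_comp (V := R_NormedModule) (S alpha) (fun xi => rho alpha * xi) xi (T1 alpha (rho alpha * xi)) (rho alpha)).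
  - apply S_derive; trivial. nra.
  - auto_derive; trivial. req. ring.
Qed.

Variable p : R.
Let G := Rpower (omega / Aconst alpha) (gam alpha).
(** [lbar] in the variable u = rho xi, with the derivative of [tau] expressed by [T1]. In this form
    it is continuous down to u = rho, which gives the value at xi = 1 its meaning. *)
Let L (u : R) := 2 * (1 + alpha) * (p * S alpha u - / gam alpha * (p - G) * (u * T1 alpha u)).

Lemma L_continuous (u : R) : rho alpha <= u -> continuous L u.
Proof.
  intros Hu. pose proof (rho_pos alpha Halpha). unfold L. apply cont_scal, cont_minus.
  - apply cont_scal. now apply S_continuous.
  - apply cont_scal. apply (cont_mult (fun u => u)); [apply continuous_id|].
    apply T1_continuous; trivial. lra.
Qed.

Lemma lbar_L (xi : R) : 1 < xi -> lbar alpha omega p xi = L (rho alpha * xi).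
Proof.
  intros Hxi. unfold lbar, Dtau. rewrite (is_derive_unique _ _ _ (tau_derive xi Hxi)).
  unfold tau, L. fold G. pose proof (gam_pos alpha Halpha).
  replace (2 * alpha / (1 + alpha)) with (/ gam alpha) by (unfold gam; field; lra). ring.
Qed.

(** S vanishes at rho and [T1] equals [slope]; the exponentials at [tmin] in [rho] and [slope]
    cancel, leaving 2 (1 + alpha) divided by its square root. *)
Lemma L_rho : L (rho alpha) = sqrt (2 * (1 + alpha)) * (G - p).
Proof.
  unfold L. rewrite S_eq_0, T1_rho by (trivial; lra). unfold slope.
  rewrite (rho_scale alpha Halpha). rewrite (Rplus_comm alpha 1).
  assert (Hs : 0 < sqrt (2 * (1 + alpha))) by (apply sqrt_lt_R0; lra).
  assert (Hs2 : sqrt (2 * (1 + alpha)) * sqrt (2 * (1 + alpha)) = 2 * (1 + alpha)) by (apply sqrt_sqrt; lra).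
  assert (He : exp (-2 * tmin alpha) * exp (2 * tmin alpha) = 1).
  { rewrite <- exp_plus. replace (-2 * tmin alpha + 2 * tmin alpha) with 0 by ring. apply exp_0. }
  set (q := sqrt (2 * (1 + alpha))) in *. unfold gam.
  replace (2 * (1 + alpha) * (p * 0 - / ((1 + alpha) / (2 * alpha)) * (p - G) *
     ((1 + alpha) / alpha * exp (-2 * tmin alpha) * (exp (2 * tmin alpha) / (2 * q)))))
    with (2 * (1 + alpha) * (G - p) * (exp (-2 * tmin alpha) * exp (2 * tmin alpha)) / q) by (field; lra).
  rewrite He, <- Hs2. field. lra.
Qed.

(** A linear combination of the two equations; only the S part has a forcing, and 2 (1 + alpha) p /
    (1 + alpha) = 2 p. *)
Lemma L_equation (x : R) : rho alpha <= x ->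
  tends (fun N => RInt (fun u => ker alpha x u * L u) (rho alpha) N) (1 * L x + 2 * p).
Proof.
  intros Hx. pose proof (rho_pos alpha Halpha) as Hrho. assert (Hx0 : 0 < x) by lra.
  set (k := - (/ gam alpha * (p - G))).
  assert (E : forall N, rho alpha <= N -> RInt (fun u => ker alpha x u * L u) (rho alpha) N
    = 2 * (1 + alpha) * (p * RInt (fun u => ker alpha x u * S alpha u) (rho alpha) N
        + k * RInt (fun u => ker alpha x u * (u * T1 alpha u)) (rho alpha) N)).
  { intros N HN.
    assert (X1 : ex_RInt (fun u => ker alpha x u * S alpha u) (rho alpha) N).
    { apply ex_RInt_cont. intros; now apply kerS_cont. }
    assert (X2 : ex_RInt (fun u => ker alpha x u * (u * T1 alpha u)) (rho alpha) N).
    { apply ex_RInt_cont_on; [lra|]. intros y Hy.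
      apply (cont_mult (fun y => ker alpha x y)); [now apply ker_cont|].
      apply (cont_mult (fun y => y)); [apply continuous_id | apply T1_continuous; trivial; lra]. }
    assert (Z1 : ex_RInt (fun u => p * (ker alpha x u * S alpha u)) (rho alpha) N)
      by exact (ex_RInt_scal (V := R_NormedModule) _ _ _ p X1).
    assert (Z2 : ex_RInt (fun u => k * (ker alpha x u * (u * T1 alpha u))) (rho alpha) N)
      by exact (ex_RInt_scal (V := R_NormedModule) _ _ _ k X2).
    rewrite <- (RInt_Rmult _ _ _ p X1), <- (RInt_Rmult _ _ _ k X2).
    rewrite <- (RInt_Rplus _ _ _ _ Z1 Z2).
    rewrite <- RInt_Rmult by exact (ex_RInt_plus (V := R_NormedModule) _ _ _ _ Z1 Z2).
    apply RInt_ext. intros u _. unfold L, k. req. ring. }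
  assert (H1 := tends_scal _ _ (2 * (1 + alpha))
    (tends_plus _ _ _ _ (tends_scal _ _ p (inhomogeneous_equation alpha Halpha x Hx))
                        (tends_scal _ _ k (homogeneous_equation alpha Halpha x Hx0)))).
  simpl in H1. intros eps He. destruct (H1 eps He) as [M HM].
  exists (Rmax M (rho alpha)). intros N HN. pose proof (Rmax_l M (rho alpha)). pose proof (Rmax_r M (rho alpha)).
  rewrite E by lra. specialize (HM N ltac:(lra)).
  replace (1 * L x + 2 * p) with (2 * (1 + alpha) * (p * (S alpha x + / (1 + alpha)) + k * (x * T1 alpha x))); trivial.
  unfold L, k. field. pose proof (gam_pos alpha Halpha). lra.
Qed.

(** Since u S' is asymptotic to gam S, the factor 1 / gam makes the contributions of p cancel and
    leaves 2 (1 + alpha) G S; G and the constant [Aconst] are tuned so that its growth constant,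
    after rescaling, is 1. *)
Lemma L_normalised : tends (fun x => Rpower x (- gam alpha) * L (r * x)) 1.
Proof.
  pose proof ratio_pos as Hr. pose proof (rho_pos alpha Halpha) as Hrho. pose proof (gam_pos alpha Halpha) as Hg.
  pose proof PI_RGT_0 as HPI. pose proof (profile_mass_pos alpha Halpha) as HI.
  assert (HA : 0 < Aconst alpha) by (apply Rmult_lt_0_compat; [lra | apply exp_pos]).
  assert (H1 := tends_scal _ _ (2 * (1 + alpha))
    (tends_plus _ _ _ _ (tends_scal _ _ p (S_asymptotic alpha Halpha))
                        (tends_scal _ _ (- (/ gam alpha * (p - G))) (T1_asymptotic alpha Halpha)))).
  simpl in H1.
  assert (H2 : tends (fun x => Rpower x (- gam alpha) * L x) (2 * (1 + alpha) * G * (profile_mass alpha / PI))).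
  { intros eps He. destruct (H1 eps He) as [M HM]. exists M. intros x Hx. specialize (HM x Hx).
    replace (Rpower x (- gam alpha) * L x - 2 * (1 + alpha) * G * (profile_mass alpha / PI))
      with (2 * (1 + alpha) * (p * (Rpower x (- gam alpha) * S alpha x) +
              - (/ gam alpha * (p - G)) * (Rpower x (- gam alpha) * (x * T1 alpha x)))
            - 2 * (1 + alpha) * (p * (profile_mass alpha / PI) + - (/ gam alpha * (p - G)) * (gam alpha * (profile_mass alpha / PI)))); trivial.
    unfold L. field. lra. }
  apply tends_rescale in H2.
  replace 1 with (Rpower r (gam alpha) * (2 * (1 + alpha) * G * (profile_mass alpha / PI))); trivial.
  unfold r, G, Rdiv at 1.
  assert (HAg := Aconst_profile_mass alpha Halpha).
  assert (P1 : 0 < Rpower (rho alpha) (gam alpha)) by apply exp_pos.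
  assert (P2 : 0 < Rpower omega (gam alpha)) by apply exp_pos.
  rewrite <- Rpower_mult_distr by (trivial; now apply Rinv_0_lt_compat).
  unfold Rdiv at 1. rewrite <- Rpower_mult_distr by (trivial; now apply Rinv_0_lt_compat).
  assert (Einv : forall z, 0 < z -> Rpower (/ z) (gam alpha) = / Rpower z (gam alpha)).
  { intros z Hz. rewrite <- Rpower_Ropp. unfold Rpower. rewrite ln_Rinv by trivial. f_equal. ring. }
  rewrite !Einv, HAg by trivial. field. repeat split; lra.
Qed.

End Final.

Theorem theorem2p8 (alpha omega p : R) :
  1 < alpha -> 0 < omega -> 0 <= p ->
  (* tau is differentiable on (1, +oo), so that D_xi tau makes sense there *)
  (forall xi, 1 < xi -> ex_derive (tau alpha) xi) /\
  (* bar l(1) understood as the limit xi -> 1+ *)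
  filterlim (lbar alpha omega p) (at_right 1)
    (locally (sqrt (2 * (1 + alpha)) * (Rpower (omega / Aconst alpha) (gam alpha) - p))) /\
  (* existence, with the explicit formula *)
  (exists l : R -> R,
     solves_eq alpha omega p l /\ normalised alpha l /\
     (forall x, omega < x -> l x = lbar alpha omega p (x / omega)) /\
     l omega = sqrt (2 * (1 + alpha)) * (Rpower (omega / Aconst alpha) (gam alpha) - p)) /\
  (* uniqueness on [omega, +oo) *)
  (forall l1 l2 : R -> R,
     solves_eq alpha omega p l1 -> normalised alpha l1 ->
     solves_eq alpha omega p l2 -> normalised alpha l2 ->
     forall x, omega <= x -> l1 x = l2 x).
Proof.
  intros Ha Hw Hp. pose proof (rho_pos alpha Ha) as Hrho. pose proof (gam_pos alpha Ha) as Hg.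
  pose proof PI_RGT_0 as HPI. pose proof (profile_mass_pos alpha Ha) as HI.
  pose proof (ratio_pos alpha omega Ha Hw) as Hr. pose proof (ratio_omega alpha omega Hw) as Hrw.
  set (L := fun u => 2 * (1 + alpha) * (p * S alpha u
     - / gam alpha * (p - Rpower (omega / Aconst alpha) (gam alpha)) * (u * T1 alpha u))).
  pose proof (L_rho alpha omega Ha p) as HLr.
  split; [|split; [|split]].
  - intros xi Hxi. eexists. now apply tau_derive.
  - apply (filterlim_ext_loc (fun xi => L (rho alpha * xi))).
    + exists (mkposreal 1 Rlt_0_1). intros xi _ Hxi. symmetry. now apply lbar_L.
    + rewrite <- HLr.
      apply (filterlim_filter_le_1 (F := locally 1)); [apply filter_le_within|].
      assert (C : continuous (fun xi => L (rho alpha * xi)) 1).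
      { apply (continuous_comp (fun xi => rho alpha * xi) L).
        - apply cont_scal, continuous_id.
        - apply (L_continuous alpha omega Ha p). lra. }
      unfold continuous in C. rewrite Rmult_1_r in C. exact C.
  (* The solution is given by [L] and not by [lbar], as [tau] has a corner at 1 and [Derive] carries
     no meaning at x = omega. *)
  - exists (fun x => L (rho alpha / omega * x)). split; [|split; [|split]].
    + intros x Hx.
      destruct (half_line_rescale alpha omega Ha Hw L 1 (2 * p) (L_continuous alpha omega Ha p)
        (L_equation alpha omega Ha p) x Hx) as [Hex Ht].
      rewrite Rmult_1_l in Ht.
      apply (is_RInt_gen_ext (fun y => ker alpha x y * L (rho alpha / omega * y))).
      * apply (Filter_prod _ _ _ (fun a => a = omega) (fun b => omega < b)); [reflexivity | exists omega; auto|].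
        intros a b -> Hb. simpl. rewrite Rmin_left by lra. intros y Hy.
        rewrite <- K_ker by (trivial; lra). req. field. lra.
      * now apply is_RInt_gen_tends.
    + apply tends_is_lim. exact (L_normalised alpha omega Ha Hw p).
    + intros x Hx. rewrite (lbar_L alpha omega Ha p).
      * replace (rho alpha * (x / omega)) with (rho alpha / omega * x) by (field; lra). reflexivity.
      * apply Rmult_lt_reg_r with omega; trivial. unfold Rdiv. rewrite Rmult_assoc, Rinv_l; lra.
    + rewrite Hrw. exact HLr.
  - intros l1 l2 S1 N1 S2 N2 x Hx.
    (* The comparison solution: x S'(x), dilated to start at omega. *)
    set (f := fun y => (rho alpha / omega * y) * T1 alpha (rho alpha / omega * y)).
    assert (Cf : forall u : R, rho alpha <= u -> continuous (fun u => u * T1 alpha u) u).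
    { intros u Hu. apply (cont_mult (fun u => u)); [apply continuous_id|].
      apply T1_continuous; trivial. lra. }
    assert (Hrescale := half_line_rescale alpha omega Ha Hw (fun u => u * T1 alpha u) 1 0 Cf).
    assert (Hhom : forall x, rho alpha <= x ->
      tends (fun N => RInt (fun u => ker alpha x u * (u * T1 alpha u)) (rho alpha) N) (1 * (x * T1 alpha x) + 0)).
    { intros z Hz. rewrite Rmult_1_l, Rplus_0_r. apply homogeneous_equation; trivial. lra. }
    specialize (Hrescale Hhom).
    apply Rminus_diag_uniq.
    apply (homogeneous_unique alpha omega Ha Hw f) with (c := Rpower (rho alpha / omega) (gam alpha) * (gam alpha * (profile_mass alpha / PI)))
      (e := fun y => l1 y - l2 y); trivial.
    + intros y Hy. unfold f. apply (continuous_comp (fun y => rho alpha / omega * y) (fun u => u * T1 alpha u)).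
      * apply cont_scal, continuous_id.
      * apply Cf. now apply (ratio_ge alpha omega Ha Hw).
    + intros y Hy. pose proof (ratio_ge alpha omega Ha Hw y Hy). unfold f. apply Rmult_le_pos; [lra|].
      now apply T1_ge_0.
    + intros z Hz. destruct (Hrescale z Hz) as [Hex Ht]. split.
      * exists omega. exact Hex.
      * rewrite Rmult_1_l in Ht. exact Ht.
    + apply Rmult_lt_0_compat; [apply exp_pos|]. apply Rmult_lt_0_compat; trivial. now apply Rdiv_lt_0_compat.
    + apply (tends_rescale alpha omega Ha Hw (fun u => u * T1 alpha u)). now apply T1_asymptotic.
    + intros z Hz.
      (* The forcing 2 p cancels in the difference of the two equations. *)
      assert (Hd := is_RInt_gen_minus (V := R_NormedModule) _ _ _ _ (S1 z Hz) (S2 z Hz)).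
      apply (is_RInt_gen_ext _ (fun y => ker alpha z y * (l1 y - l2 y))) in Hd.
      * apply is_RInt_gen_tends_inv in Hd. destruct Hd as [Hex Ht]. split; trivial.
        replace (l1 z - l2 z + 0) with (minus (l1 z + 2 * p) (l2 z + 2 * p)); trivial.
        unfold minus, plus, opp; simpl. ring.
      * apply (Filter_prod _ _ _ (fun a => a = omega) (fun b => omega < b)); [reflexivity | exists omega; auto|].
        intros a b -> Hb. simpl. rewrite Rmin_left by lra. intros y Hy.
        rewrite <- K_ker by (trivial; lra). unfold minus, plus, opp; simpl. req. field. lra.
    + assert (Hd := tends_plus _ _ _ _ (proj2 (tends_is_lim _ _) N1) (tends_scal _ _ (-1) (proj2 (tends_is_lim _ _) N2))).
      intros eps He. destruct (Hd eps He) as [M HM]. exists M. intros y Hy. specialize (HM y Hy).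
      replace (Rpower y (- gam alpha) * (l1 y - l2 y) - 0)
        with (Rpower y (- gam alpha) * l1 y + -1 * (Rpower y (- gam alpha) * l2 y) - (1 + -1 * 1)) by ring. trivial.
Qed.
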